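(* Let $K$ be the Sierpiński gasket equipped with its geodesic metric $d$ and normalized Hausdorff measure $\mu$, and let $d_h=\frac{\log3}{\log2}$. For every $p>1$ there exists a constant $C>0$ such that the following Nash inequality holds for every $f\in KS^{\alpha_p,p}(K)$: $$\|f\|_{L^p(K,\mu)}\le C\left(\|f\|_{L^p(K,\mu)}+\mathrm{Var}_p(f)\right)^\theta\|f\|_{L^1(K,\mu)}^{1-\theta},\qquad \theta=\frac{(p-1)d_h}{p(\alpha_p+d_h)-d_h}.$$ For $p=1$, there exists a constant $C>0$ such that for every $f\in KS^{d_h,1}(K)$, $$\|f\|_{L^\infty(K,\mu)}\le C\left(\|f\|_{L^1(K,\mu)}+\mathrm{Var}_1(f)\right).$$
   Context: Sierpiński gasket: let $q_1,q_2,q_3$ be the vertices of an equilateral triangle of side $1$ in $\mathbb C$, $\psi_i(z)=\frac{z-q_i}2+q_i$, $i=1,2,3$; $K$ is the unique non-empty compact subset of $\mathbb C$ with $K=\bigcup_{i=1}^3\psi_i(K)$. $d$ is the geodesic metric on $K$ and $\mu$ is the unique Borel measure on $K$ with $\mu(\psi_{i_1}\circ\cdots\circ\psi_{i_n}(K))=3^{-n}$ for all $i_1,\dots,i_n\in\{1,2,3\}$. Let $B(x,r)=\{y\in K:d(x,y)<r\}$. For $p\ge1$, $\alpha\ge0$, $r>0$, $f\in L^p(K,\mu)$ put $$E_{p,\alpha}(f,r)=\int_K\frac{1}{\mu(B(x,r))}\int_{B(x,r)}\frac{|f(y)-f(x)|^p}{r^{p\alpha}}\,d\mu(y)\,d\mu(x).$$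 $\mathcal B^{\alpha,p}(K)=\{f\in L^p(K,\mu):\sup_{r>0}E_{p,\alpha}(f,r)<+\infty\}$, $KS^{\alpha,p}(K)=\{f\in L^p(K,\mu):\limsup_{r\to0}E_{p,\alpha}(f,r)<+\infty\}$. ''Constant'' means constant $\mu$-a.e. $\alpha_p=\sup\{\alpha\ge0:\mathcal B^{\alpha,p}(K)\text{ contains non-constant functions}\}$; on the Sierpiński gasket it is known that $\alpha_1=d_h$ and $\frac{d_h}p<\alpha_p\le1+\frac{d_h-1}p$ for $p>1$. $\mathrm{Var}_p(f)=\liminf_{r\to0}E_{p,\alpha_p}(f,r)^{1/p}$. *)

(* Defs.v *)
From HB Require Import structures.
From mathcomp Require Import all_boot all_order all_algebra.
From mathcomp Require Import all_classical all_reals all_analysis.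

Set Implicit Arguments.
Unset Strict Implicit.
Unset Printing Implicit Defensive.

Import Order.TTheory GRing.Theory Num.Theory.
Import numFieldNormedType.Exports.

Local Open Scope classical_set_scope.
Local Open Scope ring_scope.

(* The complex plane as R * R: vector-space structure, topology and Borel
   sigma-algebra are those of the product.  The library norm on R * R is the
   max norm, so the Euclidean distance is spelled out. *)

Section Gasket.
Context {R : realType}.

Definition euclid_dist (x y : R * R) : R :=
  Num.sqrt ((x.1 - y.1) ^+ 2 + (x.2 - y.2) ^+ 2).

Definition unit_equilateral (q : 'I_3 -> R * R) : Prop :=
  forall i j, i != j -> euclid_dist (q i) (q j) = 1.

Definition gasket_map (q : 'I_3 -> R * R) (i : 'I_3) (z : R * R) : R * R :=
  2^-1 *: (z - q i) + q i.

Definition is_gasket (q : 'I_3 -> R * R) (K : set (R * R)) : Prop :=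
  [/\ K !=set0, compact K &
      K = \bigcup_(i in [set: 'I_3]) (gasket_map q i @` K)].

(* gasket_map q i_1 \o ... \o gasket_map q i_n for w = [:: i_1; ...; i_n] *)
Definition gasket_word_map (q : 'I_3 -> R * R) (w : seq 'I_3) :
    R * R -> R * R :=
  foldr (fun i g => gasket_map q i \o g) idfun w.

(* Borel measures on K are represented by Borel measures on the plane that
   vanish outside K. *)
Definition is_gasket_measure (q : 'I_3 -> R * R) (K : set (R * R))
    (mu : {measure set (R * R)%type -> \bar R}) : Prop :=
  mu (~` K) = 0%E /\
  forall w : seq 'I_3,
    mu (gasket_word_map q w @` K) = (3 ^- size w)%:E.

Definition hausdorff_dim : R := ln 3 / ln 2.

Definition polygonal_length (g : R -> R * R) (a b : R) (s : seq R) : R :=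
  \sum_(0 <= i < size s)
    euclid_dist (g (nth b (a :: s) i)) (g (nth b (a :: s) i.+1)).

Definition curve_length (g : R -> R * R) : \bar R :=
  ereal_sup [set (polygonal_length g 0 1 s)%:E | s in itv_partition 0 1].

Definition joining_curves (K : set (R * R)) (x y : R * R) :
    set (R -> R * R) :=
  [set g : R -> R * R |
    [/\ {within `[0 : R, 1], continuous g}, g @` `[0 : R, 1] `<=` K,
        g 0 = x & g 1 = y]].

Definition geodesic_dist (K : set (R * R)) (x y : R * R) : \bar R :=
  ereal_inf (curve_length @` joining_curves K x y).

Definition geodesic_ball (K : set (R * R)) (x : R * R) (r : R) :
    set (R * R) :=
  [set y | K y /\ (geodesic_dist K x y < r%:E)%E].

Section Energies.
Variables (K : set (R * R)) (mu : {measure set (R * R)%type -> \bar R}).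

Definition ks_energy (p alpha : R) (f : R * R -> R) (r : R) : \bar R :=
  (\int[mu]_(x in K)
     ((mu (geodesic_ball K x r))^-1 *
      \int[mu]_(y in geodesic_ball K x r)
        (`|f y - f x| `^ p / r `^ (p * alpha))%R%:E))%E.

Definition besov (alpha p : R) : set (R * R -> R) :=
  [set f : R * R -> R | f \in Lfun mu p%:E /\
    (ereal_sup [set ks_energy p alpha f r | r in [set r : R | (0 < r)%R]]
     < +oo)%E].

Definition korevaar_schoen (alpha p : R) : set (R * R -> R) :=
  [set f : R * R -> R | f \in Lfun mu p%:E /\
    (limf_esup (ks_energy p alpha f) 0^'+ < +oo)%E].

Definition ae_constant (f : R * R -> R) : Prop :=
  exists c : R, {ae mu, forall x, f x = c}.

(* The set below contains 0 and is bounded above on the gasket, so that the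
   real supremum is the genuine one. *)
Definition critical_exponent (p : R) : R :=
  sup [set alpha : R | 0 <= alpha /\
         exists f, besov alpha p f /\ ~ ae_constant f].

Definition variation_p (p : R) (f : R * R -> R) : \bar R :=
  limf_einf (fun r => (ks_energy p (critical_exponent p) f r `^ p^-1)%E)
            0^'+.

Definition nash_exponent (p : R) : R :=
  (p - 1) * hausdorff_dim /
  (p * (critical_exponent p + hausdorff_dim) - hausdorff_dim).

End Energies.

End Gasket.

(* Main.v *)
Require Import Defs.
From HB Require Import structures.
From mathcomp Require Import all_boot all_order all_algebra.
From mathcomp Require Import all_classical all_reals all_analysis.
From mathcomp Require Import ring lra.
From mathcomp Require Import perm measurable_realfun measurable_function ess_sup_inf.

(** Write f_n for the function that replaces f, on each of the 3^n cells of
level n, by its average over that cell.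

For p > 1 everything rests on a weak monotonicity of the energies: up to a
constant, the energy at one fine scale controls the fluctuations at all coarser
levels,
  [int |f - f_n|^p <= C 2^(- n p alpha_p) E(f, r)]  for all [r <= 2^(-n-1)]
([fluctuation_le_energy]).  Since the left-hand side does not depend on r, the
liminf over r, that is the p-th power of the variation, may be put on the right.
Jensen's inequality on each cell gives
[int |f_n|^p <= 3^(n (p - 1)) ||f||_1^p] ([powR_integral_split]), and Nash's
inequality follows by choosing the level n that balances the two bounds
([interpolation]).

Weak monotonicity is proved on graphs.  At a scale r comparable with 2^(-n-m),
the geodesic ball around x contains the cell of level n + m of x and its
neighbours, so by Jensen E(f, r) dominates both int |f - f_(n+m)|^p and the
discrete p-energy of the averages of f on the graph of the cells of level n + m
([energy_lower]).  Inside one cell of level n the averages form a function on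
the graph of level m, and what is needed is a resistance estimate: the p-th
power of the oscillation of a function on the graph of level m is at most
[A lambda^m] times its p-energy, with [lambda = 2^(p alpha_p) / 3]
([osc_critical]).  The estimates for all cells of level n add up
([coarse_fluctuation]), and with this value of lambda all powers cancel.

That resistance estimate is where the definition of alpha_p enters.  Suppose
that on the graph of level m some function of small energy takes different
values at two corners.  From it one builds functions with arbitrary values at
the three corners ([corner_functions]), and repeating this construction inside
each cell, then inside each subcell, gives a non-constant function on K
([frac_ext]) whose energies of some exponent are bounded.  This exponent is at
most alpha_p ([critical_exponent_lower]), which says that the energy was not
small after all ([corner_bound]).  The supremum defining alpha_p really is an
upper bound because the exponents are bounded ([critical_set_le]).  Corner
resistances bound all oscillations through a geometric sum ([osc_of_corner]),
which needs lambda > 1; this strict inequality comes from the same construction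
applied to the number of leading letters 0 of an address
([resistance_rate_gt1]), and it is where p > 1 is used.

For p = 1 the indicator of a cell shows that alpha_1 is at least d_h
([critical_exponent1_ge]).  At scale 2^(-n) the factor 1 / r^(d_h) is then
compensated by the mass 3^(-n) of a cell, so E(f, r) dominates the 1-energy of
the averages, hence their oscillation since any two cells are joined by a chain
of neighbours that uses each edge at most once ([osc_energy1]).  Thus f_n is bounded by
||f||_1 + C E(f, r), while int |f - f_n| tends to 0 along scales that realise
the liminf ([fine_scale_bounds1], [sup_inequality]). *)

Set Implicit Arguments.
Unset Strict Implicit.
Unset Printing Implicit Defensive.

Import Order.TTheory GRing.Theory Num.Theory.
Import numFieldNormedType.Exports.

Local Open Scope classical_set_scope.
Local Open Scope ring_scope.

(** * Words and the neighbour map *)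

Notation letter := 'I_3 (only parsing).
Notation word := (seq 'I_3) (only parsing).

Fixpoint words (n : nat) : seq word :=
  if n is n'.+1 then [seq a :: w | a <- enum 'I_3, w <- words n']
  else [:: [::]].

(** The cell of level [size w] that shares with the cell w its corner c, together
with the name of this corner seen from that cell.  An outer corner of K belongs
to a single cell; there the map is taken to be the identity, so that it is a
total involution and sums over all pairs (w, c) need no boundary terms. *)
Fixpoint neighbour (w : word) (c : letter) : word * letter :=
  if w is a :: t then
    if t == nseq (size t) c then
      if a == c then (w, c) else (c :: nseq (size t) a, a)
    else (a :: (neighbour t c).1, (neighbour t c).2)
  else ([::], c).

Section Words.

Lemma mem_words n (w : word) : (w \in words n) = (size w == n).
Proof.
elim: n w => [|n IH] [|a w] //=.
  by apply/negbTE/negP => /allpairsP[[b t] /= [_ _]].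
apply/allpairsP/idP => [[[b t] /= [_ ht [_ ->]]]|/eqP[sw]].
  by rewrite eqSS -IH.
by exists (a, w); rewrite mem_enum IH sw eqxx.
Qed.

Lemma uniq_words n : uniq (words n).
Proof.
elim: n => [//|n IH] /=; apply: allpairs_uniq => //; first exact: enum_uniq.
by move=> [a w] [b t] _ _ /= [-> ->].
Qed.

Lemma size_words n : size (words n) = (3 ^ n)%N.
Proof.
by elim: n => [//|n IH] /=; rewrite size_allpairs size_enum_ord IH expnS.
Qed.

Lemma big_words1 (V : nmodType) n (F : word -> V) :
  \sum_(w <- words n.+1) F w = \sum_a \sum_(w <- words n) F (a :: w).
Proof. by rewrite big_allpairs_dep big_enum. Qed.

Lemma big_words_cat (V : nmodType) n m (F : word -> V) :
  \sum_(w <- words (n + m)) F w =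
  \sum_(v <- words n) \sum_(w <- words m) F (v ++ w).
Proof.
elim: n F => [|n IH] F; first by rewrite big_seq1.
by rewrite addSn !big_words1; apply: eq_bigr => a _; rewrite IH.
Qed.

Lemma eq_big_words (V : nmodType) n (F G : word -> V) :
  (forall w, size w = n -> F w = G w) ->
  \sum_(w <- words n) F w = \sum_(w <- words n) G w.
Proof.
move=> h; rewrite big_seq [RHS]big_seq; apply: eq_bigr => w.
by rewrite mem_words => /eqP; exact: h.
Qed.

Lemma ler_sum_words (R : realType) n (F G : word -> R) :
  (forall w, size w = n -> F w <= G w) ->
  \sum_(w <- words n) F w <= \sum_(w <- words n) G w.
Proof.
move=> h; rewrite big_seq [leRHS]big_seq; apply: ler_sum => w.
by rewrite mem_words => /eqP; exact: h.
Qed.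

Lemma lee_sum_words (R : realType) n (F G : word -> \bar R) :
  (forall w, size w = n -> (F w <= G w)%E) ->
  (\sum_(w <- words n) F w <= \sum_(w <- words n) G w)%E.
Proof.
move=> h; rewrite big_seq [leRHS]big_seq; apply: lee_sum => w.
by rewrite mem_words => /eqP; exact: h.
Qed.

Lemma neighbour_corner n c : neighbour (nseq n c) c = (nseq n c, c).
Proof. by case: n => [//|n] /=; rewrite size_nseq !eqxx. Qed.

Lemma size_neighbour w c : size (neighbour w c).1 = size w.
Proof.
elim: w => [//|a w IH] /=; case: ifP => _; last by rewrite /= IH.
by case: ifP => _ //=; rewrite size_nseq.
Qed.

Lemma neighbourK w c : neighbour (neighbour w c).1 (neighbour w c).2 = (w, c).
Proof.
elim: w c => [//|a w IH] c /=; case: ifPn => [/eqP wc|wc].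
  case: ifPn => [/eqP ->|ac] /=; first by rewrite -wc !eqxx.
  by rewrite size_nseq eqxx eq_sym (negbTE ac) -wc.
rewrite /= size_neighbour IH; case: ifPn => // /eqP h; exfalso.
move: (IH c); rewrite h neighbour_corner => -[e1 e2].
by move: wc; rewrite -{1}e1 e2 eqxx.
Qed.

Lemma nseq_cat_eq (v t : word) c :
  (v ++ t == nseq (size (v ++ t)) c) =
  (v == nseq (size v) c) && (t == nseq (size t) c).
Proof. by rewrite size_cat nseqD eqseq_cat ?size_nseq. Qed.

(** Adjacency is self-similar: crossing a corner of a subcell leaves the cell v
exactly when this corner is also a corner of v. *)
Lemma neighbour_cat v t c :
  neighbour (v ++ t) c =
  if t == nseq (size t) c
  then ((neighbour v c).1 ++ nseq (size t) (neighbour v c).2, (neighbour v c).2)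
  else (v ++ (neighbour t c).1, (neighbour t c).2).
Proof.
elim: v => [|a v IH].
  by rewrite /=; case: eqP => [{1}->|_]; [rewrite neighbour_corner|case: (neighbour t c)].
rewrite [LHS]/= nseq_cat_eq IH.
have [tc|tc] := boolP (t == nseq _ c); last by rewrite andbF.
rewrite andbT /=; case: ifPn => [/eqP vc|vc] //.
case: ifPn => [/eqP ->|ac] /=; first by rewrite -(eqP tc).
by rewrite size_cat nseqD.
Qed.

Lemma neighbour_map (s : {perm 'I_3}) w c :
  neighbour (map s w) (s c) = (map s (neighbour w c).1, s (neighbour w c).2).
Proof.
elim: w => [//|a w IH] /=; rewrite size_map -map_nseq.
rewrite (inj_eq (inj_map perm_inj)) (inj_eq perm_inj).
case: ifP => _; last by rewrite IH.
by case: ifP => _ //=; rewrite !map_nseq.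
Qed.

End Words.

(** * Discrete energies *)

Section DiscreteEnergy.
Context {R : realType}.
Implicit Types (p : R) (u : word -> R).

(** The discrete p-energy of u on the graph of the cells of level m.  Each edge
is counted from both of its ends, which only affects constants, and the three
outer corners contribute 0. *)
Definition energy p m u : R :=
  \sum_(w <- words m) \sum_(c : 'I_3) `|u w - u (neighbour w c).1| `^ p.

Lemma energy_ge0 p m u : 0 <= energy p m u.
Proof. by rewrite sumr_ge0 => // *; rewrite sumr_ge0 => // *; exact: powR_ge0. Qed.

(** The graph of level m + 1 consists of three copies of the graph of level m,
joined by the edges between the cells that meet at a midpoint. *)
Lemma energyS p m u : p != 0 ->
  energy p m.+1 u = \sum_a energy p m (u \o cons a) +
    \sum_a \sum_c `|u (a :: nseq m c) - u (c :: nseq m a)| `^ p.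
Proof.
move=> p0; rewrite /energy big_words1 -big_split /=; apply: eq_bigr => a _.
rewrite exchange_big [in RHS]exchange_big -big_split /=; apply: eq_bigr => c _.
have mc : nseq m c \in words m by rewrite mem_words size_nseq.
rewrite !(bigD1_seq (nseq m c)) ?uniq_words//=.
rewrite size_nseq eqxx neighbour_corner /= subrr normr0 powR0// add0r addrC.
congr (_ + _).
  rewrite !(big_seq_cond (fun i => i != _)); apply: eq_bigr => w /andP[].
  by rewrite mem_words => /eqP -> /negbTE ->.
by case: eqP => [->|].
Qed.

Lemma energy_cat p n m u : p != 0 ->
  \sum_(v <- words n) energy p m (fun w => u (v ++ w)) <= energy p (n + m) u.
Proof.
move=> p0; elim: n u => [|n IH] u; first by rewrite big_seq1.
rewrite big_words1 addSn energyS// -[leLHS]addr0 lerD//.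
  by apply: ler_sum => a _; exact: IH.
by rewrite sumr_ge0 => // *; rewrite sumr_ge0 => // *; exact: powR_ge0.
Qed.

Lemma energy_sub p m u a : p != 0 -> energy p m (u \o cons a) <= energy p m.+1 u.
Proof.
move=> p0; rewrite energyS// (bigD1 a)//= -addrA lerDl addr_ge0//.
  by rewrite sumr_ge0 => // *; exact: energy_ge0.
by rewrite sumr_ge0 => // *; rewrite sumr_ge0 => // *; exact: powR_ge0.
Qed.

Lemma energy_lip p m u (v : word -> R) (K : R) : 0 <= K -> 0 <= p ->
  (forall w w', `|v w - v w'| <= K * `|u w - u w'|) ->
  energy p m v <= K `^ p * energy p m u.
Proof.
move=> K0 p0 h; rewrite mulr_sumr ler_sum// => w _; rewrite mulr_sumr ler_sum// => c _.
by rewrite -powRM// ge0_ler_powR ?nnegrE ?mulr_ge0.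
Qed.

Lemma energy_perm p m u (s : {perm 'I_3}) :
  energy p m (u \o map s) = energy p m u.
Proof.
have h n (F : word -> R) :
    \sum_(w <- words n) F (map s w) = \sum_(w <- words n) F w.
  elim: n F => [|n IH] F; first by rewrite !big_seq1.
  rewrite !big_words1 [RHS](reindex_inj (@perm_inj _ s)) /=.
  by apply: eq_bigr => a _; exact: (IH (fun w => F (s a :: w))).
rewrite /energy -[RHS]h; apply: eq_bigr => w _.
rewrite [RHS](reindex_inj (@perm_inj _ s)) /=; apply: eq_bigr => c _.
by rewrite neighbour_map.
Qed.

(** Two cells are joined by a chain of neighbours through each edge at most once:
inside the two cells of level 1 that contain them, by induction, and through the
midpoint common to those two. *)
Lemma osc_energy1 m u w w' : size w = m -> size w' = m ->
  `|u w - u w'| <= energy 1 m u.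
Proof.
elim: m u w w' => [|m IH] u [|a x] [|b y]//=.
  by rewrite subrr normr0 energy_ge0.
move=> [sx] [sy]; have [<-|ab] := eqVneq a b.
  apply: (le_trans (IH (u \o cons a) x y sx sy)).
  exact: energy_sub.
have h1 := IH (u \o cons a) x (nseq m b) sx (size_nseq _ _).
have h2 := IH (u \o cons b) (nseq m a) y (size_nseq _ _) sy.
have h3 : `|u (a :: nseq m b) - u (b :: nseq m a)| <=
  \sum_a \sum_c `|u (a :: nseq m c) - u (c :: nseq m a)| `^ 1.
  rewrite (bigD1 a)//= (bigD1 b)//= powRr1// -addrA lerDl.
  by rewrite addr_ge0//; rewrite sumr_ge0 => // *;
     rewrite ?sumr_ge0 => // *; exact: powR_ge0.
have h4 : energy 1 m (u \o cons a) + energy 1 m (u \o cons b) <=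
   \sum_a energy 1 m (u \o cons a).
  rewrite (bigD1 a)//= (bigD1 b) 1?eq_sym//= addrA lerDl sumr_ge0 => // *.
  exact: energy_ge0.
rewrite energyS//; move: h1 h2 h3 h4 => /=; set X := u (a :: x); set Y := u (b :: y).
set Z := u (a :: _); set W := u (b :: _).
have := ler_normD (X - Z) (Z - W); have := ler_normD (X - Z + (Z - W)) (W - Y).
have -> : X - Z + (Z - W) + (W - Y) = X - Y by ring.
lra.
Qed.

Lemma powR_root (x p : R) : 0 <= x -> p != 0 -> (x `^ p^-1) `^ p = x.
Proof. by move=> x0 p0; rewrite -powRrM mulVf// powRr1. Qed.

Lemma le_powR_root (x y p : R) : 0 < p -> 0 <= x -> x `^ p <= y -> x <= y `^ p^-1.
Proof.
move=> p0 x0 xy; have -> : x = (x `^ p) `^ p^-1.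
  by rewrite -powRrM mulfV ?gt_eqF// powRr1.
have y0 : 0 <= y := le_trans (powR_ge0 _ _) xy.
by rewrite ge0_ler_powR ?nnegrE ?invr_ge0 ?powR_ge0// ltW.
Qed.

Lemma energy1_le p m u : 0 < p ->
  energy 1 m u <= (3 ^+ m.+1) * (energy p m u) `^ p^-1.
Proof.
move=> p0; rewrite /energy [leLHS]big_seq.
apply: (@le_trans _ _ (\sum_(w <- words m | w \in words m) \sum_(c : 'I_3) (energy p m u) `^ p^-1)).
  apply: ler_sum => w ww; apply: ler_sum => c _; rewrite powRr1//.
  apply: le_powR_root => //.
  rewrite /energy (bigD1_seq w) ?uniq_words//= (bigD1 c)//= -addrA lerDl.
  by rewrite addr_ge0// sumr_ge0 => // *; rewrite ?sumr_ge0 => // *; exact: powR_ge0.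
rewrite -big_seq !sumr_const card_ord -/(energy p m u) big_const_seq count_predT size_words iter_addr_0.
by rewrite -mulrnA -natrX mulr_natl expnS.
Qed.

(** A crude bound, with an exponential factor far from optimal; it serves only to
show that the critical exponent is finite. *)
Lemma osc_energy p m u w w' : 0 < p -> size w = m -> size w' = m ->
  `|u w - u w'| <= (3 ^+ m.+1) * (energy p m u) `^ p^-1.
Proof.
move=> p0 sw sw'; exact: le_trans (osc_energy1 _ sw sw') (energy1_le _ _ p0).
Qed.

(** From the cell w = a :: x, the corner b is reached in two moves: from x to the
corner a of the cell a, a question at level m, and then from the corner a to the
corner b at level m + 1.  The cost of the first move carries one factor L less,
so the total is a geometric sum of ratio 1 / L. *)
Lemma osc_of_corner p (A L : R) : 0 < p -> 0 <= A -> 1 < L ->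
  (forall m u i k, `|u (nseq m i) - u (nseq m k)| <=
      A * L ^+ m * (energy p m u) `^ p^-1) ->
  forall m u w w', size w = m -> size w' = m ->
    `|u w - u w'| <= 2 * A * L / (L - 1) * L ^+ m * (energy p m u) `^ p^-1.
Proof.
move=> p0 A0 L1 H.
have pV0 : 0 <= p^-1 by rewrite invr_ge0 ltW.
have LB : 0 < L - 1 by rewrite subr_gt0.
have L0 : 0 < L by apply: lt_trans L1.
have [LB' L0'] : 0 <= L - 1 /\ 0 <= L by rewrite !ltW.
have key m u w b : size w = m ->
    `|u w - u (nseq m b)| <= A * L / (L - 1) * L ^+ m * (energy p m u) `^ p^-1.
  elim: m u w b => [|m IH] u [|a x] b //=.
    by rewrite subrr normr0 !mulr_ge0 ?powR_ge0 ?invr_ge0.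
  move=> [sx]; have h1 := IH (u \o cons a) x a sx.
  have := H m.+1 u a b; move: h1 => /=.
  have := @energy_sub p m u a (lt0r_neq0 p0).
  move=> /(@ge0_ler_powR _ _ pV0 _ _ (energy_ge0 _ _ _) (energy_ge0 _ _ _)).
  set E := _ `^ _; set E' := _ `^ _ => EE'.
  set X := u (a :: x); set Z := u (a :: _); set W := u (b :: _) => h1 h2.
  apply: (le_trans (ler_distD Z _ _)).
  apply: (le_trans (lerD h1 h2)).
  have Em : A * L / (L - 1) * L ^+ m * E <= A * L / (L - 1) * L ^+ m * E'.
    by rewrite ler_wpM2l// !mulr_ge0 ?exprn_ge0 ?invr_ge0.
  apply: (le_trans (lerD Em (lexx _))); rewrite exprS.
  rewrite le_eqVlt; apply/orP; left; apply/eqP.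
  by field; rewrite gt_eqF.
move=> m u w w' sw sw'; apply: (le_trans (ler_distD (u (nseq m ord0)) _ _)).
rewrite [X in _ + X]distrC.
apply: (le_trans (lerD (key _ _ _ _ sw) (key _ _ _ _ sw'))).
by rewrite le_eqVlt; apply/orP; left; apply/eqP; field; rewrite gt_eqF.
Qed.

End DiscreteEnergy.

(** * Self-similar extension from corner values *)

Section Extension.
Context {R : realType}.
Implicit Types (p : R) (u : word -> R) (a : 'I_3 -> R).

Definition clamp (x : R) : R := Num.max 0 (Num.min 1 x).

Lemma clamp0 x : x <= 0 -> clamp x = 0.
Proof. by move=> x0; rewrite /clamp; apply/max_idPl; rewrite ge_min x0 orbT. Qed.

Lemma clamp1 x : 1 <= x -> clamp x = 1.
Proof. by move=> x1; rewrite /clamp (min_idPl x1); apply/max_idPr. Qed.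

Lemma clamp_id x : 0 <= x <= 1 -> clamp x = x.
Proof. by move=> /andP[x0 x1]; rewrite /clamp (min_idPr x1); apply/max_idPr. Qed.

Lemma clamp_cases x :
  [\/ x <= 0 /\ clamp x = 0, 1 <= x /\ clamp x = 1 | 0 <= x <= 1 /\ clamp x = x].
Proof.
have [x0|x0] := leP x 0; first by apply: Or31; rewrite clamp0.
have [x1|x1] := leP 1 x; first by apply: Or32; rewrite clamp1.
by apply: Or33; rewrite clamp_id ?ltW ?x0 ?x1.
Qed.

Lemma clamp_lip x y : `|clamp x - clamp y| <= `|x - y|.
Proof.
have h1 := ler_norm (x - y); have h2 := ler_norm (y - x).
rewrite [`|y - x|]distrC in h2; rewrite ler_norml.
by case: (clamp_cases x) => -[/= hx ->]; case: (clamp_cases y) => -[/= hy ->];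
  try (case/andP: hx => ? ?); try (case/andP: hy => ? ?);
  apply/andP; split; lra.
Qed.

Lemma clamp_itv x : 0 <= clamp x <= 1.
Proof.
by case: (clamp_cases x) => -[/= hx ->]; rewrite ?hx ?lexx ?ler01.
Qed.

(** The values at the corners i and k are normalised to 1 and 0, but the value at
the third corner l is unknown.  If it is at most 1/2, then doubling the upper
half of the range and clamping gives a function equal to 1 at i and 0 at the two
other corners; otherwise the lower half does the same for k.  Clamping costs a
factor 2 in the Lipschitz constant, and the symmetries of the triangle move the
distinguished corner anywhere. *)
Lemma corner_functions p m u i k : 0 < p -> u (nseq m i) != u (nseq m k) ->
  exists h : 'I_3 -> word -> R,
    [/\ forall l, h l (nseq m l) = 1,
        forall l l', l != l' -> h l (nseq m l') = 0,
        forall l w, 0 <= h l w <= 1 &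
        forall l, energy p m (h l) <=
          (2 / `|u (nseq m i) - u (nseq m k)|) `^ p * energy p m u].
Proof.
move=> p0 uik.
have ik : i != k by apply: contra uik => /eqP ->.
have [l El] : exists l, ~: [set i; k]%SET = [set l]%SET.
  apply/cards1P; rewrite cardsCs finset.setCK cards2 ik card_ord; exact: eqxx.
have lE x : (x \notin [set i; k]%SET) = (x == l).
  by rewrite -finset.in_setC El finset.in_set1.
set D := u (nseq m i) - u (nseq m k).
have D0 : D != 0 by rewrite subr_eq0.
pose v w := (u w - u (nseq m k)) / D.
have vi : v (nseq m i) = 1 by rewrite /v divff.
have vk : v (nseq m k) = 0 by rewrite /v subrr mul0r.
have vlip w w' : `|v w - v w'| = `|u w - u w'| / `|D|.
  by rewrite /v -mulrBl opprB addrA subrK normrM normfV.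
have [e [i0 [ei0 e0 eitv elip]]] : exists e : word -> R, exists i0,
    [/\ e (nseq m i0) = 1, forall j, i0 != j -> e (nseq m j) = 0,
      forall w, 0 <= e w <= 1 & forall w w', `|e w - e w'| <= 2 * `|v w - v w'|].
  have [vl|vl] := leP (v (nseq m l)) 2^-1.
    exists (fun w => clamp (2 * v w - 1)), i; split.
    - by rewrite vi clamp1//; lra.
    - move=> j ij; rewrite clamp0//.
      have [->|jk] := eqVneq j k; first by rewrite vk; lra.
      have := lE j; rewrite !inE eq_sym (negbTE ij) (negbTE jk) => /esym/eqP ->.
      by lra.
    - by move=> w; exact: clamp_itv.
    - move=> w w'; apply: (le_trans (clamp_lip _ _)).
      have -> : 2 * v w - 1 - (2 * v w' - 1) = 2 * (v w - v w') by ring.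
      by rewrite normrM ger0_norm.
  exists (fun w => clamp (1 - 2 * v w)), k; split.
  - by rewrite vk clamp1//; lra.
  - move=> j kj; rewrite clamp0//.
    have [->|ji] := eqVneq j i; first by rewrite vi; lra.
    have := lE j; rewrite !inE (negbTE ji) eq_sym (negbTE kj) => /esym/eqP ->.
    by lra.
  - by move=> w; exact: clamp_itv.
  - move=> w w'; apply: (le_trans (clamp_lip _ _)).
    have -> : 1 - 2 * v w - (1 - 2 * v w') = 2 * (v w' - v w) by ring.
    by rewrite normrM ger0_norm// distrC.
exists (fun l => e \o map (tperm i0 l)); split => [j|j j'|j w|j] /=.
- by rewrite map_nseq tpermR.
- move=> jj'; rewrite map_nseq e0// -(inj_eq (@perm_inj _ (tperm i0 j))).
  by rewrite tpermK tpermL.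
- exact: eitv.
rewrite (energy_perm _ _ e); apply: energy_lip.
- by rewrite divr_ge0.
- exact: ltW.
- by move=> w w'; rewrite mulrAC -mulrA -vlip.
Qed.

Definition cmin a : R := \big[Num.min/a ord0]_l a l.
Definition cmax a : R := \big[Num.max/a ord0]_l a l.
Definition osc a : R := cmax a - cmin a.

Lemma cmin_le a l : cmin a <= a l. Proof. exact: bigmin_le. Qed.
Lemma le_cmax a l : a l <= cmax a. Proof. exact: le_bigmax. Qed.
Lemma cmin_ge a x : (forall l, x <= a l) -> x <= cmin a.
Proof. by move=> h; apply/bigmin_geP; split. Qed.
Lemma cmax_le a x : (forall l, a l <= x) -> cmax a <= x.
Proof. by move=> h; apply/bigmax_leP; split. Qed.
Lemma osc_ge0 a : 0 <= osc a.
Proof. by rewrite subr_ge0 (le_trans (cmin_le a ord0))// le_cmax. Qed.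

Lemma cmax_ex a : exists i, cmax a = a i.
Proof.
apply: contrapT => h.
have : cmax a < cmax a; last by rewrite ltxx.
rewrite {1}/cmax; apply/bigmax_ltP; split => [|j _];
  rewrite lt_neqAle le_cmax andbT eq_sym; apply/eqP => e; apply: h;
  by [exists ord0|exists j].
Qed.

Lemma powR_sum3 p (x : 'I_3 -> R) : 0 < p -> (forall i, 0 <= x i) ->
  (\sum_i x i) `^ p <= 3 `^ p * \sum_i x i `^ p.
Proof.
move=> p0 x0.
have M0 : 0 <= cmax x by rewrite (le_trans (x0 ord0))// le_cmax.
have [i xi] := cmax_ex x.
apply: (@le_trans _ _ ((3 * cmax x) `^ p)).
  rewrite ge0_ler_powR ?nnegrE ?mulr_ge0 ?sumr_ge0 ?(ltW p0)//.
  apply: (@le_trans _ _ (\sum_(i : 'I_3) cmax x)).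
    by apply: ler_sum => j _; exact: le_cmax.
  by rewrite sumr_const card_ord mulr_natl.
rewrite powRM// ler_wpM2l ?powR_ge0// xi (bigD1 i)//= lerDl sumr_ge0 => // *.
exact: powR_ge0.
Qed.

(** A function on the cells of level m with corner values a.  A maximum is used
rather than a sum because it stays between the least and the greatest value of
a; this is what makes the iterated construction converge. *)
Definition max_extension (h : 'I_3 -> word -> R) a w : R :=
  \big[Num.max/cmin a]_l (cmin a + (a l - cmin a) * h l w).

(** Corner values for each cell v.  The two cells that meet at a junction are both
given the mean of their values, so that the next step starts from consistent
data. *)
Definition junction_value h a v : 'I_3 -> R :=
  fun c => (max_extension h a v + max_extension h a (neighbour v c).1) / 2.

(** The corner values of the cell w of level k * m obtained from the corner values
a of K after k steps of the construction. *)
Fixpoint corner_values h m k (w : word) a : 'I_3 -> R :=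
  if k is k'.+1 then corner_values h m k' (drop m w) (junction_value h a (take m w)) else a.

Section CornerFamily.
Context (p : R) (m : nat) (h : 'I_3 -> word -> R) (d : R).
Context (p0 : 0 < p) (h1 : forall l, h l (nseq m l) = 1)
  (h0 : forall l l', l != l' -> h l (nseq m l') = 0)
  (hitv : forall l w, 0 <= h l w <= 1)
  (hd : forall l, energy p m (h l) <= d).

Lemma max_extension_ge a w : cmin a <= max_extension h a w.
Proof. exact: bigmax_ge_id. Qed.

Lemma max_extension_le a w : max_extension h a w <= cmax a.
Proof.
apply/bigmax_leP; split => [|l _].
  by rewrite (le_trans (cmin_le a ord0))// le_cmax.
have /andP[hl0 hl1] := hitv l w.
apply: (@le_trans _ _ (a l)); last exact: le_cmax.
have : (a l - cmin a) * h l w <= (a l - cmin a) * 1.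
  by rewrite ler_wpM2l// subr_ge0 cmin_le.
by lra.
Qed.

Lemma max_extension_corner a l : max_extension h a (nseq m l) = a l.
Proof.
apply/eqP; rewrite eq_le; apply/andP; split.
  apply/bigmax_leP; split => [|j _]; first exact: cmin_le.
  have [->|jl] := eqVneq j l; first by rewrite h1; lra.
  by rewrite h0// mulr0 addr0 cmin_le.
apply: le_trans (le_bigmax _ _ l); rewrite h1; lra.
Qed.

Lemma junction_value_ge a v c : cmin a <= junction_value h a v c.
Proof. by rewrite /junction_value; have := max_extension_ge a v; have := max_extension_ge a (neighbour v c).1; lra. Qed.

Lemma junction_value_le a v c : junction_value h a v c <= cmax a.
Proof. by rewrite /junction_value; have := max_extension_le a v; have := max_extension_le a (neighbour v c).1; lra. Qed.

Lemma junction_value_corner a l : junction_value h a (nseq m l) l = a l.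
Proof. by rewrite /junction_value neighbour_corner max_extension_corner; field. Qed.

Lemma junction_value_neighbour a v c :
  junction_value h a (neighbour v c).1 (neighbour v c).2 = junction_value h a v c.
Proof. by rewrite /junction_value neighbourK /= addrC. Qed.

Lemma max_extension_lip a w w' :
  `|max_extension h a w - max_extension h a w'| <= osc a * \sum_l `|h l w - h l w'|.
Proof.
have key x y : max_extension h a x <= max_extension h a y + osc a * \sum_l `|h l x - h l y|.
  apply/bigmax_leP; split => [|l _].
    rewrite (le_trans (max_extension_ge a y))// lerDl mulr_ge0 ?osc_ge0//.
    by rewrite sumr_ge0.
  apply: (@le_trans _ _ ((cmin a + (a l - cmin a) * h l y) + osc a * `|h l x - h l y|)).
    have al0 : 0 <= a l - cmin a by rewrite subr_ge0 cmin_le.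
    have H1 : (a l - cmin a) * (h l x - h l y) <= (a l - cmin a) * `|h l x - h l y|.
      by rewrite ler_wpM2l// ler_norm.
    have H2 : (a l - cmin a) * `|h l x - h l y| <= osc a * `|h l x - h l y|.
      by rewrite ler_wpM2r// lerD2r le_cmax.
    by move: H1 H2; lra.
  rewrite lerD ?ler_wpM2l ?osc_ge0 ?(le_bigmax _ (fun l => cmin a + (a l - cmin a) * h l y))//.
  by rewrite (bigD1 l)//= lerDl sumr_ge0.
rewrite ler_distl; apply/andP; split.
  rewrite lerBlDr (le_trans (key w' w))// lerD2l ler_wpM2l ?osc_ge0//.
  by apply: ler_sum => l _; rewrite distrC.
exact: key.
Qed.

Lemma energy_max_extension a : energy p m (max_extension h a) <= 3 * 3 `^ p * d * osc a `^ p.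
Proof.
apply: (@le_trans _ _ (osc a `^ p * (3 `^ p * \sum_l energy p m (h l)))).
  rewrite /energy [X in _ * (_ * X)]exchange_big /=.
  rewrite mulrA mulr_sumr; apply: ler_sum => w _.
  rewrite [X in _ * X]exchange_big /= mulr_sumr; apply: ler_sum => c _.
  apply: (@le_trans _ _ ((osc a * \sum_l `|h l w - h l (neighbour w c).1|) `^ p)).
    by rewrite ge0_ler_powR ?nnegrE ?mulr_ge0 ?osc_ge0 ?sumr_ge0 ?max_extension_lip ?(ltW p0).
  rewrite powRM ?osc_ge0 ?sumr_ge0// -mulrA ler_wpM2l ?powR_ge0//.
  exact: powR_sum3.
have -> : 3 * 3 `^ p * d * osc a `^ p = osc a `^ p * (3 `^ p * (3 * d)) by ring.
rewrite ler_wpM2l ?powR_ge0// ler_wpM2l ?powR_ge0//.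
apply: (@le_trans _ _ (\sum_(l : 'I_3) d)); first exact: ler_sum.
by rewrite sumr_const card_ord mulr_natl.
Qed.

(** Two corner values of the cell v are means of its own value with the values of
two neighbours, so they differ by at most the largest jump across the edges at
v. *)
Lemma sum_osc_junction_value a :
  \sum_(v <- words m) osc (junction_value h a v) `^ p <= 3 * 3 `^ p * d * osc a `^ p.
Proof.
apply: le_trans (energy_max_extension a); apply: ler_sum => v _.
pose D c := `|max_extension h a v - max_extension h a (neighbour v c).1|.
have [c Mc] := cmax_ex D.
apply: (@le_trans _ _ (D c `^ p)); last first.
  by rewrite (bigD1 c)//= lerDl sumr_ge0 => // *; exact: powR_ge0.
have Dc0 : 0 <= D c by rewrite /D.
rewrite ge0_ler_powR ?nnegrE ?osc_ge0 ?(ltW p0)// /osc lerBlDr.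
have Dj j : `|max_extension h a v - max_extension h a (neighbour v j).1| <= D c by rewrite -Mc; exact: (le_cmax D).
apply: cmax_le => j; rewrite addrC -lerBlDr; apply: cmin_ge => j'.
rewrite /junction_value; move: (Dj j) (Dj j'); rewrite !ler_norml => /andP[A1 A2] /andP[B1 B2].
by move: A1 A2 B1 B2; lra.
Qed.

Lemma corner_values_ge k w a c : cmin a <= corner_values h m k w a c.
Proof.
elim: k w a => [|k IH] w a /=; first exact: cmin_le.
by apply: le_trans (IH _ _); apply: cmin_ge => l; exact: junction_value_ge.
Qed.

Lemma corner_values_le k w a c : corner_values h m k w a c <= cmax a.
Proof.
elim: k w a => [|k IH] w a /=; first exact: le_cmax.
by apply: (le_trans (IH _ _)); apply: cmax_le => l; exact: junction_value_le.
Qed.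

Lemma corner_values_cat j k v t a : size v = (j * m)%N ->
  corner_values h m (j + k) (v ++ t) a = corner_values h m k t (corner_values h m j v a).
Proof.
elim: j v a => [|j IH] v a; first by move=> /size0nil ->.
rewrite mulSn => sv; rewrite addSn /=.
have mv : (m <= size v)%N by rewrite sv leq_addr.
rewrite -[in LHS](cat_take_drop m v) -catA drop_size_cat ?size_takel//.
by rewrite take_size_cat ?size_takel// IH// size_drop sv addnC addnK.
Qed.

Lemma corner_values_corner k a l : corner_values h m k (nseq (k * m) l) a l = a l.
Proof.
elim: k a => [//|k IH] a; rewrite mulSn nseqD /=.
by rewrite drop_size_cat ?size_nseq// take_size_cat ?size_nseq// IH junction_value_corner.
Qed.

(** Cells that meet at a junction have the same value there, at every step: the
junction is either interior to a cell of the previous step or is a corner of it,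
and in the second case corner values are inherited unchanged. *)
Lemma corner_values_neighbour k w a c : size w = (k * m)%N ->
  corner_values h m k (neighbour w c).1 a (neighbour w c).2 = corner_values h m k w a c.
Proof.
elim: k w a c => [|k IH] w a c; first by move=> /size0nil ->.
rewrite mulSn => sw.
have mw : (m <= size w)%N by rewrite sw leq_addr.
set v := take m w; set t := drop m w.
have sv : size v = m by rewrite size_takel.
have st : size t = (k * m)%N by rewrite size_drop sw addnC addnK.
have -> : w = v ++ t by rewrite cat_take_drop.
rewrite neighbour_cat; case: ifPn => [/eqP tE|tc] /=.
  rewrite !drop_size_cat ?size_neighbour// !take_size_cat ?size_neighbour//.
  by rewrite st corner_values_corner junction_value_neighbour {1}tE st corner_values_corner.
by rewrite !drop_size_cat// !take_size_cat// IH.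
Qed.

(** Each step multiplies the sum of the p-th powers of the oscillations by at most
3 * 3^p * d. *)
Lemma sum_osc_corner_values k a :
  \sum_(w <- words (k * m)) osc (corner_values h m k w a) `^ p <=
  (3 * 3 `^ p * d) ^+ k * osc a `^ p.
Proof.
have d0 : 0 <= d by apply: le_trans (hd ord0); exact: energy_ge0.
have C0 : 0 <= 3 * 3 `^ p * d by rewrite !mulr_ge0 ?powR_ge0.
elim: k a => [|k IH] a; first by rewrite big_seq1 expr0 mul1r.
rewrite mulSn big_words_cat.
apply: (@le_trans _ _ (\sum_(v <- words m) (3 * 3 `^ p * d) ^+ k * osc (junction_value h a v) `^ p)).
  rewrite big_seq [leRHS]big_seq; apply: ler_sum => v.
  rewrite mem_words => /eqP sv; apply: le_trans (IH _); apply: ler_sum => w _.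
  by rewrite /= drop_size_cat// take_size_cat.
rewrite -mulr_sumr exprSr -[leRHS]mulrA ler_wpM2l ?exprn_ge0//.
exact: sum_osc_junction_value.
Qed.

End CornerFamily.
End Extension.

(** * Plane geometry of the gasket *)

Section I3.
Definition o0 : 'I_3 := ord0.
Definition o1 : 'I_3 := lift ord0 ord0.
Definition o2 : 'I_3 := lift ord0 (lift ord0 ord0).

Lemma I3_ind (P : 'I_3 -> Prop) : P o0 -> P o1 -> P o2 -> forall i, P i.
Proof.
move=> p0 p1 p2 i; case: (unliftP ord0 i) => [j ->|-> //].
case: (unliftP ord0 j) => [k ->|-> //].
by rewrite (ord1 k).
Qed.

Lemma big_I3 (V : nmodType) (F : 'I_3 -> V) : \sum_i F i = F o0 + (F o1 + F o2).
Proof. by rewrite !big_ord_recl big_ord0 addr0. Qed.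
End I3.

Section EuclideanPlane.
Context {R : realType}.
Implicit Types x y z : (R * R)%type.

Lemma euclid_dist_ge0 x y : 0 <= euclid_dist x y.
Proof. exact: sqrtr_ge0. Qed.

Lemma euclid_dist_sqr x y :
  euclid_dist x y ^+ 2 = (x.1 - y.1) ^+ 2 + (x.2 - y.2) ^+ 2.
Proof. by rewrite sqr_sqrtr// addr_ge0// sqr_ge0. Qed.

Lemma euclid_distxx x : euclid_dist x x = 0.
Proof. by rewrite /euclid_dist !subrr expr0n addr0 sqrtr0. Qed.

Lemma euclid_distC x y : euclid_dist x y = euclid_dist y x.
Proof. by rewrite /euclid_dist -sqrrN opprB -[X in _ + X]sqrrN opprB. Qed.

Lemma cauchy_schwarz (a b u v : R) :
  `|a * u + b * v| <= Num.sqrt (a ^+ 2 + b ^+ 2) * Num.sqrt (u ^+ 2 + v ^+ 2).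
Proof.
rewrite -sqrtrM ?addr_ge0 ?sqr_ge0// -sqrtr_sqr ler_wsqrtr//.
have := sqr_ge0 (a * v - b * u); lra.
Qed.

Lemma euclid_dist_tri y x z : euclid_dist x z <= euclid_dist x y + euclid_dist y z.
Proof.
rewrite -(@ler_pXn2r _ 2) ?nnegrE ?addr_ge0 ?euclid_dist_ge0//.
rewrite [leRHS]sqrrD !euclid_dist_sqr.
have := cauchy_schwarz (x.1 - y.1) (x.2 - y.2) (y.1 - z.1) (y.2 - z.2).
rewrite -/(euclid_dist x y) -/(euclid_dist y z) ler_norml => /andP[_].
rewrite -mulr_natl; lra.
Qed.

Lemma abs1_le_euclid x y : `|x.1 - y.1| <= euclid_dist x y.
Proof. by rewrite -sqrtr_sqr ler_wsqrtr// lerDl sqr_ge0. Qed.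

Lemma abs2_le_euclid x y : `|x.2 - y.2| <= euclid_dist x y.
Proof. by rewrite -sqrtr_sqr ler_wsqrtr// lerDr sqr_ge0. Qed.

Lemma euclid_le_abs x y : euclid_dist x y <= `|x.1 - y.1| + `|x.2 - y.2|.
Proof.
rewrite -(@ler_pXn2r _ 2) ?nnegrE ?addr_ge0 ?euclid_dist_ge0//.
rewrite euclid_dist_sqr [leRHS]sqrrD !real_normK ?num_real// -mulr_natl.
by have := mulr_ge0 (normr_ge0 (x.1 - y.1)) (normr_ge0 (x.2 - y.2)); lra.
Qed.

Lemma in_closed (A : set (R * R)) z : closed A ->
  (forall e, 0 < e -> exists2 y, A y & euclid_dist z y < e) -> A z.
Proof.
move=> clA h; apply: contrapT => nAz.
have : nbhs z (~` A) by apply: open_nbhs_nbhs; split => //; rewrite openC.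
move=> /nbhs_ballP[e /= e0 zA].
have [y Ay zy] := h _ e0.
apply: (zA y) => //; split => /=.
  exact: le_lt_trans (abs1_le_euclid _ _) zy.
exact: le_lt_trans (abs2_le_euclid _ _) zy.
Qed.

Lemma half_expn_small (B e : R) : 0 < e -> exists n, B * 2^-1 ^+ n < e.
Proof.
move=> e0; exists (Num.bound `|B / e|).
set N := Num.bound _.
have h : `|B / e| < N%:R by exact: archi_boundP.
have h2 : (N%:R : R) <= 2 ^+ N by rewrite -natrX ler_nat ltnW// ltn_expl.
rewrite exprVn ltr_pdivrMr ?exprn_gt0// -ltr_pdivrMl// mulrC.
by apply: le_lt_trans (ler_norm _) _; apply: lt_le_trans h h2.
Qed.

Lemma half_expn_ge0 n : 0 <= (2^-1 : R) ^+ n.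
Proof. by rewrite exprn_ge0. Qed.

End EuclideanPlane.

Section Gasket.
Context {R : realType} (q : 'I_3 -> R * R).
Implicit Types (x y z : (R * R)%type) (w : word).

Definition barycentre : R * R :=
  ((\sum_i (q i).1) / 3, (\sum_i (q i).2) / 3).

(** The barycentric coordinate for the vertex i of a triangle of side 1: the inner
product of the two vectors q i - barycentre and q j - barycentre is 1/3 if
i = j and -1/6 otherwise.  These affine functions replace the geometry of the
triangle: the maps act on them by halving, and they are 2-Lipschitz. *)
Definition bary (i : 'I_3) x : R :=
  3^-1 + 2 * ((x.1 - barycentre.1) * ((q i).1 - barycentre.1) +
              (x.2 - barycentre.2) * ((q i).2 - barycentre.2)).

Lemma gasket_mapE i x :
  gasket_map q i x = ((x.1 + (q i).1) / 2, (x.2 + (q i).2) / 2).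
Proof.
by rewrite /gasket_map; case: x => x1 x2; case: (q i) => a b;
   congr (_, _) => /=; rewrite /GRing.scale /=; field.
Qed.

Lemma euclid_gasket_map i x y :
  euclid_dist (gasket_map q i x) (gasket_map q i y) = euclid_dist x y / 2.
Proof.
apply/eqP; rewrite -(@eqrXn2 _ 2)// ?divr_ge0 ?euclid_dist_ge0//.
by rewrite expr_div_n !euclid_dist_sqr !gasket_mapE /=; apply/eqP; field.
Qed.

Lemma gasket_map_vertex i : gasket_map q i (q i) = q i.
Proof. by rewrite gasket_mapE; case: (q i) => a b /=; congr (_, _); field. Qed.

Lemma gasket_map_vertexC i j : gasket_map q i (q j) = gasket_map q j (q i).
Proof. by rewrite !gasket_mapE; congr (_, _); congr (_ / _); exact: addrC. Qed.

Lemma bary_sum x : \sum_i bary i x = 1.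
Proof. by rewrite big_I3 /bary /barycentre /= !big_I3; field. Qed.

Lemma gasket_word_map_cons a w x :
  gasket_word_map q (a :: w) x = gasket_map q a (gasket_word_map q w x).
Proof. by []. Qed.

Lemma euclid_gasket_word_map w x y :
  euclid_dist (gasket_word_map q w x) (gasket_word_map q w y) =
  2^-1 ^+ size w * euclid_dist x y.
Proof.
elim: w => [|a w IH] /=; first by rewrite mul1r.
by rewrite euclid_gasket_map IH exprS; field.
Qed.

Lemma gasket_word_map_corner n c : gasket_word_map q (nseq n c) (q c) = q c.
Proof. by elim: n => [//|n IH] /=; rewrite IH gasket_map_vertex. Qed.

(** The combinatorial neighbour is the geometric one: the two cells share this
corner point. *)
Lemma gasket_word_map_neighbour w c :
  gasket_word_map q (neighbour w c).1 (q (neighbour w c).2) = gasket_word_map q w (q c).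
Proof.
elim: w c => [//|a w IH] c /=; case: ifPn => [/eqP wc|_] /=; last by rewrite IH.
case: ifPn => [//|ac] /=.
by rewrite wc size_nseq !gasket_word_map_corner gasket_map_vertexC.
Qed.

Context (hq : unit_equilateral q).

Lemma sqr_dist1 i j : i != j ->
  ((q i).1 - (q j).1) ^+ 2 + ((q i).2 - (q j).2) ^+ 2 = 1.
Proof. by move=> ij; rewrite -euclid_dist_sqr hq// expr1n. Qed.

Lemma bary_vertex i j : bary i (q j) = (i == j)%:R.
Proof.
have h01 := @sqr_dist1 o0 o1 isT; have h02 := @sqr_dist1 o0 o2 isT.
have h12 := @sqr_dist1 o1 o2 isT.
rewrite /bary /barycentre /= !big_I3.
elim/I3_ind: i; elim/I3_ind: j => /=; rewrite ?eqxx /=; move: h01 h02 h12;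
  case: (q o0) => a0 b0; case: (q o1) => a1 b1; case: (q o2) => a2 b2 /=; lra.
Qed.

Lemma bary_map i j x : bary i (gasket_map q j x) = (bary i x + (i == j)%:R) / 2.
Proof. by rewrite -bary_vertex gasket_mapE /bary /=; field. Qed.

Lemma bary_lip i x y : `|bary i x - bary i y| <= 2 * euclid_dist x y.
Proof.
have -> : bary i x - bary i y = 2 * ((x.1 - y.1) * ((q i).1 - barycentre.1) +
  (x.2 - y.2) * ((q i).2 - barycentre.2)) by rewrite /bary; ring.
rewrite normrM ger0_norm// ler_wpM2l//.
apply: (le_trans (cauchy_schwarz _ _ _ _)).
rewrite -/(euclid_dist x y) -[leRHS]mulr1 ler_wpM2l ?euclid_dist_ge0//.
rewrite -[leRHS]sqrtr1 ler_wsqrtr//.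
have := bary_vertex i i; rewrite eqxx /bary /=; lra.
Qed.

Context (K : set (R * R)) (hK : is_gasket q K).

Lemma gasket_closed : closed K.
Proof. by case: hK => _ cK _; apply: compact_closed => //; exact: pseudometric_hausdorff. Qed.

Lemma gasket_map_K i x : K x -> K (gasket_map q i x).
Proof. by case: hK => _ _ E Kx; rewrite E; exists i => //; exists x. Qed.

Lemma gasket_split x : K x -> exists i, exists2 y, K y & x = gasket_map q i y.
Proof.
case: hK => _ _ E Kx; move: (Kx); rewrite {1}E => -[i _ [y Ky <-]].
by exists i, y.
Qed.

Lemma gasket_word_map_K w x : K x -> K (gasket_word_map q w x).
Proof. by elim: w => [//|a w IH] Kx /=; apply: gasket_map_K; exact: IH. Qed.

Lemma gasket_bounded : exists2 B, 0 < B &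
  forall x y, K x -> K y -> euclid_dist x y <= B.
Proof.
case: hK => _ cK _; have [M [Mr hM]] := compact_bounded cK.
pose B := `|M| + 1; have MB : M < B by rewrite (le_lt_trans (ler_norm _))// ltrDl.
have B0 : 0 < B by rewrite ltr_pwDr.
exists (4 * B) => [|x y Kx Ky]; first by rewrite mulr_gt0.
have := hM B MB x Kx; have := hM B MB y Ky.
rewrite /= !prod_normE !ge_max => /andP[y1 y2] /andP[x1 x2].
apply: (le_trans (euclid_le_abs _ _)).
have := ler_normB x.1 y.1; have := ler_normB x.2 y.2.
move: x1 x2 y1 y2; lra.
Qed.

(** The vertex i is the limit of the images of any point of K under the iterates of
the i-th map. *)
Lemma vertex_in_K i : K (q i).
Proof.
have [x Kx] : K !=set0 by case: hK.
apply: in_closed; first exact: gasket_closed.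
move=> e e0; have [n hn] := half_expn_small (euclid_dist (q i) x) e0.
exists (gasket_word_map q (nseq n i) x); first exact: gasket_word_map_K.
rewrite -{1}(gasket_word_map_corner n i) euclid_gasket_word_map size_nseq.
by rewrite mulrC.
Qed.

(** K lies in the triangle: a negative coordinate of a point of K would at
least double when passing to the preimage of this point in K, whereas K is bounded. *)
Lemma bary_ge0 i x : K x -> 0 <= bary i x.
Proof.
have [B B0 hB] := gasket_bounded.
pose M := 2 * B.
(* The lower bound halves at each step, as K is covered by its images. *)
have hM n y : K y -> - (M * 2^-1 ^+ n) <= bary i y.
  elim: n y => [|n IH] y Ky.
    rewrite expr0 mulr1.
    have [j ji] : exists j, i != j by elim/I3_ind: i; [exists o1|exists o0|exists o0].
    have := bary_lip i y (q j); rewrite bary_vertex (negbTE ji) subr0.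
    have := hB _ _ Ky (vertex_in_K j); rewrite ler_norml /M => ? /andP[? _]; lra.
  have [j [z Kz ->]] := gasket_split Ky; rewrite bary_map exprS.
  have := IH z Kz; have : 0 <= (i == j)%:R :> R by rewrite ler0n.
  lra.
move=> Kx; rewrite leNgt; apply/negP => b0.
have b0' : 0 < - bary i x by rewrite oppr_gt0.
have [n hn] := half_expn_small M b0'; have := hM n x Kx; lra.
Qed.

Lemma bary_le1 i x : K x -> bary i x <= 1.
Proof.
move=> Kx; rewrite -(bary_sum x) (bigD1 i)//= lerDl sumr_ge0 => // j _.
exact: bary_ge0.
Qed.

Definition cell w : set (R * R) := gasket_word_map q w @` K.

Lemma cell_sub_K w : cell w `<=` K.
Proof. by move=> _ [y Ky <-]; exact: gasket_word_map_K. Qed.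

(** Among the cells of level n, only the one at the vertex a reaches the region
where the coordinate of a exceeds 1 - 2^-n. *)
Lemma near_corner w a y : cell w y -> 1 - 2^-1 ^+ size w < bary a y ->
  w = nseq (size w) a.
Proof.
elim: w y => [//|b t IH] _ [z Kz <-]; rewrite gasket_word_map_cons bary_map [size _]/=.
have Kz' := gasket_word_map_K t Kz; have b1 := bary_le1 a Kz'.
have n1 : (2^-1 : R) ^+ size t <= 1 by rewrite exprn_ile1//; lra.
move=> h; have [E|ab] := eqVneq a b; [subst b|].
  congr (_ :: _); apply: (IH (gasket_word_map q t z)); first by exists z.
  by move: h; rewrite eqxx exprS /=; lra.
exfalso; move: h; rewrite (negbTE ab) exprS /=; lra.
Qed.

(** Points at small distance lie in cells that are equal or neighbours.  If they are
in different cells of level 1, say a and b, then each of them has a coordinate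
close to its maximal value within its own cell, so both are near the midpoint
common to these cells, and [near_corner] identifies the words. *)
Lemma cells_near w w' x y : size w = size w' -> cell w x -> cell w' y ->
  (forall i, `|bary i x - bary i y| < 2^-1 ^+ size w) ->
  w' = w \/ exists c, w' = (neighbour w c).1.
Proof.
elim: w w' x y => [|a w IH] [|b w'] // x y; first by left.
move=> [sww'] [x' Kx' <-] [y' Ky' <-]; rewrite !gasket_word_map_cons [size _]/=; set x1 := gasket_word_map q w x'.
set y1 := gasket_word_map q w' y' => h.
have Kx1 : K x1 by exact: gasket_word_map_K.
have Ky1 : K y1 by exact: gasket_word_map_K.
have [ab|ab] := eqVneq a b.
  subst b; have {}h i : `|bary i x1 - bary i y1| < 2^-1 ^+ size w.
    have := h i; rewrite !bary_map exprS.
    rewrite (_ : _ / 2 - _ = 2^-1 * (bary i x1 - bary i y1)); last by field.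
    by rewrite normrM ger0_norm// ltr_pM2l.
  have [||->|[c w'E]] := IH w' x1 y1 sww' _ _ h; [by exists x'|by exists y'|by left|].
  have [wc|wc] := eqVneq w (nseq (size w) c).
    by left; rewrite w'E {1}wc neighbour_corner -wc.
  by right; exists c; rewrite /= (negbTE wc) /= -w'E.
right; exists b.
have n0 := half_expn_ge0 (R := R) (size w).
have E1 : w' = nseq (size w') a.
  apply: (@near_corner _ _ y1); first by exists y'.
  have := h a; rewrite !bary_map eqxx (negbTE ab) -sww' exprS ltr_norml => /andP[_].
  have := bary_ge0 a Kx1; rewrite /=; lra.
have E2 : w = nseq (size w) b.
  apply: (@near_corner _ _ x1); first by exists x'.
  have := h b; rewrite !bary_map eqxx eq_sym (negbTE ab) exprS ltr_norml => /andP[+ _].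
  have := bary_ge0 b Ky1; rewrite /=; lra.
by rewrite /= -E2 eqxx (negbTE ab) /= E1 sww'.
Qed.

(** A point common to two cells has several addresses; one is singled out, so that
the cells of a given level become a partition of K. *)
Definition first_letter x : 'I_3 :=
  if `[< (gasket_map q o0 @` K) x >] then o0
  else if `[< (gasket_map q o1 @` K) x >] then o1 else o2.

Definition gasket_inv i x : R * R := (2 * x.1 - (q i).1, 2 * x.2 - (q i).2).

Lemma gasket_mapK i : cancel (gasket_map q i) (gasket_inv i).
Proof.
by move=> [a b]; rewrite gasket_mapE /gasket_inv /=; congr (_, _); field.
Qed.

Lemma gasket_invK i : cancel (gasket_inv i) (gasket_map q i).
Proof.
by move=> [a b]; rewrite gasket_mapE /gasket_inv /=; congr (_, _); field.
Qed.

Definition address_tail x := gasket_inv (first_letter x) x.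

Fixpoint address n x : word :=
  if n is n'.+1 then first_letter x :: address n' (address_tail x) else [::].

Lemma size_address n x : size (address n x) = n.
Proof. by elim: n x => //= n IH x; rewrite IH. Qed.

Lemma address_tail_K x : K x -> K (address_tail x) /\ gasket_map q (first_letter x) (address_tail x) = x.
Proof.
move=> Kx; split; last by rewrite gasket_invK.
rewrite /address_tail /first_letter; case: asboolP => [[y Ky <-]|h0].
  by rewrite gasket_mapK.
case: asboolP => [[y Ky <-]|h1]; first by rewrite gasket_mapK.
have [i [y Ky E]] := gasket_split Kx.
move: h0 h1; rewrite E; elim/I3_ind: i E => E h0 h1.
- by exfalso; apply: h0; exists y.
- by exfalso; apply: h1; exists y.
- by rewrite gasket_mapK.
Qed.

Lemma address_in_cell n x : K x -> cell (address n x) x.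
Proof.
elim: n x => [|n IH] x Kx /=; first by exists x.
have [Ks E] := address_tail_K Kx; have [y Ky Ey] := IH _ Ks.
by exists y => //=; rewrite -/(gasket_word_map q _ _) Ey E.
Qed.

Lemma address_add n m x : address (n + m) x = address n x ++ address m (iter n address_tail x).
Proof. by elim: n x => [//|n IH] x; rewrite addSn /= IH -iterSr. Qed.

End Gasket.

(** * Curves in the gasket *)

Section Curves.
Context {R : realType}.
Implicit Types (x y z : (R * R)%type) (g : R -> R * R) (K : set (R * R)).

Definition glue g1 g2 (t : R) : R * R :=
  if t <= 2^-1 then g1 (2 * t) else g2 (2 * t - 1).

Definition lip_curve K L x y g :=
  [/\ forall s t, 0 <= s <= 1 -> 0 <= t <= 1 ->
        euclid_dist (g s) (g t) <= L * `|s - t|,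
      forall t, 0 <= t <= 1 -> K (g t), g 0 = x & g 1 = y].

(** Lipschitz curves parametrised by [0, 1], with Lipschitz constant as upper bound
for the length, compose under the maps of the gasket without any computation of
lengths. *)
Definition lip_conn K L x y := exists g, lip_curve K L x y g.

Lemma lip_conn_le K L L' x y : L <= L' -> lip_conn K L x y -> lip_conn K L' x y.
Proof.
move=> LL' [g [h hK g0 g1]]; exists g; split => // s t s01 t01.
by apply: (le_trans (h s t s01 t01)); rewrite ler_wpM2r.
Qed.

Lemma lip_conn_sym K L x y : lip_conn K L x y -> lip_conn K L y x.
Proof.
move=> [g [h hK g0 g1]]; exists (fun t => g (1 - t)); split => [s t s01 t01|t t01||].
- have -> : `|s - t| = `|(1 - s) - (1 - t)|.
    by rewrite distrC; congr `|_|; ring.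
  by apply: h; lra.
- by apply: hK; lra.
- by rewrite subr0.
- by rewrite subrr.
Qed.

Lemma glue_lip K L x y z g1 g2 : 0 <= L ->
  lip_curve K L x y g1 -> lip_curve K L y z g2 ->
  lip_curve K (2 * L) x z (glue g1 g2).
Proof.
move=> L0 [h1 k1 g10 g11] [h2 k2 g20 g21].
have key s t : 0 <= s <= 1 -> 0 <= t <= 1 -> s <= t ->
    euclid_dist (glue g1 g2 s) (glue g1 g2 t) <= 2 * L * `|s - t|.
  move=> s01 t01 st; rewrite /glue; case: (leP t 2^-1) => t2.
    rewrite ifT; last exact: le_trans t2.
    rewrite (_ : _ * `|_| = L * `|2 * s - 2 * t|); last first.
      by rewrite -mulrBr normrM ger0_norm//; ring.
    by apply: h1; lra.
  case: (leP s 2^-1) => s2.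
    apply: (le_trans (euclid_dist_tri y _ _)).
    have a1 : euclid_dist (g1 (2 * s)) y <= L * (1 - 2 * s).
      rewrite -g11; apply: (le_trans (h1 _ _ _ _)); [lra|lra|].
      by rewrite distrC ger0_norm//; lra.
    have a2 : euclid_dist y (g2 (2 * t - 1)) <= L * (2 * t - 1).
      rewrite -g20; apply: (le_trans (h2 _ _ _ _)); [lra|lra|].
      by rewrite distrC subr0 ger0_norm//; lra.
    rewrite distrC ger0_norm ?subr_ge0//.
    by apply: (le_trans (lerD a1 a2)); lra.
  rewrite (_ : _ * `|_| = L * `|(2 * s - 1) - (2 * t - 1)|); last first.
    rewrite (_ : 2 * s - 1 - _ = 2 * (s - t)); last by ring.
    by rewrite normrM ger0_norm//; ring.
  by apply: h2; lra.
split => [s t s01 t01|t t01||].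
- have [st|/ltW st] := leP s t; first exact: key.
  by rewrite euclid_distC distrC; exact: key.
- by rewrite /glue; case: (leP t 2^-1) => t2; [apply: k1|apply: k2]; lra.
- by rewrite /glue ifT ?mulr0// invr_ge0.
- rewrite /glue ifF; last by apply/negbTE; rewrite -ltNge; lra.
  by rewrite -g21; congr g2; ring.
Qed.

Lemma lip_conn_trans K L x y z : 0 <= L ->
  lip_conn K L x y -> lip_conn K L y z -> lip_conn K (2 * L) x z.
Proof.
by move=> L0 [g1 h1] [g2 h2]; exists (glue g1 g2); exact: glue_lip h1 h2.
Qed.

Lemma geometric_limit (a : nat -> R) (B : R) :
  (forall n k, `|a (n + k)%N - a n| <= B * 2^-1 ^+ n) ->
  exists l, forall n, `|l - a n| <= B * 2^-1 ^+ n.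
Proof.
move=> h; have B0 : 0 <= B.
  by have := h 0%N 0%N; rewrite addn0 subrr normr0 expr0 mulr1.
have key n m : a n - B * 2^-1 ^+ n <= a m + B * 2^-1 ^+ m.
  have Bn k : 0 <= B * 2^-1 ^+ k by rewrite mulr_ge0 ?half_expn_ge0.
  have := Bn n; have := Bn m; case: (leqP n m) => [nm|/ltnW mn].
    by have := h n (m - n)%N; rewrite subnKC// ler_norml => /andP[? ?]; lra.
  by have := h m (n - m)%N; rewrite subnKC// ler_norml => /andP[? ?]; lra.
pose S := range (fun n => a n - B * 2^-1 ^+ n).
have supS : has_sup S.
  by split; [exists (a 0%N - B * 2^-1 ^+ 0); exists 0%N|exists (a 0%N + B * 2^-1 ^+ 0) => _ [n _ <-]].
exists (sup S) => n; rewrite ler_distl; apply/andP; split.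
  by apply: ub_le_sup; [case: supS|exists n].
by apply: ge_sup; [case: supS|move=> _ [m _ <-]].
Qed.

End Curves.

Section GasketCurves.
Context {R : realType} (q : 'I_3 -> R * R) (K : set (R * R)).
Context (hq : unit_equilateral q) (hK : is_gasket q K).
Implicit Types (x y z : (R * R)%type) (w : word).

Lemma lip_conn_word w L x y : lip_conn K L x y ->
  lip_conn K (2^-1 ^+ size w * L) (gasket_word_map q w x) (gasket_word_map q w y).
Proof.
move=> [g [h hg g0 g1]]; exists (gasket_word_map q w \o g); split => /=.
- move=> s t s01 t01; rewrite euclid_gasket_word_map -mulrA.
  by rewrite ler_wpM2l ?half_expn_ge0// h.
- by move=> t t01; apply: (gasket_word_map_K hK) => //; exact: hg.
- by rewrite g0.
- by rewrite g1.
Qed.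

Definition seg (i j : 'I_3) (t : R) : R * R :=
  ((1 - t) * (q i).1 + t * (q j).1, (1 - t) * (q i).2 + t * (q j).2).

Lemma vertex_dist_le1 i j : euclid_dist (q i) (q j) <= 1.
Proof.
by have [->|ij] := eqVneq i j; [rewrite euclid_distxx|rewrite hq].
Qed.

Lemma seg_lip i j s t : euclid_dist (seg i j s) (seg i j t) <= `|s - t|.
Proof.
have -> : euclid_dist (seg i j s) (seg i j t) = `|s - t| * euclid_dist (q i) (q j).
  apply/eqP; rewrite -(@eqrXn2 _ 2)// ?mulr_ge0 ?euclid_dist_ge0//.
  rewrite exprMn !euclid_dist_sqr real_normK ?num_real//=.
  by apply/eqP; ring.
by rewrite -[leRHS]mulr1 ler_wpM2l ?vertex_dist_le1.
Qed.

Lemma seg0 i j : seg i j 0 = q i.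
Proof. by rewrite /seg; case: (q i) => a b /=; congr (_, _); ring. Qed.

Lemma seg1 i j : seg i j 1 = q j.
Proof. by rewrite /seg; case: (q j) => a b /=; congr (_, _); ring. Qed.

(** The segment between two vertices is in K because each half of it is the image of
the whole segment under one of the maps: by induction it is within 2^-n of K, and
K is closed. *)
Lemma seg_K i j t : 0 <= t <= 1 -> K (seg i j t).
Proof.
have near n s : 0 <= s <= 1 -> exists2 y, K y &
    euclid_dist (seg i j s) y <= 2^-1 ^+ n.
  elim: n s => [|n IH] s s01.
    exists (q i); first exact: (vertex_in_K hK).
    rewrite -(seg0 i j) (le_trans (seg_lip _ _ _ _))// subr0 ger0_norm; lra.
  case: (leP s 2^-1) => s2.
    have [|y Ky hy] := IH (2 * s); first lra.
    exists (gasket_map q i y); first exact: (gasket_map_K hK).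
    have -> : seg i j s = gasket_map q i (seg i j (2 * s)).
      by rewrite gasket_mapE /seg /=; congr (_, _); field.
    by rewrite euclid_gasket_map exprS; lra.
  have [|y Ky hy] := IH (2 * s - 1); first lra.
  exists (gasket_map q j y); first exact: (gasket_map_K hK).
  have -> : seg i j s = gasket_map q j (seg i j (2 * s - 1)).
    by rewrite gasket_mapE /seg /=; congr (_, _); field.
  by rewrite euclid_gasket_map exprS; lra.
move=> t01; apply: in_closed; first exact: gasket_closed hK.
move=> e e0; have [n hn] := @half_expn_small R 1 e e0.
have [y Ky hy] := near n t t01; exists y => //.
by apply: le_lt_trans hy _; rewrite mul1r in hn.
Qed.

Lemma seg_conn i j : lip_conn K 1 (q i) (q j).
Proof.
exists (seg i j); split; [|exact: (seg_K)|exact: seg0|exact: seg1].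
by move=> s t _ _; rewrite mul1r seg_lip.
Qed.

Local Notation fl := (first_letter q K).
Local Notation sh := (address_tail q K).

(** Approximate curves from the vertex of the first cell of x towards x: run half
of a side, then the curve for the next point of the address, at double speed
inside the first cell.  Halving in space and doubling in speed compensate, so
the Lipschitz constant remains 1. *)
Fixpoint vcurve n x : R -> R * R :=
  if n is n'.+1 then
    gasket_map q (fl x) \o glue (seg (fl x) (fl (sh x))) (vcurve n' (sh x))
  else cst (q (fl x)).

Lemma vcurve0 n x : vcurve n x 0 = q (fl x).
Proof.
case: n => [//|n] /=; rewrite /glue ifT ?invr_ge0// mulr0 seg0.
by rewrite gasket_map_vertex.
Qed.

Lemma vcurve_lip n x : K x ->
  lip_curve K 1 (q (fl x)) (vcurve n x 1) (vcurve n x).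
Proof.
elim: n x => [|n IH] x Kx.
  split => //= *; first by rewrite euclid_distxx mul1r.
  exact: (vertex_in_K hK).
have [Ks E] := address_tail_K hK Kx.
have hs : lip_curve K 1 (q (fl x)) (q (fl (sh x))) (seg (fl x) (fl (sh x))).
  split; [|exact: (seg_K)|exact: seg0|exact: seg1].
  by move=> s t _ _; rewrite mul1r seg_lip.
have [h hg g0 g1] := glue_lip ler01 hs (IH _ Ks).
split => //=.
- move=> s t s01 t01; rewrite euclid_gasket_map.
  by have := h s t s01 t01; lra.
- by move=> t t01; apply: (gasket_map_K hK) => //; exact: hg.
- by rewrite g0 gasket_map_vertex.
Qed.

Lemma vcurve_cauchy B : (forall x y, K x -> K y -> euclid_dist x y <= B) ->
  forall n k x t, K x -> 0 <= t <= 1 ->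
    euclid_dist (vcurve (n + k) x t) (vcurve n x t) <= B * 2^-1 ^+ n.
Proof.
move=> hB; elim=> [|n IH] k x t Kx t01.
  rewrite expr0 mulr1; apply: hB.
    by case: (vcurve_lip (0 + k) Kx) => _ h _ _; exact: h.
  by case: (vcurve_lip 0 Kx) => _ h _ _; exact: h.
have [Ks E] := address_tail_K hK Kx.
rewrite addSn /= euclid_gasket_map exprS /glue; case: (leP t 2^-1) => t2.
  rewrite euclid_distxx mul0r mulr_ge0 ?mulr_ge0 ?half_expn_ge0//.
  by apply: le_trans (hB _ _ Kx Kx); exact: euclid_dist_ge0.
have /(IH k _ _ Ks) : 0 <= 2 * t - 1 <= 1 by lra.
by lra.
Qed.

Lemma vcurve1_near B : (forall x y, K x -> K y -> euclid_dist x y <= B) ->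
  forall n x, K x -> euclid_dist (vcurve n x 1) x <= B * 2^-1 ^+ n.
Proof.
move=> hB; elim=> [|n IH] x Kx.
  by rewrite expr0 mulr1; apply: hB => //; exact: (vertex_in_K hK).
have [Ks E] := address_tail_K hK Kx.
rewrite /= /glue ifF; last by apply/negbTE; rewrite -ltNge; lra.
have -> : 2 * 1 - 1 = 1 :> R by ring.
rewrite -{3}E euclid_gasket_map exprS; have := IH _ Ks; lra.
Qed.

(** The approximate curves [vcurve n x] converge uniformly, geometrically fast, to a
1-Lipschitz curve ending at x. *)
Lemma vertex_conn x : K x -> lip_conn K 1 (q (fl x)) x.
Proof.
move=> Kx; have [B B0 hB] := gasket_bounded hK.
have ex t : exists l : R * R, 0 <= t <= 1 ->
    forall n, euclid_dist l (vcurve n x t) <= 2 * B * 2^-1 ^+ n.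
  have [t01|] := boolP (0 <= t <= 1); last by exists 0.
  have hc n k := vcurve_cauchy hB n k Kx t01.
  have [l1 h1] : exists l, forall n, `|l - (vcurve n x t).1| <= B * 2^-1 ^+ n.
    apply: (@geometric_limit _ (fun n => (vcurve n x t).1)) => n k.
    exact: le_trans (abs1_le_euclid _ _) (hc n k).
  have [l2 h2] : exists l, forall n, `|l - (vcurve n x t).2| <= B * 2^-1 ^+ n.
    apply: (@geometric_limit _ (fun n => (vcurve n x t).2)) => n k.
    exact: le_trans (abs2_le_euclid _ _) (hc n k).
  exists (l1, l2) => _ n; apply: (le_trans (euclid_le_abs _ _)) => /=.
  by have := h1 n; have := h2 n; lra.
have [g hg] := choice ex.
have small z1 z2 (C : R) :
    (forall n, euclid_dist z1 z2 <= C + 4 * B * 2^-1 ^+ n) -> euclid_dist z1 z2 <= C.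
  move=> h; apply/ler_addgt0Pr => e e0.
  have [n hn] := @half_expn_small R (4 * B) e e0.
  by apply: (le_trans (h n)); rewrite lerD2l ltW.
have eq0 z1 z2 : euclid_dist z1 z2 <= 0 -> z1 = z2.
  move=> h; have := abs1_le_euclid z1 z2; have := abs2_le_euclid z1 z2.
  move=> /le_trans/(_ h); rewrite normr_le0 subr_eq0 => /eqP e2.
  move=> /le_trans/(_ h); rewrite normr_le0 subr_eq0 => /eqP e1.
  by case: z1 z2 e1 e2 {h} => a b [c d] /= -> ->.
have Bn n : 0 <= B * 2^-1 ^+ n by rewrite mulr_ge0 ?half_expn_ge0 ?ltW.
exists g; split.
- move=> s t s01 t01; rewrite mul1r; apply: small => n.
  apply: (le_trans (euclid_dist_tri (vcurve n x s) _ _)).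
  have hgs := hg s s01 n; have hgt := hg t t01 n.
  have [/(_ s t s01 t01) hl _ _ _] := vcurve_lip n Kx.
  have h3 := euclid_dist_tri (vcurve n x t) (vcurve n x s) (g t).
  rewrite [euclid_dist (vcurve n x t) _]euclid_distC in h3.
  lra.
- move=> t t01; apply: in_closed; first exact: gasket_closed hK.
  move=> e e0; have [n hn] := @half_expn_small R (2 * B) e e0.
  exists (vcurve n x t); last exact: le_lt_trans (hg t t01 n) hn.
  by case: (vcurve_lip n Kx) => _ h _ _; exact: h.
- apply/eq0/small => n; rewrite -(vcurve0 n x) add0r.
  have h01 : (0 : R) <= (0 : R) <= 1 by rewrite lexx ler01.
  by have := hg 0 h01 n; have := Bn n; lra.
- apply/eq0/small => n; rewrite add0r.
  apply: (le_trans (euclid_dist_tri (vcurve n x 1) _ _)).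
  have h01 : (0 : R) <= (1 : R) <= 1 by rewrite lexx ler01.
  by have := hg 1 h01 n; have := vcurve1_near hB n Kx; have := Bn n; lra.
Qed.

Lemma gasket_conn x y : K x -> K y -> lip_conn K 4 x y.
Proof.
move=> Kx Ky; rewrite (_ : 4 = 2 * 2); last by ring.
have h21 : (1 : R) <= 2 by lra.
apply: (@lip_conn_trans _ _ _ _ (q (fl y))) => //.
  rewrite -[X in lip_conn K X _ _]mulr1.
  apply: lip_conn_trans (seg_conn (fl x) (fl y)) => //.
  by apply: lip_conn_sym; exact: vertex_conn.
by apply: lip_conn_le h21 _; exact: vertex_conn.
Qed.

Lemma cell_conn w x y : cell q K w x -> cell q K w y ->
  lip_conn K (4 * 2^-1 ^+ size w) x y.
Proof.
move=> [x' Kx' <-] [y' Ky' <-]; rewrite mulrC.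
by apply: lip_conn_word; exact: gasket_conn.
Qed.

Lemma cell_conn_neighbour w c x y : cell q K w x -> cell q K (neighbour w c).1 y ->
  lip_conn K (8 * 2^-1 ^+ size w) x y.
Proof.
move=> cx cy; rewrite (_ : 8 * _ = 2 * (4 * 2^-1 ^+ size w)); last by ring.
apply: (@lip_conn_trans _ _ _ _ (gasket_word_map q w (q c))).
- by rewrite mulr_ge0 ?half_expn_ge0.
- by apply: cell_conn => //; exists (q c) => //; exact: (vertex_in_K hK).
- rewrite -(size_neighbour w c); apply: cell_conn => //.
  exists (q (neighbour w c).2); first exact: (vertex_in_K hK).
  by rewrite gasket_word_map_neighbour.
Qed.

End GasketCurves.

(** * Geodesic distance and geodesic balls *)

Section Geodesic.
Context {R : realType}.
Implicit Types (x y z : (R * R)%type) (g : R -> R * R) (K : set (R * R)).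

Lemma eq_ler (a b : R) : a = b -> a <= b.
Proof. by move=> ->. Qed.

Lemma within_continuousP g :
  {within `[0 : R, 1], continuous g} <->
  (forall t, 0 <= t <= 1 -> forall e, 0 < e -> exists2 d, 0 < d &
     forall s, 0 <= s <= 1 -> `|s - t| < d -> euclid_dist (g s) (g t) < e).
Proof.
split=> [/subspace_continuousP h t t01 e e0|h].
  have tI : `[0 : R, 1]%classic t by rewrite /= in_itv.
  have e2 : 0 < e / 2 by rewrite divr_gt0.
  have := h t tI => /(_ _ (nbhsx_ballx (g t) (e / 2) e2)).
  rewrite /= /within /= => /nbhs_ballP[d /= d0 hd]; exists d => // s s01 st.
  have /= := hd s; rewrite /ball /= distrC in_itv /= => /(_ st s01) [b1 b2].
  apply: (le_lt_trans (euclid_le_abs _ _)).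
  rewrite distrC [X in _ + X]distrC; move: b1 b2; rewrite /ball /=; lra.
apply/subspace_continuousP => t; rewrite /= in_itv /= => t01.
apply/cvg_ballP => e e0; have [d d0 hd] := h t t01 e e0.
rewrite near_withinE; apply/nbhs_ballP; exists d => //= s.
rewrite /ball /= distrC in_itv /= => st s01.
have := hd s s01 st; rewrite euclid_distC => hs; split => /=.
  exact: le_lt_trans (abs1_le_euclid _ _) hs.
exact: le_lt_trans (abs2_le_euclid _ _) hs.
Qed.

(** The recursive form of [polygonal_length], for inductions along a partition. *)
Fixpoint polygon_length g (a : R) (s : seq R) : R :=
  if s is b :: s' then euclid_dist (g a) (g b) + polygon_length g b s' else 0.

Lemma polygonal_lengthE g a b s : polygonal_length g a b s = polygon_length g a s.
Proof.
rewrite /polygonal_length; elim: s a => [|c s IH] a /=; first by rewrite big_geq.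
by rewrite big_nat_recl//= -IH.
Qed.

Lemma path_lt_last (a : R) s : path <%R a s -> a <= last a s.
Proof.
elim: s a => [//|b s IH] a /= /andP[ab /IH]; exact/le_trans/ltW.
Qed.

Lemma polygon_length_lip g L a b s : (forall u v, a <= u -> u <= v -> v <= b ->
    euclid_dist (g u) (g v) <= L * (v - u)) ->
  path <%R a s -> last a s = b -> polygon_length g a s <= L * (b - a).
Proof.
elim: s a => [|c s IH] a h /=; first by move=> _ ->; rewrite subrr mulr0.
move=> /andP[ac p] E.
have cb : c <= b by rewrite -E path_lt_last.
have h1 := h a c (lexx _) (ltW ac) cb.
have h2 : polygon_length g c s <= L * (b - c).
  by apply: IH => // u v cu; apply: h; exact: le_trans (ltW ac) cu.
by apply: (le_trans (lerD h1 h2)); rewrite -mulrDr; apply: eq_ler; congr (_ * _); ring.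
Qed.

Lemma lip_curve_continuous K L x y g : lip_curve K L x y g ->
  {within `[0 : R, 1], continuous g}.
Proof.
move=> [h _ _ _]; apply/within_continuousP => t t01 e e0.
have L1 : 0 < `|L| + 1 by rewrite ltr_wpDl.
exists (e / (`|L| + 1)); first by rewrite divr_gt0.
move=> s s01 st; apply: (le_lt_trans (h _ _ s01 t01)).
rewrite ltr_pdivlMr// in st; apply: le_lt_trans st.
rewrite mulrC ler_wpM2l// (le_trans (ler_norm _))// lerDl//.
Qed.

Lemma geodesic_dist_lip K L x y : lip_conn K L x y ->
  (geodesic_dist K x y <= L%:E)%E.
Proof.
move=> [g hg]; have [h gK g0 g1] := hg.
apply: (@le_trans _ _ (curve_length g)).
  apply: ereal_inf_lbound; exists g => //; split => //.
    exact: lip_curve_continuous hg.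
  by move=> _ [t + <-]; rewrite /= in_itv /=; exact: gK.
apply: ge_ereal_sup => _ [s [p /eqP E] <-]; rewrite lee_fin polygonal_lengthE.
rewrite (_ : L = L * (1 - 0)); last by rewrite subr0 mulr1.
apply: polygon_length_lip p E => u v u0 uv v1.
rewrite (_ : v - u = `|u - v|); last by rewrite distrC ger0_norm// subr_ge0.
by apply: h; apply/andP; split => //; [exact: le_trans v1|exact: le_trans uv].
Qed.

Lemma euclid_le_geodesic K x y : ((euclid_dist x y)%:E <= geodesic_dist K x y)%E.
Proof.
apply: le_ereal_inf_tmp => _ [g [_ _ <- <-] <-].
apply: ereal_sup_ubound; exists [:: 1]; first by split => //=; rewrite ltr01.
by rewrite polygonal_lengthE /= addr0.
Qed.

(** The part of a partition beyond 1/2 costs at most the Lipschitz constant of g2;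
the rest, rescaled, is a partition for g1.  The edge that crosses 1/2 is split
at the junction point g1 1. *)
Lemma polygon_length_glue g1 g2 K L y z a s : lip_curve K L y z g2 -> 0 <= L -> g1 1 = y ->
  0 <= a < 2^-1 -> path <%R a s -> last a s = 1 ->
  exists t, [/\ path <%R (2 * a) t, last (2 * a) t = 1 &
    polygon_length (glue g1 g2) a s <= polygon_length g1 (2 * a) t + L].
Proof.
move=> [h2 _ g20 _] L0 g11; elim: s a => [|b s IH] a /andP[a0 a2] /=; first by lra.
move=> /andP[ab p] E; have b1 : b <= 1 by rewrite -E path_lt_last.
have [b2|b2] := ltP b 2^-1.
  have [|t [t1 t2 t3]] := IH b _ p E; first by rewrite b2 (le_trans a0)// ltW.
  exists (2 * b :: t); split => //=; first by rewrite t1 ltr_pM2l// ab.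
  have gl c : c < 2^-1 -> glue g1 g2 c = g1 (2 * c) by move=> c2; rewrite /glue ltW.
  by rewrite !gl//; lra.
exists [:: 1]; split => //=; first by rewrite andbT; lra.
have hb : polygon_length (glue g1 g2) b s <= (2 * L) * (1 - b).
  apply: polygon_length_lip p E => u v bu uv v1.
  have gl w : 2^-1 <= w -> glue g1 g2 w = g2 (2 * w - 1).
    move=> w2; rewrite /glue; case: (leP w 2^-1) => // w2'.
    have -> : w = 2^-1 by apply/le_anti; rewrite w2' w2.
    rewrite (_ : 2 * _ = 1); last by rewrite mulfV ?pnatr_eq0.
    by rewrite subrr g20.
  rewrite !gl; [|exact: le_trans (le_trans bu uv)|exact: le_trans bu].
  apply: (le_trans (h2 _ _ _ _)); [lra|lra|].
  rewrite distrC ger0_norm; last lra.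
  by apply: eq_ler; ring.
have h1 : euclid_dist (glue g1 g2 a) (glue g1 g2 b) <=
    euclid_dist (g1 (2 * a)) (g1 1) + L * (2 * b - 1).
  rewrite /glue ifT ?(ltW a2)//; case: (leP b 2^-1) => b2'.
    have -> : b = 2^-1 by apply/le_anti; rewrite b2' b2.
    by rewrite mulfV ?pnatr_eq0// subrr mulr0 addr0.
  apply: (le_trans (euclid_dist_tri (g1 1) _ _)); rewrite lerD2l g11 -g20.
  apply: (le_trans (h2 _ _ _ _)); [lra|lra|].
  by rewrite sub0r normrN ger0_norm//; lra.
lra.
Qed.

Lemma glue_continuous g1 g2 K L y z : lip_curve K L y z g2 -> 0 <= L -> g1 1 = y ->
  {within `[0 : R, 1], continuous g1} ->
  {within `[0 : R, 1], continuous (glue g1 g2)}.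
Proof.
move=> [h2 _ g20 _] L0 g11 /within_continuousP c1; apply/within_continuousP.
move=> t t01 e e0; have [t2|t2] := leP t 2^-1.
  have [||d d0 hd] := c1 (2 * t) _ (e / 2); [lra|by rewrite divr_gt0|].
  have L4 : 0 < 4 * L + 1 by lra.
  exists (Num.min (d / 2) (e / (4 * L + 1))).
    by rewrite lt_min !divr_gt0.
  move=> s s01; rewrite lt_min => /andP[sd se].
  rewrite ltr_pdivlMr// in se.
  rewrite /glue [X in euclid_dist _ X]ifT//; case: (leP s 2^-1) => s2.
    apply: (@lt_trans _ _ (e / 2)); last by lra.
    apply: hd; first lra.
    by rewrite -mulrBr normrM ger0_norm//; lra.
  apply: (le_lt_trans (euclid_dist_tri (g1 1) _ _)).
  have a1 : euclid_dist (g1 1) (g1 (2 * t)) < e / 2.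
    move: sd; rewrite ger0_norm; last by lra.
    move=> sd; apply: hd; first by rewrite lexx ler01.
    by rewrite ger0_norm; lra.
  have a2 : euclid_dist (g2 (2 * s - 1)) (g1 1) <= L * (2 * s - 1).
    rewrite g11 -g20; apply: (le_trans (h2 _ _ _ _)); [lra|lra|].
    by rewrite subr0 ger0_norm//; lra.
  have a3 : L * (2 * s - 1) <= 2 * (L * `|s - t|).
    rewrite mulrCA ler_wpM2l// ger0_norm; lra.
  by have := normr_ge0 (s - t); lra.
have L2 : 0 < 2 * L + 1 by lra.
exists (Num.min (t - 2^-1) (e / (2 * L + 1))).
  by rewrite lt_min divr_gt0// subr_gt0 t2.
move=> s s01; rewrite lt_min => /andP[sd se].
rewrite ltr_pdivlMr// in se.
have s2 : 2^-1 < s by move: sd; rewrite ltr_norml => /andP[]; lra.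
rewrite /glue !ifF; [|by apply/negbTE; rewrite -ltNge..].
apply: (le_lt_trans (h2 _ _ _ _)); [lra|lra|].
rewrite (_ : 2 * s - 1 - _ = 2 * (s - t)); last by ring.
by rewrite normrM ger0_norm//; have := normr_ge0 (s - t); lra.
Qed.

(** Instead of a triangle inequality for general curves, it suffices to append a
Lipschitz curve to an almost minimal one. *)
Lemma geodesic_dist_lt_lip K L x y z (r : R) : 0 <= L ->
  (geodesic_dist K x y < r%:E)%E -> lip_conn K L y z ->
  (geodesic_dist K x z <= (r + L)%:E)%E.
Proof.
move=> L0 /ereal_inf_lt[_ [g1 [c1 k1 g10 g11] <-] len] [g2 hg2].
have [h2 k2 g20 g21] := hg2.
apply: (@le_trans _ _ (curve_length (glue g1 g2))).
  apply: ereal_inf_lbound; exists (glue g1 g2) => //; split.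
  - exact: glue_continuous hg2 L0 g11 c1.
  - move=> _ [t + <-]; rewrite /= in_itv /= => t01; rewrite /glue.
    case: (leP t 2^-1) => t2; last by apply: k2; lra.
    by apply: k1; exists (2 * t) => //; rewrite /= in_itv /=; lra.
  - by rewrite /glue ifT ?mulr0// invr_ge0.
  - rewrite /glue ifF; last by apply/negbTE; rewrite -ltNge; lra.
    by rewrite -g21; congr g2; ring.
apply: ge_ereal_sup => _ [s [p /eqP E] <-]; rewrite polygonal_lengthE.
have z2 : 0 <= (0 : R) < 2^-1 by rewrite lexx invr_gt0 ltr0n.
have [t [p1 p2 p3]] := polygon_length_glue hg2 L0 g11 z2 p E.
rewrite mulr0 in p1 p2 p3.
apply: (@le_trans _ _ (polygon_length g1 0 t + L)%:E); first by rewrite lee_fin.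
rewrite lee_fin lerD2r -lee_fin; apply: le_trans (ltW len).
apply: ereal_sup_ubound; exists t; last by rewrite polygonal_lengthE.
by split => //; apply/eqP.
Qed.

End Geodesic.

Section GasketBalls.
Context {R : realType} (q : 'I_3 -> R * R) (K : set (R * R)).
Context (hq : unit_equilateral q) (hK : is_gasket q K).
Implicit Types (x y z : (R * R)%type) (w : word).

Lemma ball_near n r x y : r <= 2^-1 ^+ n.+1 -> geodesic_ball K x r y ->
  forall i, `|bary q i x - bary q i y| < 2^-1 ^+ n.
Proof.
move=> rn [Ky d] i; apply: (le_lt_trans (bary_lip hq _ _ _)).
have := le_lt_trans (euclid_le_geodesic _ _ _) d; rewrite lte_fin.
by move: rn; rewrite exprS; lra.
Qed.

Lemma ball_sub_cells n r x w y w' : r <= 2^-1 ^+ n.+1 -> size w = n -> size w' = n ->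
  cell q K w x -> cell q K w' y -> geodesic_ball K x r y ->
  w' = w \/ exists c, w' = (neighbour w c).1.
Proof.
move=> rn sw sw' cx cy B; apply: (cells_near hq hK) cx cy _.
  by rewrite sw sw'.
by rewrite sw; exact: ball_near B.
Qed.

Lemma cell_sub_ball r w x y : 8 * 2^-1 ^+ size w < r -> cell q K w x ->
  cell q K w y \/ (exists c, cell q K (neighbour w c).1 y) ->
  geodesic_ball K x r y.
Proof.
move=> wr cx; have h0 := half_expn_ge0 (R := R) (size w).
have key : lip_conn K (8 * 2^-1 ^+ size w) x y -> K y -> geodesic_ball K x r y.
  move=> h Ky; split => //; apply: le_lt_trans (geodesic_dist_lip h) _.
  by rewrite lte_fin.
case=> [cy|[c cy]]; apply: key.
- apply: lip_conn_le (cell_conn hq hK cx cy); lra.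
- exact: cell_sub_K hK _ _ cy.
- exact: cell_conn_neighbour cx cy.
- exact: cell_sub_K hK _ _ cy.
Qed.

(** Geodesic balls are open in K for the Euclidean topology, since nearby points
lie in equal or neighbouring small cells and are joined by short curves. *)
Lemma geodesic_ball_open r x y : geodesic_ball K x r y ->
  exists2 e, 0 < e & forall z, K z -> euclid_dist y z < e -> geodesic_ball K x r z.
Proof.
move=> [Ky d].
have [r' dr' rr'] : exists2 r' : R, (geodesic_dist K x y < r'%:E)%E & r' < r.
  case E : (geodesic_dist K x y) d => [l| |] //.
    by rewrite lte_fin => lr; exists ((l + r) / 2); rewrite ?lte_fin; lra.
  by move=> _; have := euclid_le_geodesic K x y; rewrite E.
have rr0 : 0 < r - r' by rewrite subr_gt0.
have [n hn] := half_expn_small 8 rr0.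
exists (2^-1 ^+ n.+1); first by rewrite exprn_gt0.
move=> z Kz yz; split => //.
have cy := address_in_cell hK n Ky; have cz := address_in_cell hK n Kz.
have sz t : size (address q K n t) = n by exact: size_address.
have near i : `|bary q i y - bary q i z| < 2^-1 ^+ n.
  by apply: (le_lt_trans (bary_lip hq _ _ _)); move: yz; rewrite exprS; lra.
have h0 := half_expn_ge0 (R := R) n.
have : lip_conn K (8 * 2^-1 ^+ n) y z.
  have [||E|[c E]] := cells_near hq hK _ cy cz _; rewrite ?sz//.
    rewrite E in cz; have := cell_conn hq hK cy cz; rewrite sz.
    by apply: lip_conn_le; lra.
  by rewrite E in cz; have := cell_conn_neighbour hq hK cy cz; rewrite sz.
move=> /(geodesic_dist_lt_lip _ dr') h; apply: le_lt_trans (h _) _.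
  by rewrite mulr_ge0.
by rewrite lte_fin; lra.
Qed.

End GasketBalls.

(** * Measurability and the measure of cells *)

Section PlaneMeasurability.
Context {R : realType}.

(** The Borel sets of the plane are generated here by measurable rectangles; an open
set is the union of the countably many rational boxes that it contains. *)
Lemma open_measurable_plane (U : set (R * R)) : open U -> measurable U.
Proof.
move=> oU.
pose box (i : rat * rat * nat) : set (R * R) :=
  ball (ratr i.1.1 : R) (i.2.+1%:R^-1) `*` ball (ratr i.1.2 : R) (i.2.+1%:R^-1).
pose F i := if `[< box i `<=` U >] then box i else set0.
have -> : U = \bigcup_i F i.
  apply/seteqP; split => [x Ux|x [i _]]; last first.
    by rewrite /F; case: asboolP => // h /h.
  have /nbhs_ballP[e /= e0 xU] : nbhs x U by exact: open_nbhs_nbhs.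
  have e2 : 0 < e / 2 by rewrite divr_gt0.
  pose n := Num.bound (2 / e).
  have hn : (n.+1%:R : R)^-1 < e / 2.
    rewrite -[e / 2]invrK ltf_pV2 ?posrE ?invr_gt0// invf_div.
    apply: lt_trans (archi_boundP _) _; first by rewrite divr_ge0// ltW.
    by rewrite ltr_nat.
  have n0 : (0 : R) < n.+1%:R^-1 by rewrite invr_gt0.
  have rat_near (t : R) : exists a : rat, `|ratr a - t| < n.+1%:R^-1.
    have [|a /itvP ha] := @rat_in_itvoo R (t - n.+1%:R^-1) (t + n.+1%:R^-1); first by rewrite ltrBlDr -addrA ltrDl addr_gt0.
    by exists a; rewrite ltr_distl !ha.
  have [a ha] := rat_near x.1; have [b hb] := rat_near x.2.
  exists (a, b, n) => //; rewrite /F asboolT; first by split.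
  move=> y [/= y1 y2]; apply: xU; split; rewrite /ball /= in y1 y2 *.
    rewrite (le_lt_trans (ler_distD (ratr a) _ _))// distrC.
    by move: hn ha y1; move: (_^-1) => d; lra.
  rewrite (le_lt_trans (ler_distD (ratr b) _ _))// distrC.
  by move: hn hb y2; move: (_^-1) => d; lra.
apply: countable_bigcupT_measurable; first exact: countableP.
move=> i; rewrite /F; case: asboolP => // _.
by apply: measurableX; apply: open_measurable; exact: ball_open.
Qed.

Lemma closed_measurable_plane (A : set (R * R)) : closed A -> measurable A.
Proof.
by move=> cA; rewrite -[A]setCK; apply: measurableC; apply: open_measurable_plane; exact: closed_openC.
Qed.

End PlaneMeasurability.

Section GasketMeasure.
Context {R : realType} (q : 'I_3 -> R * R) (K : set (R * R)).
Context (hq : unit_equilateral q) (hK : is_gasket q K).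
Context (mu : {measure set (R * R)%type -> \bar R}) (hmu : is_gasket_measure q K mu).
Implicit Types (x y z : (R * R)%type) (w : word).

Lemma measurable_gasket : measurable K.
Proof. by apply: closed_measurable_plane; exact: gasket_closed hK. Qed.

Lemma measurable_gasket_inv i : measurable_fun setT (@gasket_inv R q i).
Proof.
apply: measurable_fun_pair.
  apply: measurable_funB => //; apply: measurable_funM => //; exact: measurable_fst.
apply: measurable_funB => //; apply: measurable_funM => //; exact: measurable_snd.
Qed.

Lemma gasket_map_imageE i (A : set (R * R)) :
  gasket_map q i @` A = gasket_inv q i @^-1` A.
Proof.
apply/seteqP; split => [_ [x Ax <-]|x Ax] /=; first by rewrite gasket_mapK.
by exists (gasket_inv q i x) => //; rewrite gasket_invK.
Qed.

Lemma measurable_gasket_map i (A : set (R * R)) : measurable A ->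
  measurable (gasket_map q i @` A).
Proof.
move=> mA; rewrite gasket_map_imageE -[_ @^-1` _]setTI.
exact: measurable_gasket_inv.
Qed.

Lemma measurable_cell w : measurable (cell q K w).
Proof.
elim: w => [|a w IH].
  by rewrite /cell (_ : gasket_word_map q [::] = id)// image_id; exact: measurable_gasket.
rewrite /cell (_ : gasket_word_map q (a :: w) = gasket_map q a \o gasket_word_map q w)//.
by rewrite -image_comp; apply: measurable_gasket_map.
Qed.

Lemma geodesic_ball_measurable r x : measurable (geodesic_ball K x r).
Proof.
pose U : set (R * R) := \bigcup_(e in [set u : (R * R) * R | 0 < u.2 /\
   (forall z, K z -> euclid_dist u.1 z < u.2 -> geodesic_ball K x r z)])
   [set z | euclid_dist e.1 z < e.2].
have -> : geodesic_ball K x r = K `&` U.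
  apply/seteqP; split => [y yB|y [Ky [[u e] /= [e0 h] uy]]]; last exact: h.
  have [e e0 he] := geodesic_ball_open hq hK yB.
  by split; [case: yB|exists (y, e) => //=; rewrite euclid_distxx].
apply: measurableI; first exact: measurable_gasket.
apply: open_measurable_plane; apply: bigcup_open => -[u e] /= [e0 _].
rewrite openE => z /= uz; apply/nbhs_ballP.
exists ((e - euclid_dist u z) / 2) => /=; first by rewrite divr_gt0// subr_gt0.
move=> y [/= z1 z2]; rewrite /ball /= in z1 z2.
apply: le_lt_trans (euclid_dist_tri z _ _) _.
by have := euclid_le_abs z y; lra.
Qed.

(** The points of K with selected address w.  These sets differ from the cells at
junction points only, and, unlike the cells, they partition K exactly, which
allows integrals to be split without discussing the null sets of junctions. *)
Definition address_cell w : set (R * R) := K `&` [set x | address q K (size w) x = w].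

Lemma measurable_first_letter a : measurable [set x | first_letter q K x = a].
Proof.
have m i : measurable (gasket_map q i @` K).
  by apply: measurable_gasket_map; exact: measurable_gasket.
set K0 := gasket_map q o0 @` K; set K1 := gasket_map q o1 @` K.
have E0 : [set x | first_letter q K x = o0] = K0.
  apply/seteqP; split => x /=; rewrite /first_letter -/K0 -/K1.
    by case: asboolP => //; case: asboolP.
  by move=> h; rewrite asboolT.
have E1 : [set x | first_letter q K x = o1] = K1 `\` K0.
  apply/seteqP; split => x /=; rewrite /first_letter -/K0 -/K1.
    by case: asboolP => //; case: asboolP.
  by move=> [h h']; rewrite asboolF// asboolT.
have E2 : [set x | first_letter q K x = o2] = ~` (K0 `|` K1).
  apply/seteqP; split => x /=; rewrite /first_letter -/K0 -/K1.
    by case: asboolP => //; case: asboolP => // h1 h0 _ [].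
  by move=> /not_orP[h0 h1]; rewrite !asboolF.
elim/I3_ind: a; rewrite ?E0 ?E1 ?E2; first exact: m.
  by apply: measurableD; exact: m.
by apply: measurableC; apply: measurableU; exact: m.
Qed.

Lemma measurable_address_eq n w : measurable [set x | address q K n x = w].
Proof.
elim: n w => [|n IH] [|a w].
- by rewrite (_ : [set _ | _] = setT)//; apply/seteqP.
- by rewrite (_ : [set _ | _] = set0)//; apply/seteqP; split => x.
- by rewrite (_ : [set _ | _] = set0)//; apply/seteqP; split => x.
rewrite (_ : [set _ | _] = [set x | first_letter q K x = a] `&`
   (gasket_inv q a @^-1` [set x | address q K n x = w])); last first.
  apply/seteqP; split => x /=; first by move=> [<- <-].
  by move=> [E1 E2]; congr (_ :: _) => //; rewrite -E2 /address_tail E1.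
apply: measurableI; first exact: measurable_first_letter.
by rewrite -[_ @^-1` _]setTI; apply: measurable_gasket_inv.
Qed.

Lemma measurable_address_cell w : measurable (address_cell w).
Proof.
by apply: measurableI; [exact: measurable_gasket|exact: measurable_address_eq].
Qed.

Lemma measurable_address_fun n (g : word -> R) :
  measurable_fun setT (fun x => g (address q K n x)).
Proof.
move=> _ Y mY; rewrite setTI.
rewrite (_ : _ @^-1` _ = \bigcup_(w in [set` words n] `&` (g @^-1` Y))
   [set x | address q K n x = w]).
  apply: fin_bigcup_measurable; last by move=> *; exact: measurable_address_eq.
  exact/finite_setIl/finite_seq.
apply/seteqP; split => [x /= Yx|x /= [w [_ /= Yw] E]]; last by rewrite E.
exists (address q K n x) => //; split => //=.
by rewrite mem_words size_address.
Qed.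

Lemma address_cell_sub_cell w : address_cell w `<=` cell q K w.
Proof. by move=> x [Kx /= <-]; exact: address_in_cell. Qed.

Lemma trivIset_address_cell n : trivIset [set` words n] address_cell.
Proof.
move=> w w' /=; rewrite !mem_words => /eqP sw /eqP sw' [x [[_ /= E] [_ /= E']]].
by rewrite -E -E' sw sw'.
Qed.

Lemma gasket_address_cellE n : K = \big[setU/set0]_(w <- words n) address_cell w.
Proof.
rewrite -bigcup_seq; apply/seteqP; split => [x Kx|x [w _ []]//].
exists (address q K n x); first by rewrite /= mem_words size_address.
by split => //=; rewrite size_address.
Qed.

Lemma address_cell_address_cellE v m : address_cell v = \big[setU/set0]_(w <- words m) address_cell (v ++ w).
Proof.
rewrite -bigcup_seq; apply/seteqP; split => [x [Kx /= Ex]|x [w /= + [Kx /=]]].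
  exists (address q K m (iter (size v) (address_tail q K) x)) => /=.
    by rewrite mem_words size_address.
  by split => //=; rewrite size_cat address_add Ex size_address.
rewrite mem_words size_cat address_add => /eqP sw /eqP.
by rewrite eqseq_cat ?size_address// => /andP[/eqP E _]; split.
Qed.

Lemma trivIset_address_cell_cat v m : trivIset [set` words m] (fun w => address_cell (v ++ w)).
Proof.
move=> w w' /=; rewrite !mem_words => /eqP sw /eqP sw' [x [[_ /= E] [_ /= E']]].
move: E E'; rewrite !size_cat sw sw' => -> /eqP.
by rewrite eqseq_cat// => /andP[_ /eqP].
Qed.

Lemma mu_gasket : mu K = 1%E.
Proof.
have := hmu.2 [::]; rewrite expr0 invr1 => <-.
by congr (mu _); rewrite (_ : gasket_word_map q [::] = id)// image_id.
Qed.

Lemma mu_setT : mu [set: R * R] = 1%E.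
Proof.
rewrite -(setvU K) setUC measureU ?setICr//; [|exact: measurable_gasket|exact: measurableC measurable_gasket].
transitivity (1 + 0 : \bar R)%E; last by rewrite adde0.
by congr (_ + _)%E; [exact: mu_gasket|exact: hmu.1].
Qed.

Lemma mu_cell w : mu (cell q K w) = (3 ^- size w)%:E.
Proof. exact: hmu.2. Qed.

Lemma mu_fin (A : set (R * R)) : measurable A -> mu A \is a fin_num.
Proof.
move=> mA; rewrite ge0_fin_numE//; apply: (@le_lt_trans _ _ (mu setT)).
  by apply: le_measure => //; rewrite inE.
by rewrite mu_setT ltry.
Qed.

Lemma integral_gasket_address_cell n (F : R * R -> \bar R) : measurable_fun K F ->
  (forall x, K x -> (0 <= F x)%E) ->
  (\int[mu]_(x in K) F x = \sum_(w <- words n) \int[mu]_(x in address_cell w) F x)%E.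
Proof.
move=> mF F0; rewrite {1}(gasket_address_cellE n); apply: ge0_integral_bigsetU.
- exact: measurable_address_cell.
- exact: uniq_words.
- exact: trivIset_address_cell.
- by rewrite -gasket_address_cellE.
- by rewrite -gasket_address_cellE.
Qed.

Lemma integral_address_cell_address_cell v m (F : R * R -> \bar R) : measurable_fun (address_cell v) F ->
  (forall x, address_cell v x -> (0 <= F x)%E) ->
  (\int[mu]_(x in address_cell v) F x =
   \sum_(w <- words m) \int[mu]_(x in address_cell (v ++ w)) F x)%E.
Proof.
move=> mF F0; rewrite {1}(address_cell_address_cellE v m).
apply: (@ge0_integral_bigsetU _ _ _ _ _ (fun w => address_cell (v ++ w))).
- by move=> w; exact: measurable_address_cell.
- exact: uniq_words.
- exact: trivIset_address_cell_cat.
- by rewrite -address_cell_address_cellE.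
- by rewrite -address_cell_address_cellE.
Qed.

(** Each of the 3^n atoms has at most the mass 3^-n of its cell, and their masses
add up to 1, so equality holds for all of them. *)
Lemma mu_address_cell w : mu (address_cell w) = (3 ^- size w)%:E.
Proof.
have le v : fine (mu (address_cell v)) <= 3 ^- size v.
  rewrite -lee_fin fineK; last by apply: mu_fin; exact: measurable_address_cell.
  rewrite -mu_cell; apply: le_measure; rewrite ?inE.
  - exact: measurable_address_cell.
  - exact: measurable_cell.
  - exact: address_cell_sub_cell.
have sum1 : \sum_(v <- words (size w)) fine (mu (address_cell v)) = 1.
  apply: EFin_inj; rewrite -sumEFin -[RHS]mu_gasket.
  transitivity (\sum_(v <- words (size w)) \int[mu]_(x in address_cell v) cst 1%E x)%E.
    apply: eq_bigr => v _; rewrite integral_cst; last exact: measurable_address_cell.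
    by rewrite mul1e fineK//; by apply: mu_fin; exact: measurable_address_cell.
  rewrite -integral_gasket_address_cell ?integral_cst ?mul1e//; exact: measurable_gasket.
have sum2 : \sum_(v <- words (size w)) (3 ^- (size w) : R) = 1.
  rewrite big_const_seq count_predT size_words iter_addr_0 -[_ *+ (_ ^ _)]mulr_natr natrX.
  by rewrite mulVf// expf_neq0.
apply/eqP; rewrite -[mu _]fineK; last by apply: mu_fin; exact: measurable_address_cell.
rewrite eqe eq_le le /= -subr_le0.
have ww : w \in words (size w) by rewrite mem_words.
have E : \sum_(v <- words (size w)) (3 ^- size w - fine (mu (address_cell v))) = 0.
  by rewrite sumrB sum1 sum2 subrr.
rewrite -E (bigD1_seq w) ?uniq_words//= lerDl big_seq_cond sumr_ge0 => // v.
by rewrite mem_words => /andP[/eqP <- _]; rewrite subr_ge0.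
Qed.

End GasketMeasure.

(** * Cell averages and two-sided energy bounds *)

Section Jensen.
Context {R : realType}.

(** The convex function t^p lies above its tangent at s. *)
Lemma powR_tangent (p s t : R) : 1 <= p -> 0 <= s -> 0 <= t ->
  p * s `^ (p - 1) * t <= t `^ p + (p - 1) * s `^ p.
Proof.
move=> p1 s0 t0; have [->|pn1] := eqVneq p 1.
  by rewrite subrr powRr0 !mul1r mul0r addr0 powRr1.
have {pn1}p1 : 1 < p by rewrite lt_neqAle eq_sym pn1.
have p0 : 0 < p by apply: lt_trans p1.
have pm1 : 0 < p - 1 by rewrite subr_gt0.
have := @conjugate_powR R t (s `^ (p - 1)) p (p / (p - 1)) t0 (powR_ge0 _ _) p0.
rewrite divr_gt0// => /(_ isT).
have -> : p^-1 + (p / (p - 1))^-1 = 1 by field; rewrite !gt_eqF.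
move=> /(_ erefl); rewrite -powRrM (_ : (p - 1) * (p / (p - 1)) = p); last first.
  by field; rewrite gt_eqF.
have -> : s `^ p / (p / (p - 1)) = (p - 1) * s `^ p / p by field; rewrite !gt_eqF.
rewrite -mulrDl ler_pdivlMr//; apply: le_trans; apply: eq_ler; ring.
Qed.

(** The inner average of the energy is not known to be measurable as a function of
the centre of the ball.  For nonnegative functions the integral is a supremum
over simple functions below the integrand, so it is monotone without any
measurability. *)
Lemma ge0_le_integral_nonmeasurable d (T : measurableType d)
    (mu : {measure set T -> \bar R}) (D : set T) (f1 f2 : T -> \bar R) :
  (forall x, D x -> (0 <= f1 x)%E) -> (forall x, D x -> (f1 x <= f2 x)%E) ->
  (\int[mu]_(x in D) f1 x <= \int[mu]_(x in D) f2 x)%E.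
Proof.
move=> f0 f12; rewrite !(integral_mkcond D).
have h10 x : (0 <= (f1 \_ D) x)%E by exact: erestrict_ge0.
have h12 x : ((f1 \_ D) x <= (f2 \_ D) x)%E.
  by rewrite !patchE; case: ifPn => // /[!inE]; exact: f12.
rewrite !ge0_integralTE//; last by move=> x; exact: le_trans (h12 x).
apply: le_ereal_sup => _ [h /= hf <-]; exists h => //= x.
exact: le_trans (hf x) (h12 x).
Qed.

Lemma measurable_powR_abs d (T : measurableType d) (A : set T) (g : T -> R) p :
  measurable_fun A g -> measurable_fun A (fun x => (`|g x| `^ p)%:E).
Proof.
move=> mg; apply/measurable_EFinP.
apply: (@measurableT_comp _ _ _ _ _ _ (fun t : R => t `^ p)).
  exact: measurable_powR.
exact: measurableT_comp.
Qed.

(** Integrate [powR_tangent] with s the mean of |g| and t = |g x|. *)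
Lemma jensen_powR d (T : measurableType d) (mu : {measure set T -> \bar R})
    (A : set T) (g : T -> R) (m p : R) :
  measurable A -> mu A = m%:E -> 0 < m -> 1 <= p ->
  mu.-integrable A (EFin \o g) ->
  ((m * `|m^-1 * fine (\int[mu]_(x in A) (g x)%:E)| `^ p)%:E <=
   \int[mu]_(x in A) (`|g x| `^ p)%:E)%E.
Proof.
move=> mA muA m0 p1 ig; have p0 : 0 < p by apply: lt_le_trans p1.
have mg : measurable_fun A g by apply/measurable_EFinP; exact: measurable_int ig.
have mag : measurable_fun A (fun x => `|g x|) by exact: measurableT_comp.
have iag := integrable_abse ig.
set I := (\int[mu]_(x in A) (`|g x| `^ p)%:E)%E.
have I0 : (0 <= I)%E by apply: integral_ge0 => x _; rewrite lee_fin powR_ge0.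
pose a := m^-1 * fine (\int[mu]_(x in A) (`|g x|)%:E).
have Jfin : (\int[mu]_(x in A) (`|g x|)%:E)%E \is a fin_num.
  exact: integrable_fin_num iag.
have J0 : (0 <= \int[mu]_(x in A) (`|g x|)%:E)%E by apply: integral_ge0.
have a0 : 0 <= a by rewrite mulr_ge0 ?invr_ge0 ?(ltW m0)// fine_ge0.
have JE : (\int[mu]_(x in A) (`|g x|)%:E = (a * m)%:E)%E.
  by rewrite -[LHS]fineK// /a mulrAC mulVf ?gt_eqF// mul1r.
have ga : `|m^-1 * fine (\int[mu]_(x in A) (g x)%:E)| <= a.
  rewrite normrM (ger0_norm (ltW _)) ?invr_gt0// ler_pM2l ?invr_gt0//.
  rewrite -lee_fin -abse_EFin !fineK//; last exact: integrable_fin_num ig.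
  by apply: le_abse_integral => //; apply/measurable_EFinP.
apply: (@le_trans _ _ (m * a `^ p)%:E).
  by rewrite lee_fin ler_pM2l// ge0_ler_powR ?nnegrE// ltW.
have [->|an0] := eqVneq a 0; first by rewrite powR0 ?gt_eqF// mulr0.
have mgp := measurable_powR_abs p mg.
have pm1 : 0 <= p - 1 by rewrite subr_ge0.
have key : ((p * a `^ (p - 1) * (a * m))%:E <= I + ((p - 1) * a `^ p * m)%:E)%E.
  rewrite EFinM -JE -ge0_integralZl_EFin//; last 2 first.
  - by apply/measurable_EFinP.
  - by rewrite mulr_ge0 ?powR_ge0// ltW.
  rewrite [((_ * m)%:E)%E]EFinM -muA -(integral_cst mu mA) -ge0_integralD//.
  - apply: ge0_le_integral_nonmeasurable.
    + by move=> x _; rewrite -EFinM lee_fin mulr_ge0// mulr_ge0 ?powR_ge0// ltW.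
    + by move=> x _; rewrite /= -EFinM -EFinD lee_fin; apply: powR_tangent.
  - by move=> x _; rewrite lee_fin mulr_ge0 ?powR_ge0.
have aE : a `^ (p - 1) * a = a `^ p.
  by rewrite -{2}[a]powRr1// -powRD ?subrK// an0 implybT.
have -> : m * a `^ p = p * a `^ (p - 1) * (a * m) - (p - 1) * a `^ p * m.
  by rewrite -aE; ring.
by rewrite EFinB leeBlDr.
Qed.

End Jensen.

Lemma ks_energy_ge0 (R : realType) (K : set (R * R))
    (mu : {measure set (R * R)%type -> \bar R}) p alpha f r :
  (0 <= ks_energy K mu p alpha f r)%E.
Proof.
apply: integral_ge0 => x _; rewrite mule_ge0 ?inve_ge0//; apply: integral_ge0 => y _.
by rewrite lee_fin mulr_ge0 ?invr_ge0 ?powR_ge0.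
Qed.

Section EnergyBounds.
Context {R : realType} (q : 'I_3 -> R * R) (K : set (R * R)).
Context (hq : unit_equilateral q) (hK : is_gasket q K).
Context (mu : {measure set (R * R)%type -> \bar R}) (hmu : is_gasket_measure q K mu).
Implicit Types (x y z : (R * R)%type) (w : word) (f : R * R -> R).

Local Notation mK := (measurable_gasket hK).
Local Notation maddress_cell := (measurable_address_cell hK).

Definition cell_avg f w : R :=
  3 ^+ size w * fine (\int[mu]_(x in address_cell q K w) (f x)%:E)%E.

Lemma muT_fin : mu setT \is a fin_num.
Proof. by rewrite (mu_setT hK hmu). Qed.

Lemma Lfun_measurable p f : f \in Lfun mu p -> measurable_fun setT f.
Proof. by move/sub_Lfun_mfun; rewrite inE. Qed.

Lemma Lfun_integrable1 p f : 1 <= p -> f \in Lfun mu p%:E ->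
  mu.-integrable setT (EFin \o f).
Proof.
move=> p1 fp; apply/Lfun1_integrable; move: fp.
by apply: Lfun_subset => //; exact: muT_fin.
Qed.

Lemma cell_avg_jensen f w c p : mu.-integrable setT (EFin \o f) -> 1 <= p ->
  ((3 ^- size w * `|cell_avg f w - c| `^ p)%:E <=
   \int[mu]_(x in address_cell q K w) (`|f x - c| `^ p)%:E)%E.
Proof.
move=> fi p1; have mw := mu_address_cell hK hmu w.
have fiw : mu.-integrable (address_cell q K w) (EFin \o f).
  by apply: integrableS fi => //; exact: maddress_cell.
have ciw : mu.-integrable (address_cell q K w) (EFin \o cst c).
  apply/integrableP; split; first by apply/measurable_EFinP.
  under eq_integral do rewrite /=.
  rewrite (integral_cst mu (maddress_cell w) (`|c|%:E)) mw.
  by rewrite -EFinM ltry.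
have giw : mu.-integrable (address_cell q K w) (EFin \o (fun x => f x - c)).
  rewrite (_ : _ \o _ = ((EFin \o f) \- (EFin \o cst c))%E)//.
  by apply: integrableB => //; exact: maddress_cell.
have ffin : (\int[mu]_(x in address_cell q K w) (f x)%:E)%E \is a fin_num.
  by apply: integrable_fin_num fiw; exact: maddress_cell.
have w0 : 0 < (3 : R) ^- size w by rewrite invr_gt0 exprn_gt0.
have := jensen_powR (maddress_cell w) mw w0 p1 giw; rewrite invrK.
suff -> : 3 ^+ size w * fine (\int[mu]_(x in address_cell q K w) (f x - c)%:E) = cell_avg f w - c by [].
under eq_integral do rewrite EFinB.
rewrite (integralB_EFin (f2 := cst c) (maddress_cell w))//.
rewrite (integral_cst mu (maddress_cell w) (c%:E)) mw -EFinM fineB//.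
by rewrite mulrBr /= mulrCA mulfV ?expf_neq0// mulr1.
Qed.

(** A ball of radius at most 16 * 2^-n is covered by four cells of level n - 5,
that of its centre and three neighbours, and each of them has mass 3^5 * 3^-n. *)
Definition ball_ratio : R := 4 * 3 ^+ 5.

Lemma ball_ratio_gt0 : 0 < ball_ratio.
Proof. by rewrite mulr_gt0// exprn_gt0. Qed.

Lemma mu_ball_le n r x : (5 <= n)%N -> r <= 16 * 2^-1 ^+ n -> K x ->
  (mu (geodesic_ball K x r) <= (ball_ratio * 3 ^- n)%:E)%E.
Proof.
move=> n5 rn Kx; set l := (n - 5)%N; have nE : n = (l + 5)%N by rewrite subnK.
set v := address q K l x; have sv : size v = l by rewrite size_address.
pose C := cell q K v `|` (cell q K (neighbour v o0).1 `|` (cell q K (neighbour v o1).1 `|`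
   cell q K (neighbour v o2).1)).
have mc w : measurable (cell q K w) by exact: (measurable_cell hK).
have mC : measurable C by do 3 (apply: measurableU => //).
apply: (@le_trans _ _ (mu C)).
  apply: le_measure; rewrite ?inE//.
    exact: (geodesic_ball_measurable hq hK).
  move=> y yB; have [Ky _] := yB.
  have rl : r <= 2^-1 ^+ l.+1.
    apply: (le_trans rn); rewrite nE exprD exprS; apply: eq_ler.
    by rewrite !exprS expr0; field.
  have cy := address_in_cell hK l Ky; have cx := address_in_cell hK l Kx.
  have := ball_sub_cells hq hK rl (size_address _ _ _ _) (size_address _ _ _ _) cx cy yB.
  case=> [E|[c E]]; first by left; rewrite /v -E.
  by right; move: E; elim/I3_ind: c => E; rewrite E in cy; [left|right; left|right; right].
have h w : size w = l -> (mu (cell q K w) <= (3 ^- l)%:E)%E.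
  by move=> <-; rewrite (mu_cell hmu).
apply: (@le_trans _ _ ((3 ^- l)%:E + ((3 ^- l)%:E + ((3 ^- l)%:E + (3 ^- l)%:E)))%E).
  apply: (le_trans (measureU2 _ _ _)) => //; first by do 2 (apply: measurableU => //).
  apply: leeD; first exact: h.
  apply: (le_trans (measureU2 _ _ _)) => //; first by apply: measurableU.
  apply: leeD; first by apply: h; rewrite size_neighbour.
  apply: (le_trans (measureU2 _ _ _)) => //.
  by apply: leeD; apply: h; rewrite size_neighbour.
rewrite -!EFinD lee_fin nE exprD invfM; apply: eq_ler.
by rewrite /ball_ratio; set u := 3 ^- l; field.
Qed.

(** The ball around x contains the cell w' = tau w, of mass 3^-n comparable with that
of the ball, and by Jensen the mean of |f y - f x|^p over y in that cell is at
least |f x - avg|^p.  The choice tau = id gives the deviation from the average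
over the own cell of x; a choice of neighbours gives the discrete energy of the
averages. *)
Lemma energy_lower n r p alpha f (tau : word -> word) : (5 <= n)%N -> 1 <= p ->
  8 * 2^-1 ^+ n < r -> r <= 16 * 2^-1 ^+ n ->
  f \in Lfun mu p%:E ->
  (forall w, tau w = w \/ exists c, tau w = (neighbour w c).1) ->
  (\int[mu]_(x in K) (`|f x - cell_avg f (tau (address q K n x))| `^ p)%:E <=
    (ball_ratio * r `^ (p * alpha))%:E * ks_energy K mu p alpha f r)%E.
Proof.
move=> n5 p1 rn1 rn2 fL htau.
have mf := Lfun_measurable fL; have fi := Lfun_integrable1 p1 fL.
have r0 : 0 < r by apply: le_lt_trans rn1; rewrite mulr_ge0 ?half_expn_ge0.
have ra : 0 < r `^ (p * alpha) by exact: powR_gt0.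
have m1 : measurable_fun K (fun x => (`|f x - cell_avg f (tau (address q K n x))| `^ p)%:E).
  apply: measurable_powR_abs; apply: measurable_funB.
    by apply: measurable_funTS.
  by apply: measurable_funTS; apply: (measurable_address_fun hK n (fun w => cell_avg f (tau w))).
pose C := (ball_ratio * r `^ (p * alpha))^-1.
have b0 := ball_ratio_gt0; have b0' := ltW b0.
have C0 : 0 < C by rewrite invr_gt0 mulr_gt0.
suff h : (C%:E * \int[mu]_(x in K) (`|f x - cell_avg f (tau (address q K n x))| `^ p)%:E
    <= ks_energy K mu p alpha f r)%E.
  apply: le_trans (lee_wpmul2l _ h); last by rewrite lee_fin mulr_ge0 ?powR_ge0.
  rewrite muleA -EFinM /C mulfV ?mul1e// mulf_neq0// gt_eqF//.
rewrite -ge0_integralZl_EFin//; [|exact: mK|exact: ltW].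
apply: ge0_le_integral_nonmeasurable => x Kx.
  by rewrite mule_ge0// lee_fin ?powR_ge0// ltW.
set B := geodesic_ball K x r; set w' := tau _.
have mB : measurable B by exact: (geodesic_ball_measurable hq hK).
have sw' : size w' = n.
  by rewrite /w'; case: (htau (address q K n x)) => [->|[c ->]]; rewrite ?size_neighbour size_address.
have wB : address_cell q K w' `<=` B.
  move=> y wy; have [Ky _] := wy.
  have cx := address_in_cell hK n Kx.
  apply: (cell_sub_ball hq hK _ cx); first by rewrite size_address.
  have := address_cell_sub_cell hK wy; rewrite /w'.
  by case: (htau (address q K n x)) => [->|[c ->]]; [left|right; exists c].
have inner : ((3 ^- n * `|f x - cell_avg f w'| `^ p / r `^ (p * alpha))%:E <=
   \int[mu]_(y in B) (`|f y - f x| `^ p / r `^ (p * alpha))%:E)%E.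
  apply: (@le_trans _ _ (\int[mu]_(y in address_cell q K w') (`|f y - f x| `^ p / r `^ (p * alpha))%:E)%E).
    under eq_integral do rewrite mulrC EFinM.
    rewrite ge0_integralZl_EFin//; last 3 first.
    - exact: maddress_cell.
    - by apply/measurable_funTS/measurable_powR_abs/measurable_funB.
    - by rewrite invr_ge0 ltW.
    rewrite mulrC EFinM lee_wpmul2l ?lee_fin ?invr_ge0 ?(ltW ra)//.
    by rewrite distrC -sw'; apply: cell_avg_jensen.
  apply: ge0_subset_integral => //.
  - exact: maddress_cell.
  - apply: measurable_funTS; under eq_fun do rewrite EFinM.
    apply: emeasurable_funM => //.
    by apply/measurable_powR_abs/measurable_funB.
  - by move=> y _; rewrite lee_fin mulr_ge0 ?powR_ge0 ?invr_ge0 ?(ltW ra).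
have muB : ((3 ^+ n / ball_ratio)%:E <= (mu B)^-1)%E.
  rewrite inve_pge ?inE//; last by rewrite lee_fin divr_ge0 ?exprn_ge0.
  apply: (le_trans (mu_ball_le n5 rn2 Kx)); rewrite inver gt_eqF; last first.
    by rewrite divr_gt0 ?exprn_gt0.
  by rewrite lee_fin invf_div.
have muB0 : (0 <= (3 ^+ n / ball_ratio)%:E)%E by rewrite lee_fin divr_ge0 ?exprn_ge0.
have inner0 : (0 <= (3 ^- n * `|f x - cell_avg f w'| `^ p / r `^ (p * alpha))%:E)%E.
  by rewrite lee_fin !mulr_ge0 ?powR_ge0 ?invr_ge0 ?exprn_ge0 ?(ltW ra).
apply: le_trans (lee_pmul muB0 inner0 muB inner).
rewrite -!EFinM lee_fin; apply: eq_ler; rewrite /C invfM.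
set u := _ `^ p; set v := r `^ _; field.
by rewrite /v !gt_eqF// exprn_gt0.
Qed.

(** A ball of small radius only sees the cell of its centre and the neighbours, where
the variation of f is at most M.  At level 0 there is only one cell, so any radius
is allowed. *)
Lemma energy_upper n r p alpha f (M : word -> R) : 0 < r -> 0 <= p ->
  (n = 0%N \/ r <= 2^-1 ^+ n.+1) ->
  (forall x y, K x -> K y ->
     (address q K n y = address q K n x \/
      exists c, address q K n y = (neighbour (address q K n x) c).1) ->
     `|f y - f x| <= M (address q K n x)) ->
  (ks_energy K mu p alpha f r <=
    ((r `^ (p * alpha))^-1 * 3 ^- n * \sum_(w <- words n) M w `^ p)%:E)%E.
Proof.
move=> r0 p0 rn hM; have ra : 0 < r `^ (p * alpha) by exact: powR_gt0.
pose H x := (M (address q K n x) `^ p / r `^ (p * alpha))%:E.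
apply: (@le_trans _ _ (\int[mu]_(x in K) H x)%E).
  apply: ge0_le_integral_nonmeasurable => x Kx.
    rewrite mule_ge0 ?inve_ge0//; apply: integral_ge0 => y _.
    by rewrite lee_fin mulr_ge0 ?powR_ge0 ?invr_ge0 ?(ltW ra).
  set B := geodesic_ball K x r.
  have mB : measurable B by exact: (geodesic_ball_measurable hq hK).
  have HB : (\int[mu]_(y in B) (`|f y - f x| `^ p / r `^ (p * alpha))%:E <=
      H x * mu B)%E.
    rewrite -(integral_cst mu mB); apply: ge0_le_integral_nonmeasurable => y By.
      by rewrite lee_fin mulr_ge0 ?powR_ge0 ?invr_ge0 ?(ltW ra).
    have [Ky _] := By.
    have hxy : `|f y - f x| <= M (address q K n x).
      apply: hM => //; case: rn => [n0|rn].
        by left; move: (size_address q K n x) (size_address q K n y); rewrite n0 => /size0nil -> /size0nil ->.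
      exact: (ball_sub_cells hq hK rn (size_address _ _ _ _) (size_address _ _ _ _)
        (address_in_cell hK n Kx) (address_in_cell hK n Ky) By).
    rewrite lee_fin ler_pM2r ?invr_gt0// ge0_ler_powR ?nnegrE//.
    exact: le_trans hxy.
  have H0 : (0 <= H x)%E by rewrite lee_fin mulr_ge0 ?powR_ge0 ?invr_ge0 ?(ltW ra).
  have [B0|B0] := eqVneq (mu B) 0%E.
    rewrite B0 mule0 in HB.
    have -> : (\int[mu]_(y in B) (`|f y - f x| `^ p / r `^ (p * alpha))%:E = 0)%E.
      apply/le_anti; rewrite HB /=; apply: integral_ge0 => y _.
      by rewrite lee_fin mulr_ge0 ?powR_ge0 ?invr_ge0 ?(ltW ra).
    by rewrite mule0.
  apply: (@le_trans _ _ ((mu B)^-1 * (H x * mu B))%E).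
    by apply: lee_wpmul2l => //; rewrite inve_ge0.
  by rewrite muleCA mulVe ?mule1//; exact: (mu_fin hK hmu).
rewrite (integral_gasket_address_cell hK mu n); last 2 first.
- apply: measurable_funTS; apply/measurable_EFinP.
  exact: (measurable_address_fun hK n (fun w => M w `^ p / r `^ (p * alpha))).
- by move=> x _; rewrite lee_fin mulr_ge0 ?powR_ge0 ?invr_ge0 ?(ltW ra).
rewrite mulr_sumr -sumEFin !big_seq; apply: lee_sum => w.
rewrite mem_words => /eqP sw.
rewrite (eq_integral (cst (M w `^ p / r `^ (p * alpha))%:E)); last first.
  by move=> x; rewrite inE => -[_ /= E]; rewrite /H -sw E.
rewrite integral_cst; last exact: maddress_cell.
rewrite (mu_address_cell hK hmu) sw -EFinM lee_fin; apply: eq_ler; ring.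
Qed.

End EnergyBounds.

(** * Coarse fluctuations from fine ones; the critical set is bounded *)

Lemma powR_add_le (R : realType) (p a b : R) : 0 <= p -> 0 <= a -> 0 <= b ->
  (a + b) `^ p <= 2 `^ p * (a `^ p + b `^ p).
Proof.
move=> p0 a0 b0.
wlog ab : a b a0 b0 / a <= b.
  move=> h; have [/h|/ltW/h] := leP a b; first exact.
  by rewrite addrC [b `^ p + _]addrC; exact.
apply: (@le_trans _ _ ((2 * b) `^ p)).
  by rewrite ge0_ler_powR ?nnegrE ?addr_ge0 ?mulr_ge0//; lra.
by rewrite powRM// ler_wpM2l ?powR_ge0// lerDr powR_ge0.
Qed.

Section Fluctuation.
Context {R : realType} (q : 'I_3 -> R * R) (K : set (R * R)).
Context (hq : unit_equilateral q) (hK : is_gasket q K).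
Context (mu : {measure set (R * R)%type -> \bar R}) (hmu : is_gasket_measure q K mu).
Implicit Types (x y z : (R * R)%type) (w v : word) (f : R * R -> R).

Local Notation mK := (measurable_gasket hK).
Local Notation maddress_cell := (measurable_address_cell hK).
Local Notation cell_avg := (cell_avg q K mu).

Definition deviation p f w (c : R) : \bar R :=
  (\int[mu]_(x in address_cell q K w) (`|f x - c| `^ p)%:E)%E.

Definition fluctuation p f n (tau : word -> word) : \bar R :=
  (\int[mu]_(x in K) (`|f x - cell_avg f (tau (address q K n x))| `^ p)%:E)%E.

Context (p : R) (p1 : 1 <= p) (f : R * R -> R) (fL : f \in Lfun mu p%:E).

Let p0 : 0 < p. Proof. exact: lt_le_trans p1. Qed.
Let fi := Lfun_integrable1 hK hmu p1 fL.
Let mf : measurable_fun setT f := Lfun_measurable fL.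

Lemma measurable_deviation (A : set (R * R)) c : measurable A ->
  measurable_fun A (fun x => (`|f x - c| `^ p)%:E).
Proof. by move=> mA; apply: measurable_powR_abs; apply: measurable_funTS; apply: measurable_funB. Qed.

Lemma deviation_ge0 w c : (0 <= deviation p f w c)%E.
Proof. by apply: integral_ge0 => x _; rewrite lee_fin powR_ge0. Qed.

Lemma deviation_shift w c c' : (deviation p f w c <=
  (2 `^ p)%:E * (deviation p f w c' + (3 ^- size w * `|c' - c| `^ p)%:E))%E.
Proof.
have mA := maddress_cell w.
have -> : ((3 ^- size w * `|c' - c| `^ p)%:E =
    \int[mu]_(x in address_cell q K w) cst (`|c' - c| `^ p)%:E x)%E.
  by rewrite integral_cst// (mu_address_cell hK hmu) -EFinM mulrC.
rewrite -ge0_integralD; [|exact: mA|by move=> x _; rewrite lee_fin powR_ge0|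
  exact: measurable_deviation|by move=> x _; rewrite lee_fin powR_ge0|
  exact: measurable_cst].
rewrite -ge0_integralZl_EFin; [|exact: mA|
  by move=> x _; rewrite adde_ge0 ?lee_fin ?powR_ge0|
  by apply: emeasurable_funD => //; exact: measurable_deviation|exact: powR_ge0].
apply: ge0_le_integral_nonmeasurable => x _; first by rewrite lee_fin powR_ge0.
rewrite /= -EFinD -EFinM lee_fin; apply: le_trans (powR_add_le (ltW p0) _ _) => //.
by rewrite ge0_ler_powR ?nnegrE ?addr_ge0 ?(ltW p0)// ler_distD.
Qed.

(** Up to a constant the average is the best approximation by constants. *)
Lemma deviation_avg w c : (deviation p f w (cell_avg f w) <=
  (2 * 2 `^ p)%:E * deviation p f w c)%E.
Proof.
apply: (le_trans (deviation_shift w _ c)).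
rewrite [2 * _]mulrC [in leRHS]EFinM -muleA lee_wpmul2l ?lee_fin ?powR_ge0//.
rewrite mule_natl mule2n leeD2l// distrC.
exact: (cell_avg_jensen hK hmu).
Qed.

Lemma deviation_cat v m c :
  (deviation p f v c = \sum_(w <- words m) deviation p f (v ++ w) c)%E.
Proof.
apply: (integral_address_cell_address_cell hK mu) => [|x _]; last by rewrite lee_fin powR_ge0.
by apply: measurable_deviation; exact: maddress_cell.
Qed.

Lemma fluctuationE n tau :
  (fluctuation p f n tau = \sum_(w <- words n) deviation p f w (cell_avg f (tau w)))%E.
Proof.
rewrite /fluctuation (integral_gasket_address_cell hK mu n); last 2 first.
- apply: measurable_powR_abs; apply: measurable_funTS; apply: measurable_funB => //.
  exact: (measurable_address_fun hK n (fun w => cell_avg f (tau w))).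
- by move=> x _; rewrite lee_fin powR_ge0.
apply: eq_big_words => w sw; apply: eq_integral => x; rewrite inE => -[_ /=].
by rewrite sw => ->.
Qed.

(** Averaging |f x - avg(neighbour)|^p over x in the cell w gives, by Jensen, at
least |avg w - avg(neighbour)|^p. *)
Lemma energy_cell_avg_le n (Q : R) :
  (forall c, (fluctuation p f n (fun w => (neighbour w c).1) <= Q%:E)%E) ->
  3 ^- n * energy p n (cell_avg f) <= 3 * Q.
Proof.
move=> hQ; rewrite /energy exchange_big mulr_sumr.
apply: (@le_trans _ _ (\sum_(c : 'I_3) Q)); last first.
  by rewrite sumr_const card_ord mulr_natl.
apply: ler_sum => c _; rewrite -lee_fin; apply: le_trans (hQ c).
rewrite fluctuationE mulr_sumr -sumEFin; apply: lee_sum_words => w sw. by rewrite -sw; exact: (cell_avg_jensen hK hmu).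
Qed.

(** On a cell v of level n, compare f with the average over one fixed subcell
v ++ nseq m o0.  This involves the fluctuation of f in each subcell and the
differences of averages of subcells, which the oscillation bound on the graph of
level m controls by the energy inside v; these energies add up to at most the
energy of level n + m ([energy_cat]). *)
Lemma coarse_fluctuation n m (Q S : R) : 0 <= S ->
  (forall u w w', size w = m -> size w' = m ->
     `|u w - u w'| `^ p <= S * energy p m u) ->
  (fluctuation p f (n + m) id <= Q%:E)%E ->
  (forall c, (fluctuation p f (n + m) (fun w => (neighbour w c).1) <= Q%:E)%E) ->
  (fluctuation p f n id <=
    (2 * 2 `^ p * 2 `^ p * (1 + 3 * 3 ^+ m * S) * Q)%:E)%E.
Proof.
move=> S0 hS hQ hQc; have hE := energy_cell_avg_le hQc.
pose c v := cell_avg f (v ++ nseq m o0).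
have h1 v : (deviation p f v (cell_avg f v) <= (2 * 2 `^ p * 2 `^ p)%:E *
   \sum_(w <- words m) (deviation p f (v ++ w) (cell_avg f (v ++ w)) +
     (3 ^- (size v + m) * `|cell_avg f (v ++ w) - c v| `^ p)%:E))%E.
  apply: (le_trans (deviation_avg v (c v))).
  rewrite [in leRHS]EFinM -muleA lee_wpmul2l ?lee_fin ?mulr_ge0 ?powR_ge0//.
  rewrite (deviation_cat v m) ge0_sume_distrr; last first.
    by move=> w _; rewrite adde_ge0 ?deviation_ge0// lee_fin mulr_ge0 ?powR_ge0 ?invr_ge0 ?exprn_ge0.
  apply: lee_sum_words => w sw.
  by rewrite -sw -size_cat; exact: deviation_shift.
rewrite fluctuationE.
apply: (@le_trans _ _ (\sum_(v <- words n) (2 * 2 `^ p * 2 `^ p)%:E *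
   \sum_(w <- words m) (deviation p f (v ++ w) (cell_avg f (v ++ w)) +
     (3 ^- (n + m) * `|cell_avg f (v ++ w) - c v| `^ p)%:E))%E).
  apply: lee_sum_words => v sv.
  by rewrite -sv; exact: h1.
rewrite -ge0_sume_distrr; last first.
  move=> v _; apply: sume_ge0 => w _.
  by rewrite adde_ge0 ?deviation_ge0// lee_fin mulr_ge0 ?powR_ge0 ?invr_ge0 ?exprn_ge0.
rewrite -[X in (_ <= X%:E)%E]mulrA [in leRHS]EFinM lee_wpmul2l ?lee_fin ?mulr_ge0 ?powR_ge0//.
under eq_bigr do rewrite big_split /=.
rewrite big_split /= -(big_words_cat n m (fun w => deviation p f w (cell_avg f w))).
rewrite mulrDl mul1r EFinD; apply: leeD.
  by rewrite fluctuationE in hQ.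
under eq_bigr do rewrite sumEFin.
rewrite sumEFin lee_fin.
apply: (@le_trans _ _ (\sum_(v <- words n) 3 ^- (n + m) * (3 ^+ m * (S * energy p m (fun w => cell_avg f (v ++ w)))))).
  apply: ler_sum => v _; rewrite -mulr_sumr ler_wpM2l ?invr_ge0 ?exprn_ge0//.
  apply: (@le_trans _ _ (\sum_(w <- words m) S * energy p m (fun w => cell_avg f (v ++ w)))).
    apply: ler_sum_words => w sw.
    by apply: (hS (fun w => cell_avg f (v ++ w))); rewrite ?size_nseq.
  by rewrite big_const_seq count_predT size_words iter_addr_0 -[_ *+ (_ ^ _)]mulr_natl natrX.
rewrite -!mulr_sumr.
have h2 := energy_cat n m (cell_avg f) (lt0r_neq0 p0).
apply: (@le_trans _ _ (3 ^+ m * S * (3 ^- (n + m) * energy p (n + m) (cell_avg f)))).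
  rewrite [leRHS](_ : _ = 3 ^- (n + m) * (3 ^+ m * (S * energy p (n + m) (cell_avg f)))); last by ring.
  by rewrite !ler_wpM2l ?invr_ge0 ?exprn_ge0.
rewrite [leRHS](_ : _ = 3 ^+ m * S * (3 * Q)); last by ring.
by rewrite ler_wpM2l// mulr_ge0// exprn_ge0.
Qed.

Lemma coarse_from_energy n m r alpha (S Q : R) : 0 <= S ->
  (forall u w w', size w = m -> size w' = m ->
     `|u w - u w'| `^ p <= S * energy p m u) ->
  (5 <= n + m)%N -> 8 * 2^-1 ^+ (n + m) < r -> r <= 16 * 2^-1 ^+ (n + m) ->
  (ks_energy K mu p alpha f r <= Q%:E)%E ->
  (fluctuation p f n id <=
    (2 * 2 `^ p * 2 `^ p * (1 + 3 * 3 ^+ m * S) * (ball_ratio * r `^ (p * alpha) * Q))%:E)%E.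
Proof.
move=> S0 hS n5 r1 r2 hE.
have low tau : (forall w, tau w = w \/ exists c, tau w = (neighbour w c).1) ->
    (fluctuation p f (n + m) tau <= (ball_ratio * r `^ (p * alpha) * Q)%:E)%E.
  move=> ht; apply: (le_trans (energy_lower hq hK hmu alpha n5 p1 r1 r2 fL ht)).
  by rewrite [leRHS]EFinM lee_wpmul2l// lee_fin mulr_ge0 ?powR_ge0 ?(ltW ball_ratio_gt0).
apply: (coarse_fluctuation S0 hS); first by apply: low => w; left.
by move=> c; apply: low => w; right; exists c.
Qed.

Lemma fluctuation0_const : fluctuation p f 0 id = 0%E -> ae_constant mu f.
Proof.
move=> h; exists (cell_avg f [::]).
have mD : measurable_fun K (fun x => (`|f x - cell_avg f [::]| `^ p)%:E).
  exact: (measurable_deviation _ mK).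
have : (\int[mu]_(x in K) `|(`|f x - cell_avg f [::]| `^ p)%:E| = 0)%E.
  by rewrite -[RHS]h; apply: eq_integral => x _; rewrite gee0_abs// lee_fin powR_ge0.
move=> /(ae_eq_integral_abs mu mK mD) [N [mN N0 hN]].
exists (N `|` ~` K); split.
- by apply: measurableU => //; apply: measurableC; exact: mK.
- apply/eqP; rewrite -measure_le0; apply: (le_trans (measureU2 _ mN (measurableC mK))).
  have e2 (a b : \bar R) : a = b -> (a <= b)%E by move=> ->.
  by rewrite -[leRHS]adde0; apply: leeD; apply: e2; [exact: N0|exact: hmu.1].
- move=> x /= fx; have [Kx|] := pselect (K x); last by right.
  left; apply: hN => /= /(_ Kx) [] /eqP; rewrite powR_eq0 normr_eq0 subr_eq0.
  by move=> /andP[/eqP/fx].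
Qed.

End Fluctuation.

Section CriticalSetBounded.
Context {R : realType} (q : 'I_3 -> R * R) (K : set (R * R)).
Context (hq : unit_equilateral q) (hK : is_gasket q K).
Context (mu : {measure set (R * R)%type -> \bar R}) (hmu : is_gasket_measure q K mu).

Definition critical_set (p : R) : set R :=
  [set alpha : R | 0 <= alpha /\ exists f, besov K mu alpha p f /\ ~ ae_constant mu f].

Lemma powR_half_expn (a : R) n : (2^-1 ^+ n) `^ a = (2 `^ a)^-1 ^+ n.
Proof.
rewrite -powR_mulrn ?invr_ge0// -powRrM mulrC powRrM -powR_mulrn ?invr_ge0 ?powR_ge0//.
by congr (_ `^ _); rewrite -[2^-1]powR_inv1// -powRrM mulN1r powRN.
Qed.

(** Summing the crude oscillation bound [osc_energy] over the cells of level m loses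
a factor of order (3 * 3^p)^m, whereas the factor r^(p alpha) in the energy bound
gains 2^(- p alpha m).  Once 2^(p alpha) >= 4 * 3^p, which holds beyond the stated
bound as 4 >= 3, the product decays like (3/4)^m and f is constant. *)
Lemma critical_set_le p alpha : 1 <= p -> critical_set p alpha ->
  alpha <= (2 + 2 * p) / p.
Proof.
move=> p1 [a0 [f [[fL fB] fnc]]]; have p0 : 0 < p by exact: lt_le_trans p1.
rewrite leNgt; apply/negP => ap; apply: fnc.
set E := ereal_sup _ in fB.
have E0 : (0 <= E)%E.
  apply: (le_trans (ks_energy_ge0 K mu p alpha f 1)).
  by apply: ereal_sup_ubound; exists 1 => //=.
have Efin : E \is a fin_num by rewrite ge0_fin_numE.
pose Q := fine E; have Q0 : 0 <= Q by exact: fine_ge0.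
have hQ r : 0 < r -> (ks_energy K mu p alpha f r <= Q%:E)%E.
  by move=> r0; rewrite fineK//; apply: ereal_sup_ubound; exists r.
have pa : 4 * 3 `^ p <= 2 `^ (p * alpha).
  have e4 : 2 `^ 2 = 4 :> R by rewrite powR_mulrn//; ring.
  rewrite -e4.
  apply: (@le_trans _ _ (2 `^ (2 + 2 * p))).
    rewrite [2 `^ (2 + _)]powRD ?pnatr_eq0 ?implybT// ler_wpM2l ?powR_ge0//.
    rewrite [2 `^ (2 * p)]powRrM ge0_ler_powR ?nnegrE ?powR_ge0 ?(ltW p0)//.
    by rewrite e4 ler_nat.
  by apply: ler_powR; rewrite ?ler1n// [p * alpha]mulrC -ler_pdivrMr//; exact: ltW.
pose D := 2 * 2 `^ p * 2 `^ p * (4 * 3 `^ p) * (ball_ratio * 16 `^ (p * alpha) * Q).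
have ball_ratio_ge0 : 0 <= ball_ratio :> R by apply: ltW; exact: ball_ratio_gt0.
have D0 : 0 <= D by rewrite /D !mulr_ge0 ?powR_ge0.
have key m : (5 <= m)%N -> (fluctuation q K mu p f 0 id <= (D * (3 / 4) ^+ m)%:E)%E.
  move=> m5; have r0 : 0 < 16 * 2^-1 ^+ m :> R by rewrite mulr_gt0 ?exprn_gt0.
  have hS (u : word -> R) w w' : size w = m -> size w' = m ->
      `|u w - u w'| `^ p <= (3 ^+ m.+1) `^ p * energy p m u.
    move=> sw sw'; rewrite -[X in _ * X](@powR_root _ _ p) ?energy_ge0 ?gt_eqF//.
    rewrite -powRM ?exprn_ge0 ?powR_ge0// ge0_ler_powR ?nnegrE ?(ltW p0)//.
      by rewrite mulr_ge0 ?exprn_ge0 ?powR_ge0.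
    exact: osc_energy.
  have := @coarse_from_energy _ q K hq hK mu hmu p p1 f fL 0 m (16 * 2^-1 ^+ m) alpha _ Q
     (powR_ge0 _ _) hS m5 _ (lexx _) (hQ _ r0).
  have r8 : 8 * 2^-1 ^+ (0 + m) < 16 * 2^-1 ^+ m :> R.
    by rewrite add0n ltr_pM2r ?exprn_gt0//; lra.
  move=> /(_ r8) /le_trans; apply; rewrite lee_fin /D.
  rewrite powRM ?exprn_ge0// powR_half_expn.
  have -> : (3 ^+ m.+1) `^ p = 3 `^ p * (3 `^ p) ^+ m.
    by rewrite -powR_mulrn// -powRrM mulrC powRrM powR_mulrn ?powR_ge0// exprS.
  have h3p : 1 <= 3 `^ p by rewrite -[leLHS](powRr0 3) ler_powR ?ler1n// ltW.
  have hm : 1 + 3 * 3 ^+ m * (3 `^ p * (3 `^ p) ^+ m) <= 4 * 3 `^ p * (3 * 3 `^ p) ^+ m.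
    rewrite exprMn; set X := (3 : R) ^+ m; set Y := (3 `^ p) ^+ m; set Z := 3 `^ p.
    have X1 : 1 <= X by rewrite exprn_ege1//; lra.
    have Y1 : 1 <= Y by rewrite exprn_ege1.
    have XY : 1 <= X * Y by rewrite mulr_ege1.
    have ZXY : 1 <= Z * (X * Y) by rewrite mulr_ege1.
    by rewrite (_ : 4 * Z * (X * Y) = Z * (X * Y) + 3 * X * (Z * Y)) ?lerD2r//; ring.
  have h34 : (3 * 3 `^ p) ^+ m * (2 `^ (p * alpha))^-1 ^+ m <= (3 / 4) ^+ m.
    rewrite -exprMn lerXn2r ?nnegrE ?divr_ge0 ?mulr_ge0 ?powR_ge0//.
    by rewrite ler_pdivrMr ?powR_gt0//; lra.
  set A := 2 * 2 `^ p * 2 `^ p; set c := 16 `^ (p * alpha).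
  have A0 : 0 <= A by rewrite !mulr_ge0 ?powR_ge0.
  have c0 : 0 <= ball_ratio * c * Q by rewrite !mulr_ge0 ?powR_ge0.
  set W := (2 `^ (p * alpha))^-1 ^+ m in h34 *.
  have W0 : 0 <= W by rewrite exprn_ge0// invr_ge0 powR_ge0.
  apply: (@le_trans _ _ (A * (4 * 3 `^ p * (3 * 3 `^ p) ^+ m) * (ball_ratio * (c * W) * Q))).
    by rewrite ler_wpM2r ?ler_wpM2l// !mulr_ge0 ?powR_ge0.
  rewrite (_ : _ * _ = A * (4 * 3 `^ p) * (ball_ratio * c * Q) * ((3 * 3 `^ p) ^+ m * W)); last by ring.
  by rewrite ler_wpM2l// !mulr_ge0 ?powR_ge0.
apply: (fluctuation0_const hK hmu fL).
apply/le_anti/andP; split; last first.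
  by apply: integral_ge0 => x _; rewrite lee_fin powR_ge0.
apply/lee_addgt0Pr => e e0; rewrite add0e.
have [m hm] : exists m, D * (3 / 4) ^+ m < e.
  have : (fun m => D * (3 / 4) ^+ m) @ \oo --> D * 0.
    by apply: cvgMr; apply: cvg_expr; rewrite ger0_norm; lra.
  rewrite mulr0 => /cvgrPdist_lt/(_ e e0)[N _ hN]; exists N.
  have := hN N (leqnn N); rewrite /= sub0r normrN; apply: le_lt_trans.
  exact: ler_norm.
apply: (le_trans (key (m + 5)%N (leq_addl _ _))); rewrite lee_fin.
apply: le_trans (ltW hm); rewrite ler_wpM2l// exprD ler_piMr ?exprn_ge0 ?divr_ge0//.
by rewrite exprn_ile1 ?divr_ge0//; lra.
Qed.

Lemma critical_set_ub p alpha : 1 <= p -> critical_set p alpha ->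
  alpha <= critical_exponent K mu p.
Proof.
move=> p1 h; apply: ub_le_sup => //; exists ((2 + 2 * p) / p) => b.
exact: critical_set_le.
Qed.

End CriticalSetBounded.

(** * Functions of finite energy at the critical exponent *)

Lemma geometric_scale (R : realType) (b s : R) : 0 < b < 1 -> 0 < s <= 1 ->
  exists k, b ^+ k.+1 < s <= b ^+ k.
Proof.
move=> /andP[b0 b1] /andP[s0 s1].
have ex : exists k, b ^+ k.+1 < s.
  have : (fun k => b ^+ k) @ \oo --> (0 : R) by apply: cvg_expr; rewrite gtr0_norm.
  move=> /cvgrPdist_lt/(_ s s0)[N _ hN]; exists N.
  by have := hN N.+1 (leqnSn N); rewrite /= sub0r normrN gtr0_norm ?exprn_gt0.
case: (ex_minnP ex) => k hk kmin; exists k; rewrite hk /= leNgt.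
case: k hk kmin => [|k] hk kmin; first by rewrite expr0 -leNgt.
by apply/negP => /kmin; rewrite ltnn.
Qed.

(** The map [neighbour] is an involution of the pairs (cell, corner). *)
Lemma sum_neighbour (R : realType) n (F : word -> R) :
  \sum_(w <- words n) \sum_(c : 'I_3) F (neighbour w c).1 =
  \sum_(w <- words n) \sum_(c : 'I_3) F w.
Proof.
pose P := [seq (w, c) | w <- words n, c <- enum 'I_3].
have sumP (G : word * 'I_3 -> R) :
    \sum_(w <- words n) \sum_(c : 'I_3) G (w, c) = \sum_(i <- P) G i.
  by rewrite big_allpairs_dep; apply: eq_bigr => w _; rewrite big_enum.
rewrite (sumP (fun i => F (neighbour i.1 i.2).1)) (sumP (fun i => F i.1)).
have uP : uniq P.
  apply: allpairs_uniq; [exact: uniq_words|exact: enum_uniq|].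
  by move=> [w c] [w' c'] _ _ /= [-> ->].
have memP i : (i \in P) = (size i.1 == n).
  apply/allpairsP/idP => [[j [/= hj _ ->]]|si]; first by rewrite -mem_words.
  by exists i; rewrite mem_words si mem_enum; split => //; case: i {si}.
have inj : injective (fun i : word * 'I_3 => neighbour i.1 i.2).
  move=> [w c] [w' c'] /= E.
  by have := neighbourK w c; rewrite E neighbourK => -[-> ->].
have pP : perm_eq (map (fun i : word * 'I_3 => neighbour i.1 i.2) P) P.
  apply: uniq_perm => //; first by rewrite map_inj_uniq.
  move=> [w c]; rewrite memP /=; apply/mapP/idP => [[[v d]]|sw].
    by rewrite memP /= => /eqP sv /(congr1 fst) /= ->; rewrite size_neighbour sv.
  by exists (neighbour w c); rewrite ?memP ?size_neighbour ?neighbourK.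
by rewrite -[RHS](perm_big _ pP) /= big_map.
Qed.

Section BoundedLfun.
Context {R : realType} (mu : {measure set (R * R)%type -> \bar R}).
Context (mu1 : mu setT = 1%E).

Lemma bounded_Lfun p (f : R * R -> R) : 0 < p -> measurable_fun setT f ->
  (forall x, `|f x| <= 1) -> f \in Lfun mu p%:E.
Proof.
move=> p0 mf f1; rewrite inE; apply/andP; split; rewrite inE//=.
rewrite /finite_norm unlock poweR_lty//.
apply: (@le_lt_trans _ _ (\int[mu]_x cst 1%E x)%E).
  apply: ge0_le_integral_nonmeasurable => x _; first exact: poweR_ge0.
  rewrite /= lee_fin; apply: (@le_trans _ _ (1 `^ p)); last by rewrite powR1.
  by rewrite ge0_ler_powR ?nnegrE ?(ltW p0).
by rewrite integral_cst// mu1 mule1 ltry.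
Qed.

End BoundedLfun.

Section FractalExtension.
Context {R : realType} (q : 'I_3 -> R * R) (K : set (R * R)).
Context (hq : unit_equilateral q) (hK : is_gasket q K).
Context (mu : {measure set (R * R)%type -> \bar R}) (hmu : is_gasket_measure q K mu).
Context (p : R) (m : nat) (h : 'I_3 -> word -> R) (d e : R).
Context (p1 : 1 <= p) (h1 : forall l, h l (nseq m l) = 1)
  (h0 : forall l l', l != l' -> h l (nseq m l') = 0)
  (hitv : forall l w, 0 <= h l w <= 1)
  (hd : forall l, energy p m (h l) <= d)
  (de : 3 * 3 `^ p * d <= e) (e0 : 0 < e) (e1 : e < 1).
Implicit Types (x y z : (R * R)%type) (w v : word).

Let p0 : 0 < p. Proof. exact: lt_le_trans p1. Qed.

Definition indicator0 (l : 'I_3) : R := (l == o0)%:R.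

Definition word_corner k w := corner_values h m k w indicator0.
Definition addr_corner k x := word_corner k (address q K (k * m) x).
(** The hulls of the corner values of the cells containing x form a decreasing
sequence of intervals; the supremum of their lower ends is a point of all of
them. *)
Definition frac_ext x : R := sup (range (fun k => cmin (addr_corner k x))).

Lemma addr_corner_add k j x c :
  cmin (addr_corner k x) <= addr_corner (k + j) x c <= cmax (addr_corner k x).
Proof.
rewrite /addr_corner /word_corner mulnDl address_add corner_values_cat ?size_address//.
by rewrite corner_values_ge//= (corner_values_le _ hitv).
Qed.

Lemma cmin_le_cmax k j x : cmin (addr_corner j x) <= cmax (addr_corner k x).
Proof.
have h2 i : cmin (addr_corner i x) <= cmax (addr_corner i x).
  exact: le_trans (cmin_le _ o0) (le_cmax _ o0).
case: (leqP j k) => [/subnKC <-|/ltnW/subnKC <-].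
  by have /andP[+ _] := addr_corner_add j (k - j) x o0; move/le_trans; apply; exact: le_cmax.
by have /andP[_] := addr_corner_add k (j - k) x o0; apply: le_trans; exact: cmin_le.
Qed.

Lemma frac_ext_itv k x : cmin (addr_corner k x) <= frac_ext x <= cmax (addr_corner k x).
Proof.
apply/andP; split.
  apply: ub_le_sup; last by exists k.
  by exists (cmax (addr_corner 0 x)) => _ [j _ <-]; exact: cmin_le_cmax.
apply: ge_sup; first by exists (cmin (addr_corner 0 x)), 0%N.
by move=> _ [j _ <-]; exact: cmin_le_cmax.
Qed.

Lemma measurable_frac_ext : measurable_fun setT frac_ext.
Proof.
apply: (@measurable_fun_cvg _ _ _ _ (fun k x => cmin (addr_corner k x))) => [k|x _].
  exact: (measurable_address_fun hK (k * m) (fun w => cmin (word_corner k w))).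
apply: nondecreasing_cvgn.
  move=> i j ij; apply: cmin_ge => c; rewrite -(subnKC ij).
  by have /andP[] := addr_corner_add i (j - i) x c.
by exists (cmax (addr_corner 0 x)) => _ [j _ <-]; exact: cmin_le_cmax.
Qed.

Lemma osc_indicator0 : osc indicator0 <= 1.
Proof.
have H1 : cmax indicator0 <= 1 by apply: cmax_le => l; rewrite /indicator0 lern1 leq_b1.
have H2 : 0 <= cmin indicator0 by apply: cmin_ge => l; rewrite /indicator0 ler0n.
by rewrite /osc; lra.
Qed.

Lemma word_corner_itv k w c : 0 <= word_corner k w c <= 1.
Proof.
have H1 : cmax indicator0 <= 1 by apply: cmax_le => l; rewrite /indicator0 lern1 leq_b1.
have H2 : 0 <= cmin indicator0 by apply: cmin_ge => l; rewrite /indicator0 ler0n.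
apply/andP; split; first by apply: (le_trans H2); apply: corner_values_ge.
by apply: le_trans H1; apply: corner_values_le.
Qed.

Lemma frac_ext_bounded x : `|frac_ext x| <= 1.
Proof.
have /andP[a b] := frac_ext_itv 0 x.
have c0 : 0 <= cmin (addr_corner 0 x).
  by apply: cmin_ge => c; have /andP[] := word_corner_itv 0 (address q K (0 * m) x) c.
have c1 : cmax (addr_corner 0 x) <= 1.
  by apply: cmax_le => c; have /andP[] := word_corner_itv 0 (address q K (0 * m) x) c.
by rewrite ger0_norm; lra.
Qed.

Lemma frac_ext_Lfun : frac_ext \in Lfun mu p%:E.
Proof.
apply: (bounded_Lfun (mu_setT hK hmu) p0); first exact: measurable_frac_ext.
exact: frac_ext_bounded.
Qed.

Definition word_osc k w : R := osc (word_corner k w).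

Lemma sum_word_osc k : \sum_(w <- words (k * m)) word_osc k w `^ p <= e ^+ k.
Proof.
apply: (le_trans (sum_osc_corner_values p0 hd k indicator0)).
have d0 : 0 <= d by apply: le_trans (hd o0); exact: energy_ge0.
rewrite -[leRHS]mulr1; apply: ler_pM; rewrite ?exprn_ge0 ?powR_ge0 ?mulr_ge0 ?powR_ge0//.
  by apply: lerXn2r; rewrite ?nnegrE ?mulr_ge0 ?powR_ge0 ?(ltW e0).
apply: (@le_trans _ _ (1 `^ p)); last by rewrite powR1.
by rewrite ge0_ler_powR ?nnegrE ?osc_ge0 ?osc_indicator0 ?(ltW p0).
Qed.

Lemma word_osc_le k w : size w = (k * m)%N -> word_osc k w `^ p <= e ^+ k.
Proof.
move=> sw; apply: le_trans (sum_word_osc k).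
rewrite (bigD1_seq w) ?uniq_words ?mem_words ?sw//= lerDl sumr_ge0 => // *.
exact: powR_ge0.
Qed.

(** A bound for the variation of [frac_ext] from a point of the cell w to a point of
w or of a neighbour: such cells share the corner value at their junction, so the
oscillations in both of them bound the difference. *)
Definition word_modulus k w : R :=
  word_osc k w + \sum_c word_osc k (neighbour w c).1.

Lemma frac_ext_modulus k x y :
  (address q K (k * m) y = address q K (k * m) x \/
   exists c, address q K (k * m) y = (neighbour (address q K (k * m) x) c).1) ->
  `|frac_ext y - frac_ext x| <= word_modulus k (address q K (k * m) x).
Proof.
have /andP[x1 x2] := frac_ext_itv k x; have /andP[y1 y2] := frac_ext_itv k y.
move: x1 x2 y1 y2; rewrite /addr_corner; set w := address q K (k * m) x.
set w' := address q K (k * m) y => x1 x2 y1 y2 E.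
have os0 v : 0 <= word_osc k v by exact: osc_ge0.
have sw : size w = (k * m)%N by rewrite size_address.
rewrite ler_norml /word_modulus.
case: E => [E|[c E]].
  have S0 : 0 <= \sum_c word_osc k (neighbour w c).1 by rewrite sumr_ge0.
  rewrite E in y1 y2; rewrite /word_osc /osc in S0 *.
  by apply/andP; split; lra.
have Sc : word_osc k w' <= \sum_c word_osc k (neighbour w c).1.
  by rewrite E (bigD1 c)//= lerDl sumr_ge0.
have sh := corner_values_neighbour h1 h0 indicator0 c sw.
rewrite -E -!/(word_corner k _) in sh.
have a1 := cmin_le (word_corner k w) c; have a2 := le_cmax (word_corner k w) c.
have b1 := cmin_le (word_corner k w') (neighbour w c).2.
have b2 := le_cmax (word_corner k w') (neighbour w c).2.
rewrite sh in b1 b2; move: Sc; set S := \sum__ _; rewrite /word_osc /osc => Sc.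
by apply/andP; split; lra.
Qed.

Lemma sum_word_modulus k : \sum_(w <- words (k * m)) word_modulus k w `^ p <=
  2 `^ p * (1 + 3 `^ p * 3) * e ^+ k.
Proof.
have os0 v : 0 <= word_osc k v by exact: osc_ge0.
apply: (@le_trans _ _ (\sum_(w <- words (k * m)) 2 `^ p * (word_osc k w `^ p +
   3 `^ p * \sum_c word_osc k (neighbour w c).1 `^ p))).
  apply: ler_sum => w _; apply: (le_trans (powR_add_le (ltW p0) _ _)); rewrite ?sumr_ge0//.
  by rewrite ler_wpM2l ?powR_ge0// lerD2l; apply: powR_sum3.
rewrite -mulr_sumr big_split /= -mulr_sumr (sum_neighbour _ (fun w => word_osc k w `^ p)).
rewrite -mulrA ler_wpM2l ?powR_ge0// mulrDl mul1r.
have E : \sum_(w <- words (k * m)) \sum_(c : 'I_3) word_osc k w `^ p =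
    3 * \sum_(w <- words (k * m)) word_osc k w `^ p.
  by rewrite mulr_sumr; apply: eq_bigr => w _; rewrite sumr_const card_ord mulr_natl.
rewrite E mulrA; have hs := sum_word_osc k.
by apply: lerD => //; rewrite ler_wpM2l ?mulr_ge0 ?powR_ge0.
Qed.

Lemma address_cell_not_null w (f : R * R -> R) c : {ae mu, forall x, f x = c} ->
  exists2 x, address_cell q K w x & f x = c.
Proof.
move=> hf; apply: contrapT => hn.
have neg : mu.-negligible (address_cell q K w).
  by apply: negligibleS hf => x wx /= fx; apply: hn; exists x.
have N0 := measure_negligible (measurable_address_cell hK w) neg.
have : (3 ^- size w)%:E = 0%E :> \bar R by rewrite -(mu_address_cell hK hmu w); exact: N0.
by move=> [] /eqP; rewrite gt_eqF// invr_gt0 exprn_gt0.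
Qed.

(** Take k so large that the oscillation in cells of level k * m is less than 1/2.
Near the vertices 0 and 1, with corner values 1 and 0, the function is then
greater, respectively less, than 1/2 on sets of positive measure. *)
Lemma frac_ext_nonconst : ~ ae_constant mu frac_ext.
Proof.
move=> [c hc].
have [k hk] : exists k, e ^+ k < (2^-1) `^ p.
  have : (fun k => e ^+ k) @ \oo --> (0 : R) by apply: cvg_expr; rewrite gtr0_norm.
  move=> /cvgrPdist_lt/(_ _ (@powR_gt0 R 2^-1 p _)).
  rewrite invr_gt0 ltr0n => /(_ isT)[N _ hN]; exists N.
  by have := hN N (leqnn N); rewrite /= sub0r normrN gtr0_norm ?exprn_gt0.
have small l : word_osc k (nseq (k * m) l) < 2^-1.
  rewrite ltNge; apply/negP => hle.
  have A : word_osc k (nseq (k * m) l) `^ p <= e ^+ k by apply: word_osc_le; rewrite size_nseq.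
  have B : 2^-1 `^ p <= word_osc k (nseq (k * m) l) `^ p.
    by rewrite ge0_ler_powR ?nnegrE ?osc_ge0 ?invr_ge0 ?(ltW p0).
  by have := le_lt_trans (le_trans B A) hk; rewrite ltxx.
have val l : exists2 t, t = c & cmin (word_corner k (nseq (k * m) l)) <= t <= cmax (word_corner k (nseq (k * m) l)).
  have [x [_ /= cx] fx] := address_cell_not_null (nseq (k * m) l) hc.
  exists (frac_ext x) => //; have := frac_ext_itv k x; rewrite /addr_corner.
  by move: cx; rewrite size_nseq => ->.
have cc l : word_corner k (nseq (k * m) l) l = indicator0 l by exact: (corner_values_corner h1 h0).
have [_ -> /andP[a1 a2]] := val o0; have [_ -> /andP[b1 b2]] := val o1.
have c0 := cc o0; have c1 := cc o1; rewrite /indicator0 /= in c0 c1.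
have s0 := small o0; have s1 := small o1; rewrite /word_osc /osc in s0 s1.
have m0 := le_cmax (word_corner k (nseq (k * m) o0)) o0; rewrite c0 in m0.
have m1 := cmin_le (word_corner k (nseq (k * m) o1)) o1; rewrite c1 in m1.
move: m0 m1; rewrite mulr0n mulr1n; lra.
Qed.

Context (m0 : (0 < m)%N).

(** The solution alpha of 2^(p alpha m) = 3^m / e, for which the energies at scales
2^(-km) neither grow nor decay in k. *)
Definition frac_exponent : R := ln (3 ^+ m / e) / (m%:R * p * ln 2).

Let ratio1 : 1 <= 3 ^+ m / e.
Proof.
rewrite ler_pdivlMr// mul1r; apply: (le_trans (ltW e1)).
by rewrite exprn_ege1// ler1n.
Qed.

Lemma frac_exponent_ge0 : 0 <= frac_exponent.
Proof.
by rewrite divr_ge0 ?ln_ge0 ?mulr_ge0 ?(ltW p0)// ln_ge0// ler1n.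
Qed.

Lemma frac_exponentE : (2 `^ (p * frac_exponent)) ^+ m = 3 ^+ m / e.
Proof.
have l2 : 0 < ln 2 :> R by rewrite ln_gt0// ltr1n.
have r0 : 0 < 3 ^+ m / e by apply: lt_le_trans ratio1.
rewrite -powR_mulrn ?powR_ge0// -powRrM /powR gt_eqF//.
rewrite (_ : _ * ln 2 = ln (3 ^+ m / e)); first by rewrite lnK// posrE.
rewrite /frac_exponent; field.
by rewrite (gt_eqF l2) (gt_eqF p0) pnatr_eq0 -lt0n m0.
Qed.

Lemma frac_ext_besov : besov K mu frac_exponent p frac_ext.
Proof.
split; first exact: frac_ext_Lfun.
set al := frac_exponent; set X := 2 `^ (p * al).
have X1 : 1 <= X.
  by rewrite -[leLHS](powRr0 2) ler_powR ?ler1n// mulr_ge0 ?(ltW p0)// frac_exponent_ge0.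
have X0 : 0 < X by apply: lt_le_trans X1.
pose B := 2 `^ p * (1 + 3 `^ p * 3).
have B0 : 0 <= B by rewrite mulr_ge0 ?powR_ge0// addr_ge0 ?mulr_ge0 ?powR_ge0.
apply: (@le_lt_trans _ _ (X ^+ m.+1 * B)%:E); last by rewrite ltry.
apply: ge_ereal_sup => _ [r /= r0 <-].
(* k is the number of steps used for the modulus, 2^-t a lower bound of r. *)
have bound k t : r `^ (p * al) >= (X ^+ t)^-1 -> X ^+ t <= X ^+ m.+1 * (X ^+ m) ^+ k ->
    (k * m = 0)%N \/ r <= 2^-1 ^+ (k * m).+1 ->
    (ks_energy K mu p al frac_ext r <= (X ^+ m.+1 * B)%:E)%E.
  move=> rX tk rk.
  have := energy_upper hq hK hmu al r0 (ltW p0) rk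
    (fun x y _ _ hxy => @frac_ext_modulus k x y hxy).
  move=> /le_trans; apply; rewrite lee_fin.
  have ra : 0 < r `^ (p * al) by exact: powR_gt0.
  have rV : (r `^ (p * al))^-1 <= X ^+ t by rewrite -[leRHS]invrK lef_pV2 ?posrE ?invr_gt0 ?exprn_gt0.
  have hs := sum_word_modulus k; rewrite -/B in hs.
  have XmE : X ^+ m = 3 ^+ m / e by exact: frac_exponentE.
  apply: (@le_trans _ _ ((X ^+ m.+1 * (X ^+ m) ^+ k) * 3 ^- (k * m) * (B * e ^+ k))).
    apply: ler_pM => //.
    - by rewrite mulr_ge0 ?invr_ge0 ?powR_ge0 ?exprn_ge0.
    - by rewrite sumr_ge0 => // *; exact: powR_ge0.
    - by rewrite ler_wpM2r ?invr_ge0 ?exprn_ge0// (le_trans rV).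
  apply: eq_ler; rewrite XmE mulnC exprM expr_div_n; field.
  by rewrite !expf_neq0// gt_eqF.
have rpow t : 2^-1 ^+ t <= r -> (X ^+ t)^-1 <= r `^ (p * al).
  move=> rt; rewrite -exprVn -powR_half_expn ge0_ler_powR ?nnegrE ?exprn_ge0 ?(ltW r0)//.
  by rewrite mulr_ge0 ?(ltW p0)// frac_exponent_ge0.
(* Radii above 1/2 are treated at level 0, where there is one cell. *)
have [r2|r2] := leP r 2^-1; last first.
  apply: (bound 0 1)%N; [|by rewrite expr0 mulr1 expr1 exprS ler_peMr ?exprn_ege1// ltW|by left].
  by apply: rpow; rewrite expr1 ltW.
have [|| k /andP[k1 k2]] := @geometric_scale R (2^-1 ^+ m) (2 * r).
- by rewrite exprn_gt0// exprn_ilt1// -?lt0n//; lra.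
- by rewrite mulr_gt0//=; lra.
apply: (bound k (k.+1 * m).+1); last by right; rewrite exprS mulnC exprM; lra.
  by apply: rpow; rewrite exprS mulnC exprM; lra.
by rewrite -exprM -exprD mulSn addSn mulnC.
Qed.

Lemma critical_exponent_lower :
  3 ^+ m / e <= (2 `^ (p * critical_exponent K mu p)) ^+ m.
Proof.
rewrite -frac_exponentE; apply: lerXn2r; rewrite ?nnegrE ?powR_ge0//.
rewrite ler_powR ?ler1n// ler_pM2l//.
apply: (critical_set_ub hq hK hmu p1); split; first exact: frac_exponent_ge0.
by exists frac_ext; split; [exact: frac_ext_besov|exact: frac_ext_nonconst].
Qed.

End FractalExtension.

(** * The critical exponent controls discrete resistances *)

Section Critical.
Context {R : realType} (q : 'I_3 -> R * R) (K : set (R * R)).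
Context (hq : unit_equilateral q) (hK : is_gasket q K).
Context (mu : {measure set (R * R)%type -> \bar R}) (hmu : is_gasket_measure q K mu).

(** The factor lambda by which p-resistances between corners grow with the level, as
predicted by the scaling of the energy at the critical exponent. *)
Definition resistance_rate (p : R) : R := 2 `^ (p * critical_exponent K mu p) / 3.

Lemma resistance_rateE p : 2 `^ (p * critical_exponent K mu p) = 3 * resistance_rate p.
Proof. by rewrite /resistance_rate [RHS]mulrC divfK ?pnatr_eq0. Qed.

(** A function of small energy with distinct corner values is a seed for the
self-similar construction, so its existence forces lambda to be large. *)
Lemma rate_lower p m u i k e : 1 <= p -> u (nseq m i) != u (nseq m k) ->
  3 * 3 `^ p * ((2 / `|u (nseq m i) - u (nseq m k)|) `^ p * energy p m u) <= e ->
  0 < e -> e < 1 -> 1 <= e * resistance_rate p ^+ m.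
Proof.
move=> p1 uik he e0 e1; have p0 : 0 < p by exact: lt_le_trans p1.
have m0 : (0 < m)%N by case: m uik {he} => //=; rewrite eqxx.
have [h [h1 h0 hitv hd]] := corner_functions p0 uik.
have := critical_exponent_lower hq hK hmu p1 h1 h0 hitv hd he e0 e1 m0.
rewrite resistance_rateE exprMn ler_pdivrMr// -{1}[3 ^+ m]mulr1 -mulrA.
by rewrite ler_pM2l ?exprn_gt0// mulrC.
Qed.

(** If the inequality failed, an e slightly below lambda^-m would be admissible in
[rate_lower] and violate its conclusion. *)
Lemma corner_bound p m u i k : 1 <= p -> 1 <= resistance_rate p ->
  `|u (nseq m i) - u (nseq m k)| `^ p <=
    3 * 3 `^ p * 2 `^ p * resistance_rate p ^+ m * energy p m u.
Proof.
move=> p1 l1; have p0 : 0 < p by exact: lt_le_trans p1.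
set lam := resistance_rate p in l1 *.
have lm1 : 1 <= lam ^+ m by exact: exprn_ege1.
have lm0 : 0 < lam ^+ m by apply: lt_le_trans lm1.
have E0 := energy_ge0 p m u.
have [uE|uik] := eqVneq (u (nseq m i)) (u (nseq m k)).
  rewrite uE subrr normr0 powR0 ?gt_eqF// !mulr_ge0 ?powR_ge0//.
  exact: ltW.
set D := `|u (nseq m i) - u (nseq m k)|.
have D0 : 0 < D by rewrite normr_gt0 subr_eq0.
pose d := 3 * 3 `^ p * ((2 / D) `^ p * energy p m u).
have dE : d * D `^ p = 3 * 3 `^ p * 2 `^ p * energy p m u.
  have e2 : (2 / D) `^ p * D `^ p = 2 `^ p.
    by rewrite -powRM ?divr_ge0 ?(ltW D0)// divfK ?gt_eqF.
  by rewrite /d -e2; ring.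
have d0 : 0 <= d by rewrite !mulr_ge0 ?powR_ge0.
have key : 1 <= d * lam ^+ m.
  rewrite leNgt; apply/negP => dl.
  have dl' : d < (lam ^+ m)^-1 by rewrite -[X in _ < X]mul1r ltr_pdivlMr.
  have lV1 : (lam ^+ m)^-1 <= 1 by rewrite invf_le1.
  (* A value strictly between, so that it is positive even if d = 0. *)
  pose e := (d + (lam ^+ m)^-1) / 2.
  have e0 : 0 < e by rewrite divr_gt0// ltr_wpDl// invr_gt0.
  have he : d <= e by rewrite /e; lra.
  have e1 : e < 1 by rewrite /e; lra.
  have := rate_lower p1 uik he e0 e1; rewrite -/lam leNgt => /negP; apply.
  by rewrite -ltr_pdivlMr// mul1r /e; lra.
rewrite -[leLHS]mul1r (le_trans (ler_wpM2r (powR_ge0 D p) key))//.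
by rewrite mulrAC dE; apply: eq_ler; ring.
Qed.

(** This function grows linearly along the chain of cells towards the vertex 0, with
boundedly many edges where it jumps at each level: its energy of level m is
O(m), whereas its values at two corners differ by m. *)
Fixpoint leading_run (w : word) : nat :=
  if w is a :: t then if a == o0 then (leading_run t).+1 else 0 else 0.

Lemma leading_run_corner m : leading_run (nseq m o0) = m.
Proof. by elim: m => //= m ->. Qed.

Lemma leading_run_corner0 m c : c != o0 -> leading_run (nseq m c) = 0%N.
Proof. by case: m => //= m /negbTE ->. Qed.

Lemma energy_cst p m (u : word -> R) : p != 0 -> (forall w w', u w = u w') ->
  energy p m u = 0.
Proof.
move=> p0 h; rewrite /energy big1 // => w _; rewrite big1 // => c _.
by rewrite (h _ w) subrr normr0 powR0.
Qed.

Lemma sum9_le (F : 'I_3 -> 'I_3 -> R) : (forall a c, F a c <= 1) ->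
  \sum_a \sum_c F a c <= 9.
Proof.
move=> h; apply: (@le_trans _ _ (\sum_(a : 'I_3) \sum_(c : 'I_3) 1)).
  by apply: ler_sum => a _; apply: ler_sum.
rewrite !big_I3; lra.
Qed.

Lemma energy_leading_run p m : 0 < p ->
  energy p m (fun w => (leading_run w)%:R) <= 9 * m%:R :> R.
Proof.
move=> p0; have pn0 := lt0r_neq0 p0.
elim: m => [|m IH].
  by rewrite mulr0 /energy big_seq1 big1 // => c _; rewrite subrr normr0 powR0.
rewrite energyS// -[m.+1%:R]natr1 mulrDr mulr1 lerD//.
  rewrite big_I3 -[leRHS]addr0 -[X in _ <= _ + X]addr0.
  apply: lerD; last by apply: lerD; apply: eq_ler; apply: energy_cst.
  apply: le_trans IH; apply: eq_ler; apply: eq_bigr => w _; apply: eq_bigr => c _ /=.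
  by rewrite -!natr1 opprD addrACA subrr addr0.
apply: sum9_le => a c; apply: (@le_trans _ _ (1 `^ p)); last by rewrite powR1.
have small (x y : nat) : (x <= 1)%N -> (y <= 1)%N -> `|x%:R - y%:R| <= 1 :> R.
  move: x y => [|[|x]] [|[|y]] // _ _;
    by rewrite ?subrr ?normr0 ?subr0 ?sub0r ?normrN ?normr1.
have run1 b b' : b != b' -> (leading_run (b :: nseq m b') <= 1)%N.
  move=> bb' /=; have [bE|//] := eqVneq b o0.
  by rewrite leading_run_corner0// -bE eq_sym.
have [->|ac] := eqVneq a c; first by rewrite subrr normr0 ge0_ler_powR ?nnegrE ?(ltW p0).
by apply: ge0_ler_powR; rewrite ?nnegrE ?(ltW p0)// small ?run1// eq_sym.
Qed.

(** Rescaled to have corner difference 1, the function [leading_run] has energy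
O(m^(1 - p)), which is small for large m as p > 1; then [rate_lower] gives
lambda^m >= 1 / e > 1. *)
Lemma resistance_rate_gt1 p : 1 < p -> 1 < resistance_rate p.
Proof.
move=> p1; have p0 : 0 < p by exact: lt_trans p1.
have pm1 : 0 < p - 1 by rewrite subr_gt0.
pose C := 3 * 3 `^ p * (2 `^ p * 9) : R.
have C0 : 0 < C by rewrite !mulr_gt0 ?powR_gt0.
pose m := (Num.bound (C `^ (p - 1)^-1)).+1.
have m0 : 0 < m%:R :> R by rewrite ltr0n.
have Cm : C < m%:R `^ (p - 1).
  have -> : C = (C `^ (p - 1)^-1) `^ (p - 1) by rewrite powR_root ?gt_eqF// ltW.
  rewrite gt0_ltr_powR ?nnegrE ?powR_ge0 ?ler0n//.
  apply: lt_trans (archi_boundP (powR_ge0 _ _)) _; by rewrite ltr_nat.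
pose u w : R := (leading_run w)%:R / m%:R.
have u0 : u (nseq m o0) = 1 by rewrite /u leading_run_corner divff ?gt_eqF.
have u1 : u (nseq m o1) = 0 by rewrite /u leading_run_corner0// mul0r.
have uN : u (nseq m o0) != u (nseq m o1) by rewrite u0 u1 oner_eq0.
have Eu : energy p m u <= (m%:R^-1) `^ p * (9 * m%:R).
  apply: (le_trans (energy_lip (u := fun w => (leading_run w)%:R) (K := m%:R^-1) _ _ _ _)).
  - by rewrite invr_ge0.
  - exact: ltW.
  - by move=> w w'; rewrite /u -mulrBl normrM [leLHS]mulrC normfV (ger0_norm (ler0n _ m)).
  - by rewrite ler_wpM2l ?powR_ge0// energy_leading_run.
pose e := C / m%:R `^ (p - 1).
have mp0 : 0 < m%:R `^ (p - 1) :> R by rewrite powR_gt0.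
have e0 : 0 < e by rewrite divr_gt0.
have e1 : e < 1 by rewrite ltr_pdivrMr// mul1r.
have he : 3 * 3 `^ p * ((2 / `|u (nseq m o0) - u (nseq m o1)|) `^ p * energy p m u) <= e.
  rewrite u0 u1 subr0 normr1 divr1.
  apply: (@le_trans _ _ (3 * 3 `^ p * (2 `^ p * ((m%:R^-1) `^ p * (9 * m%:R))))).
    by rewrite !ler_wpM2l ?mulr_ge0 ?powR_ge0.
  apply: eq_ler; rewrite /e /C.
  have -> : (m%:R^-1 : R) `^ p = (m%:R `^ (p - 1))^-1 / m%:R.
    have mp : m%:R `^ p = m%:R `^ (p - 1) * m%:R :> R.
      by rewrite -[X in _ * X]powRr1 ?ler0n// -powRD ?subrK// (gt_eqF m0) implybT.
    by rewrite -[X in X `^ p]powR_inv1 ?ler0n// -powRrM mulN1r powRN mp invfM.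
  by field; rewrite !gt_eqF.
have := rate_lower (ltW p1) uN he e0 e1; rewrite -ler_pdivrMl// mulr1 => le1.
rewrite ltNge; apply/negP => l1.
have l0 : 0 <= resistance_rate p by rewrite divr_ge0 ?powR_ge0.
have : resistance_rate p ^+ m <= 1 by exact: exprn_ile1.
move=> /(le_trans le1); rewrite invf_le1// leNgt e1 //.
Qed.

Lemma osc_critical p : 1 < p -> exists2 A, 0 <= A &
  forall m (u : word -> R) w w', size w = m -> size w' = m ->
    `|u w - u w'| `^ p <= A * resistance_rate p ^+ m * energy p m u.
Proof.
move=> p1; have p0 : 0 < p by exact: lt_trans p1.
have l1 := resistance_rate_gt1 p1; set lam := resistance_rate p in l1 *.
have l0 : 0 < lam by apply: lt_trans l1.
pose L := lam `^ p^-1.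
have L1 : 1 < L.
  rewrite /L -[ltLHS](_ : 1 `^ p^-1 = 1); last by rewrite powR1.
  by rewrite gt0_ltr_powR ?invr_gt0 ?nnegrE ?(ltW l0).
pose A0 := (3 * 3 `^ p * 2 `^ p) `^ p^-1 : R.
have A00 : 0 <= A0 by exact: powR_ge0.
have LE m : L ^+ m = (lam ^+ m) `^ p^-1.
  by rewrite /L -powR_mulrn ?powR_ge0// -powRrM mulrC powRrM powR_mulrn ?(ltW l0).
have H m u i k : `|u (nseq m i) - u (nseq m k)| <= A0 * L ^+ m * energy p m u `^ p^-1.
  have c0 : 0 <= 3 * 3 `^ p * 2 `^ p :> R by rewrite !mulr_ge0 ?powR_ge0.
  rewrite LE -!powRM ?mulr_ge0 ?exprn_ge0 ?(ltW l0) ?energy_ge0//.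
  apply: le_powR_root => //; exact: corner_bound (ltW p1) (ltW l1).
have oscH := osc_of_corner p0 A00 L1 H.
have L0 : 0 <= L by apply: le_trans (ltW L1).
pose A1 := 2 * A0 * L / (L - 1).
have A10 : 0 <= A1 by rewrite divr_ge0 ?mulr_ge0// subr_ge0 ltW.
exists (A1 `^ p); first exact: powR_ge0.
move=> m u w w' sw sw'.
have E0 := energy_ge0 p m u.
apply: (@le_trans _ _ ((A1 * L ^+ m * energy p m u `^ p^-1) `^ p)).
  have H2 : `|u w - u w'| <= A1 * L ^+ m * energy p m u `^ p^-1 by exact: oscH.
  have B0 : 0 <= A1 * L ^+ m * energy p m u `^ p^-1.
    by rewrite (mulr_ge0 (mulr_ge0 A10 (exprn_ge0 _ L0))) ?powR_ge0.
  by rewrite ge0_ler_powR ?nnegrE ?(ltW p0).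
rewrite (powRM _ (mulr_ge0 A10 (exprn_ge0 m L0)) (powR_ge0 _ _)).
rewrite (powRM _ A10 (exprn_ge0 m L0)) (powR_root E0 (lt0r_neq0 p0)).
by rewrite LE powR_root ?gt_eqF// exprn_ge0// ltW.
Qed.

(** Choose m so that r is comparable with 2^(-n-m).  The lower energy bound gives the
factor r^(p alpha_p), of order (3 lambda)^(-n-m), and the coarsening gives the
factor 3^m lambda^m: the dependence on m cancels. *)
Lemma fluctuation_le_energy p : 1 < p -> exists2 C, 0 < C &
  forall f, f \in Lfun mu p%:E -> forall n r, 0 < r -> r <= 2^-1 ^+ n.+1 ->
    (fluctuation q K mu p f n id <=
     (C * (2 `^ (p * critical_exponent K mu p))^-1 ^+ n)%:E *
       ks_energy K mu p (critical_exponent K mu p) f r)%E.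
Proof.
move=> p1; have p0 : 0 < p by exact: lt_trans p1.
have [A A0 hA] := osc_critical p1.
set al := critical_exponent K mu p; set X := 2 `^ (p * al).
have l1 := resistance_rate_gt1 p1.
have XE : X = 3 * resistance_rate p by exact: resistance_rateE.
have X1 : 1 < X by rewrite XE; lra.
have X0 : 0 < X by apply: lt_trans X1.
have al0 : 0 <= p * al.
  rewrite leNgt; apply/negP => al0; move: X1; rewrite ltNge => /negP; apply.
  by rewrite -[leRHS](powRr0 2) /X ler_powR ?ler1n// ltW.
pose C := 2 * 2 `^ p * 2 `^ p * (1 + 3 * A) * (ball_ratio * 16 `^ (p * al)).
have b0 : 0 < ball_ratio :> R by exact: ball_ratio_gt0.
have C0 : 0 < C by rewrite !mulr_gt0 ?powR_gt0// ltr_pwDl// mulr_ge0.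
exists C => // f fL n r r0 rn.
have ks0 := ks_energy_ge0 K mu p al f r.
case E : (ks_energy K mu p al f r) ks0 => [Q| |] // Q0; last first.
  have c0 : (0 < (C * X^-1 ^+ n)%:E)%E by rewrite lte_fin mulr_gt0// exprn_gt0// invr_gt0.
  by rewrite (gt0_muley c0) leey.
rewrite lee_fin in Q0.
have [|| k /andP[k1 k2]] := @geometric_scale R 2^-1 (r * 2 ^+ n.+1).
- by rewrite invr_gt0 ltr0n/=; lra.
- rewrite mulr_gt0 ?exprn_gt0//= -ler_pdivlMr ?exprn_gt0// mul1r -exprVn//.
set m := (k + 5)%N; set N := (n + m)%N.
have P2 j : (2^-1 : R) ^+ j * 2 ^+ j = 1 by rewrite -exprMn mulVf ?expr1n.
have E16 : 16 * 2^-1 ^+ N = 2^-1 ^+ k * 2^-1 ^+ n.+1 :> R.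
  by rewrite /N /m addnA !exprD [2^-1 ^+ n.+1]exprS; field.
have r1 : 8 * 2^-1 ^+ N < r.
  have -> : 8 * 2^-1 ^+ N = 2^-1 ^+ k.+1 * 2^-1 ^+ n.+1 :> R.
    by rewrite [2^-1 ^+ k.+1]exprS -mulrA -E16; field.
  by rewrite [2^-1 ^+ n.+1]exprVn ltr_pdivrMr ?exprn_gt0.
have r2 : r <= 16 * 2^-1 ^+ N.
  by rewrite E16 [2^-1 ^+ n.+1]exprVn ler_pdivlMr ?exprn_gt0.
have lm0 : 0 <= A * resistance_rate p ^+ m.
  by rewrite mulr_ge0// exprn_ge0// ltW// (lt_trans _ l1).
have N5 : (5 <= n + m)%N by rewrite /m addnA leq_addl.
have EQ : (ks_energy K mu p al f r <= Q%:E)%E by rewrite E.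
apply: (le_trans (coarse_from_energy hq hK hmu (ltW p1) fL lm0 (@hA m) N5 r1 r2 EQ)).
rewrite -EFinM lee_fin.
have rX : r `^ (p * al) <= 16 `^ (p * al) * (X^-1 ^+ n * X^-1 ^+ m).
  rewrite -exprD -powR_half_expn -powRM ?exprn_ge0//.
  have h16 : 0 <= 16 * 2^-1 ^+ (n + m) :> R by rewrite mulr_ge0 ?exprn_ge0.
  by rewrite ge0_ler_powR ?nnegrE ?(ltW r0).
have Xm1 : 1 <= X ^+ m by rewrite exprn_ege1// ltW.
have hX : 1 + 3 * 3 ^+ m * (A * resistance_rate p ^+ m) <= (1 + 3 * A) * X ^+ m.
  rewrite (_ : 3 * 3 ^+ m * _ = 3 * A * X ^+ m); last first.
    rewrite XE [(3 * resistance_rate p) ^+ m]exprMn.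
    by move: (3 ^+ m) (resistance_rate p ^+ m) => s t; ring.
  have -> : (1 + 3 * A) * X ^+ m = X ^+ m + 3 * A * X ^+ m by ring.
  by rewrite lerD2r.
apply: (@le_trans _ _ (2 * 2 `^ p * 2 `^ p * ((1 + 3 * A) * X ^+ m) *
   (ball_ratio * (16 `^ (p * al) * (X^-1 ^+ n * X^-1 ^+ m)) * Q))).
  apply: ler_pM.
  - by rewrite !mulr_ge0 ?powR_ge0// addr_ge0// !mulr_ge0 ?exprn_ge0// ltW// (lt_trans _ l1).
  - by rewrite !mulr_ge0 ?powR_ge0// ltW.
  - by rewrite ler_wpM2l// !mulr_ge0 ?powR_ge0.
  - by rewrite ler_wpM2r// ler_wpM2l// ltW.
have XX : X ^+ m * X^-1 ^+ m = 1 by rewrite -exprMn divff ?expr1n// gt_eqF.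
have rearrange (a b c d u v z t : R) : z * v = 1 ->
    a * (b * z) * (c * (d * (u * v)) * t) = a * b * (c * d) * u * t.
  by move=> zv; transitivity (a * b * (c * d) * u * t * (z * v)); [ring|rewrite zv mulr1].
by apply: eq_ler; rewrite /C; exact: rearrange.
Qed.

End Critical.

(** * Optimising the level *)

Section RealLemmas.
Context {R : realType}.

Lemma powR2_hausdorff : 2 `^ hausdorff_dim = 3 :> R.
Proof.
have l2 : 0 < ln 2 :> R by rewrite ln_gt0// ltr1n.
by rewrite /powR gt_eqF// /hausdorff_dim divfK ?gt_eqF// lnK// posrE.
Qed.

Lemma hausdorff_dim_gt0 : 0 < hausdorff_dim :> R.
Proof. by rewrite divr_gt0// ln_gt0// ltr1n. Qed.

Lemma powR3_expn n (s : R) : (3 ^+ n) `^ s = (2 ^+ n) `^ (hausdorff_dim * s).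
Proof.
rewrite powRrM; congr (_ `^ _).
by rewrite -[2 ^+ n]powR_mulrn// -powRrM mulrC powRrM powR2_hausdorff powR_mulrn.
Qed.

Lemma le_limf_einf_right (g : R -> \bar R) (x : \bar R) (r0 : R) : 0 < r0 ->
  (forall r, 0 < r -> r < r0 -> (x <= g r)%E) -> (x <= limf_einf g 0^'+)%E.
Proof.
move=> r00 h; rewrite limf_einfE.
apply: le_trans (ereal_sup_ubound _); last first.
  exists [set r | 0 < r < r0] => //=.
  near=> r; apply/andP; split; near: r; [exact: nbhs_right_gt|exact: nbhs_right_lt].
by apply: le_ereal_inf_tmp => _ [r /= /andP[r1 r2] <-]; exact: h.
Unshelve. all: by end_near.
Qed.

(** With A = a + v and x = b / A <= 1, the two terms balance when
2^-n is comparable with x^g, where 1 / g = al + d_h (p - 1) / p.  Both are then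
comparable with the p-th power of x^(1 - theta) * A = A^theta * b^(1 - theta).
Using a + v rather than v ensures x <= 1, so that the level n exists. *)
Lemma interpolation (p al a b v C theta : R) : 1 < p -> 0 < al -> 0 <= b -> b <= a ->
  0 <= v -> 0 < C ->
  (forall n, a `^ p <= C * ((2 `^ (p * al))^-1 ^+ n * v `^ p + (3 ^+ n) `^ (p - 1) * b `^ p)) ->
  theta = (p - 1) * hausdorff_dim / (p * (al + hausdorff_dim) - hausdorff_dim) ->
  a <= (C * (2 `^ (p * al) + 1)) `^ p^-1 * ((a + v) `^ theta * b `^ (1 - theta)).
Proof.
move=> p1 al0 b0 ba v0 C0 h thE; have p0 : 0 < p by exact: lt_trans p1.
have d0 : 0 < hausdorff_dim :> R := hausdorff_dim_gt0.
have pm1 : 0 < p - 1 by rewrite subr_gt0.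
have a0 : 0 <= a by exact: le_trans ba.
set d := hausdorff_dim in d0 thE *; set X := 2 `^ (p * al) in h *.
have X1 : 1 < X.
  rewrite /X -[ltLHS](powRr0 2); rewrite /powR !gt_eqF// ltr_expR mul0r mulr_gt0 ?mulr_gt0//.
  by rewrite ln_gt0// ltr1n.
have X0 : 0 < X by apply: lt_trans X1.
have rhs0 : 0 <= (C * (X + 1)) `^ p^-1 * ((a + v) `^ theta * b `^ (1 - theta)).
  by rewrite !mulr_ge0 ?powR_ge0.
have [bE|bn0] := eqVneq b 0.
  suff az : a = 0 by apply: (le_trans _ rhs0); rewrite az.
  suff ap : a `^ p <= 0.
    apply/eqP; have /eqP : a `^ p = 0 by apply/le_anti; rewrite ap powR_ge0.
    by rewrite powR_eq0 => /andP[].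
  apply/ler_addgt0Pr => e e0; rewrite add0r.
  have : (fun n => C * v `^ p * X^-1 ^+ n) @ \oo --> C * v `^ p * 0.
    apply: cvgMr; apply: cvg_expr; rewrite gtr0_norm ?invr_gt0// invf_lt1//.
  rewrite mulr0 => /cvgrPdist_lt/(_ e e0)[N _ hN].
  have := hN N (leqnn N); rewrite /= sub0r normrN => /(le_lt_trans (ler_norm _))/ltW.
  apply: le_trans; have := h N; rewrite bE (powR0 (lt0r_neq0 p0)) mulr0 addr0.
  by rewrite [X^-1 ^+ N * _]mulrC mulrA.
have {bn0}b0 : 0 < b by rewrite lt_neqAle eq_sym bn0.
pose A := a + v; have A0 : 0 < A by rewrite ltr_pwDl// (lt_le_trans b0).
have bA : b <= A by rewrite (le_trans ba)// lerDl.
pose x := b / A; have x0 : 0 < x by rewrite divr_gt0.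
have x1 : x <= 1 by rewrite ler_pdivrMr// mul1r.
pose be := d * (p - 1) / p.
have be0 : 0 < be by rewrite divr_gt0// mulr_gt0.
pose g := (al + be)^-1.
have g0 : 0 < g by rewrite invr_gt0 addr_gt0.
have den0 : p * (al + d) - d != 0.
  rewrite (_ : _ - _ = p * al + d * (p - 1)); last by ring.
  by rewrite gt_eqF// addr_gt0// mulr_gt0.
have aben0 : al * p + d * (p - 1) != 0.
  by rewrite gt_eqF// addr_gt0// mulr_gt0.
have thetaE : be * g = theta.
  rewrite thE /g /be; field.
  by rewrite den0 gt_eqF//= aben0.
have theta1E : al * g = 1 - theta.
  rewrite thE /g /be; field.
  by rewrite den0 gt_eqF//= aben0.
pose t := x `^ g; have t0 : 0 < t by exact: powR_gt0.
have t1 : t <= 1.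
  apply: (@le_trans _ _ (1 `^ g)); last by rewrite powR1.
  by rewrite ge0_ler_powR ?nnegrE ?(ltW g0) ?(ltW x0).
have [|| n /andP[n1 n2]] := @geometric_scale R 2^-1 t.
- by rewrite invr_gt0 ltr0n/=; lra.
- by rewrite t0 t1.
pose Y := x `^ (1 - theta) * A.
have Y0 : 0 <= Y by rewrite mulr_ge0 ?powR_ge0// ltW.
have YE : Y = A `^ theta * b `^ (1 - theta).
  have -> : b = x * A by rewrite divfK ?gt_eqF.
  rewrite powRM ?(ltW x0) ?(ltW A0)// mulrCA -powRD ?(gt_eqF A0) ?implybT//.
  by rewrite [theta + _]addrC subrK powRr1 ?(ltW A0).
have e1 : X^-1 ^+ n * v `^ p <= X * Y `^ p.
  apply: (@le_trans _ _ ((2 * t) `^ (p * al) * A `^ p)).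
    rewrite /X -powR_half_expn; apply: ler_pM; rewrite ?powR_ge0//.
      rewrite ge0_ler_powR ?nnegrE ?mulr_ge0 ?(ltW p0) ?(ltW al0) ?(ltW t0) ?exprn_ge0//.
      by move: n1; rewrite exprS; lra.
    by rewrite ge0_ler_powR ?nnegrE ?(ltW p0) ?(ltW A0)// lerDr.
  rewrite powRM ?(ltW t0)// -mulrA ler_wpM2l ?powR_ge0//.
  rewrite /Y (powRM _ (powR_ge0 x _) (ltW A0)); apply: eq_ler; congr (_ * _).
  by rewrite /t -(powRrM x g) -(powRrM x (1 - theta)) -theta1E; congr (_ `^ _); ring.
have e2 : (3 ^+ n) `^ (p - 1) * b `^ p <= Y `^ p.
  have tn : 2 ^+ n <= t^-1.
    by rewrite -[leLHS]invrK lef_pV2 ?posrE ?invr_gt0 ?exprn_gt0// -exprVn.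
  rewrite powR3_expn -/d.
  apply: (@le_trans _ _ ((t^-1) `^ (d * (p - 1)) * b `^ p)).
    rewrite ler_wpM2r ?powR_ge0// ge0_ler_powR ?nnegrE ?exprn_ge0 ?invr_ge0 ?(ltW t0)//.
    by rewrite mulr_ge0 ?(ltW d0)// subr_ge0 ltW.
  have -> : (t^-1) `^ (d * (p - 1)) = (x `^ (- theta)) `^ p.
    have -> : t^-1 = x `^ (- g) by rewrite powRN.
    rewrite -(powRrM x (- g)) -(powRrM x (- theta)) -thetaE /be; congr (_ `^ _).
    by field; rewrite gt_eqF.
  rewrite -powRM ?powR_ge0 ?(ltW b0)//; apply: eq_ler; congr (_ `^ _).
  have -> : b = x * A by rewrite divfK ?gt_eqF.
  rewrite mulrA /Y; congr (_ * _).
  by rewrite -{2}[x]powRr1 ?(ltW x0)// -powRD ?(gt_eqF x0) ?implybT// addrC.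
have ap : a `^ p <= C * (X + 1) * Y `^ p.
  apply: (le_trans (h n)); rewrite -mulrA ler_wpM2l ?(ltW C0)//.
  by rewrite mulrDl mul1r lerD.
have CX0 : 0 <= C * (X + 1) by rewrite mulr_ge0 ?(ltW C0)// addr_ge0 ?(ltW X0).
apply: (le_trans (le_powR_root p0 a0 ap)).
rewrite powRM ?powR_ge0// -YE ler_wpM2l ?powR_ge0//.
by rewrite -powRrM divff ?gt_eqF// powRr1.
Qed.

End RealLemmas.

(** * The exponent one, and the two inequalities *)

Section ExponentOne.
Context {R : realType} (q : 'I_3 -> R * R) (K : set (R * R)).
Context (hq : unit_equilateral q) (hK : is_gasket q K).
Context (mu : {measure set (R * R)%type -> \bar R}) (hmu : is_gasket_measure q K mu).

Definition head_indicator (w : word) : R := (head o1 w == o0)%:R.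

(** The indicator of a cell of level 1.  It jumps only across the two midpoints that
this cell shares with the others, so at each level boundedly many cells see a jump. *)
Definition cell_indicator (x : R * R) : R := head_indicator (address q K 1 x).

(** At level 0 the word is empty and carries no information on the first letter, hence
the bound 1. *)
Definition head_modulus n (w : word) : R :=
  if n is 0 then 1
  else \sum_(c : 'I_3) `|head_indicator w - head_indicator (neighbour w c).1|.

Lemma head_modulus_ge0 n w : 0 <= head_modulus n w.
Proof. by case: n => //= n; rewrite sumr_ge0. Qed.

Lemma sum_head_modulus n : \sum_(w <- words n) head_modulus n w `^ 1 <= 9.
Proof.
case: n => [|n]; first by rewrite big_seq1 powR1; lra.
have -> : \sum_(w <- words n.+1) head_modulus n.+1 w `^ 1 = energy 1 n.+1 head_indicator.
  apply: eq_bigr => w _; rewrite powRr1; last exact: head_modulus_ge0.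
  by apply: eq_bigr => c _; rewrite powRr1.
rewrite energyS ?oner_eq0// [X in X + _]big1 ?add0r; last first.
  by move=> a _; apply: energy_cst; rewrite ?oner_eq0.
apply: sum9_le => a c; rewrite powRr1// /head_indicator /=.
by case: (a == o0); case: (c == o0); rewrite ?subrr ?normr0 ?subr0 ?sub0r ?normrN ?normr1.
Qed.

Lemma cell_indicator_modulus n x y :
  (address q K n y = address q K n x \/
   exists c, address q K n y = (neighbour (address q K n x) c).1) ->
  `|cell_indicator y - cell_indicator x| <= head_modulus n (address q K n x).
Proof.
case: n => [_|n E].
  rewrite /cell_indicator /head_indicator /=.
  by case: (_ == o0); case: (_ == o0); rewrite ?subrr ?normr0 ?subr0 ?sub0r ?normrN ?normr1.
have ciE z : cell_indicator z = head_indicator (address q K n.+1 z) by [].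
rewrite !ciE; case: E => [->|[c ->]].
  by rewrite subrr normr0 head_modulus_ge0.
by rewrite distrC /head_modulus (bigD1 c)//= lerDl sumr_ge0.
Qed.

Lemma measurable_cell_indicator : measurable_fun setT cell_indicator.
Proof. exact: (measurable_address_fun hK 1 head_indicator). Qed.

Lemma cell_indicator_nonconst : ~ ae_constant mu cell_indicator.
Proof.
move=> [c hc].
have [x [_ /= x1] fx] := address_cell_not_null hK hmu [:: o0] hc.
have [y [_ /= y1] fy] := address_cell_not_null hK hmu [:: o1] hc.
move: fx; rewrite -fy /cell_indicator /head_indicator /= .
case: x1 => ->; case: y1 => ->; rewrite eqxx /= => /eqP.
by rewrite oner_eq0.
Qed.

Lemma cell_indicator_besov : besov K mu hausdorff_dim 1 cell_indicator.
Proof.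
have d0 := @hausdorff_dim_gt0 R.
split.
  apply: (bounded_Lfun (mu_setT hK hmu) ltr01); first exact: measurable_cell_indicator.
  move=> x; rewrite /cell_indicator /head_indicator.
  by case: (_ == o0); rewrite ?normr0 ?normr1.
apply: (@le_lt_trans _ _ 81%:E); last by rewrite ltry.
apply: ge_ereal_sup => _ [r /= r0 <-].
have bound n : n = 0%N \/ r <= 2^-1 ^+ n.+1 -> 2^-1 ^+ n.+2 <= r ->
    (ks_energy K mu 1 hausdorff_dim cell_indicator r <= 81%:E)%E.
  move=> rn nr.
  have := energy_upper hq hK hmu hausdorff_dim r0 ler01 rn
    (fun x y _ _ hxy => @cell_indicator_modulus n x y hxy).
  move=> /le_trans; apply; rewrite lee_fin mul1r.
  have rd : (r `^ hausdorff_dim)^-1 <= 3 ^+ n.+2.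
    rewrite -[leRHS]invrK lef_pV2 ?posrE ?invr_gt0 ?exprn_gt0 ?powR_gt0//.
    rewrite -exprVn -{1}powR2_hausdorff -powR_half_expn.
    by rewrite ge0_ler_powR ?nnegrE ?exprn_ge0 ?(ltW r0) ?(ltW d0).
  apply: (@le_trans _ _ (3 ^+ n.+2 * 3 ^- n * 9)).
    apply: ler_pM; rewrite ?sum_head_modulus//.
    - by rewrite mulr_ge0 ?invr_ge0 ?powR_ge0 ?exprn_ge0.
    - by rewrite sumr_ge0 => // *; exact: powR_ge0.
    - by rewrite ler_wpM2r ?invr_ge0 ?exprn_ge0.
  rewrite !exprS; apply: eq_ler; set u := 3 ^+ n; field.
  by rewrite expf_neq0.
have [r2|r2] := leP r 2^-1; last first.
  apply: (bound 0%N); first by left.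
  by rewrite !exprS expr0; lra.
have [|| k /andP[k1 k2]] := @geometric_scale R 2^-1 (2 * r).
- by rewrite invr_gt0 ltr0n/=; lra.
- by rewrite mulr_gt0//=; lra.
apply: (bound k); first by right; rewrite exprS; lra.
by rewrite exprS; lra.
Qed.

Lemma critical_exponent1_ge : hausdorff_dim <= critical_exponent K mu 1.
Proof.
apply: (critical_set_ub hq hK hmu (lexx 1)); split; first exact/ltW/hausdorff_dim_gt0.
by exists cell_indicator; split; [exact: cell_indicator_besov|exact: cell_indicator_nonconst].
Qed.

End ExponentOne.

Section Inequalities.
Context {R : realType} (q : 'I_3 -> R * R) (K : set (R * R)).
Context (hq : unit_equilateral q) (hK : is_gasket q K).
Context (mu : {measure set (R * R)%type -> \bar R}) (hmu : is_gasket_measure q K mu).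
Implicit Types (f : R * R -> R).

Local Notation mK := (measurable_gasket hK).
Local Notation maddress_cell := (measurable_address_cell hK).
Local Notation cell_avg := (cell_avg q K mu).

Lemma integral_setT_gasket (g : R * R -> \bar R) : measurable_fun setT g ->
  (forall x, (0 <= g x)%E) ->
  (\int[mu]_x g x = \int[mu]_(x in K) g x)%E.
Proof.
move=> mg g0; rewrite (@ge0_negligible_integral _ _ _ mu setT (~` K))//.
- by rewrite setTD setCK.
- exact: measurableC mK.
- exact: hmu.1.
Qed.

Lemma cell_avg_abs_le f w : mu.-integrable setT (EFin \o f) ->
  ((3 ^- size w * `|cell_avg f w|)%:E <= \int[mu]_(x in address_cell q K w) (`|f x|)%:E)%E.
Proof.
move=> fi; have := cell_avg_jensen hK hmu w 0 fi (lexx 1).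
rewrite subr0 powRr1// => /le_trans; apply; apply: ge0_le_integral_nonmeasurable => x _.
  by rewrite lee_fin powR_ge0.
by rewrite subr0 powRr1.
Qed.

Lemma L1_real f : mu.-integrable setT (EFin \o f) ->
  ('N[mu]_1[EFin \o f])%E \is a fin_num.
Proof.
move=> fi; rewrite Lnorm1; apply: (integrable_fin_num measurableT).
exact: integrable_abse fi.
Qed.

Lemma sum_cell_avg_abs f n : mu.-integrable setT (EFin \o f) ->
  \sum_(w <- words n) 3 ^- n * `|cell_avg f w| <= fine (('N[mu]_1[EFin \o f])%E).
Proof.
move=> fi; have mabs : measurable_fun setT (fun x => (`|f x|)%:E).
  move/integrableP: fi => [/measurable_EFinP mf _].
  by apply/measurable_EFinP; exact: measurableT_comp.
rewrite -lee_fin fineK ?L1_real// Lnorm1.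
rewrite (integral_setT_gasket (g := fun x => (`|f x|)%:E))//.
rewrite (integral_gasket_address_cell hK mu n)//; last exact: measurable_funTS.
rewrite -sumEFin; apply: lee_sum_words => w sw.
by rewrite -sw; exact: cell_avg_abs_le.
Qed.

(** On a cell w the average satisfies [|avg w| <= 3^n ||f||_1]; using this for p - 1 of
the p factors of |avg w|^p and summing the remaining one gives
[3^(n (p - 1)) ||f||_1^p]. *)
Lemma powR_integral_split p f n : 1 <= p -> f \in Lfun mu p%:E ->
  (\int[mu]_(x in K) (`|f x| `^ p)%:E <=
    (2 `^ p)%:E * (fluctuation q K mu p f n id +
      ((3 ^+ n) `^ (p - 1) * fine (('N[mu]_1[EFin \o f])%E) `^ p)%:E))%E.
Proof.
move=> p1 fL; have p0 : 0 < p by exact: lt_le_trans p1.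
have mf := Lfun_measurable fL; have fi := Lfun_integrable1 hK hmu p1 fL.
set b := fine _; have b0 : 0 <= b by rewrite fine_ge0 ?Lnorm_ge0.
have mavg : measurable_fun K (fun x => cell_avg f (address q K n x)).
  by apply: measurable_funTS; exact: (measurable_address_fun hK n (cell_avg f)).
have mdev : measurable_fun K (fun x => (`|f x - cell_avg f (address q K n x)| `^ p)%:E).
  by apply: measurable_powR_abs; apply: measurable_funB => //; exact: measurable_funTS.
apply: (@le_trans _ _ (\int[mu]_(x in K) ((2 `^ p)%:E *
   ((`|f x - cell_avg f (address q K n x)| `^ p)%:E + (`|cell_avg f (address q K n x)| `^ p)%:E)))%E).
  apply: ge0_le_integral_nonmeasurable => x _; first by rewrite lee_fin powR_ge0.
  rewrite -EFinD -EFinM lee_fin; apply: le_trans (powR_add_le (ltW p0) _ _) => //.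
  rewrite ge0_ler_powR ?nnegrE ?addr_ge0 ?(ltW p0)//.
  by rewrite -{1}[f x](subrK (cell_avg f (address q K n x))) ler_normD.
rewrite ge0_integralZl_EFin; [|exact: mK|
  by move=> x _; rewrite adde_ge0 ?lee_fin ?powR_ge0|
  by apply: emeasurable_funD => //; exact: measurable_powR_abs|exact: powR_ge0].
rewrite lee_wpmul2l ?lee_fin ?powR_ge0//.
rewrite ge0_integralD; [|exact: mK|by move=> x _; rewrite lee_fin powR_ge0|exact: mdev|
  by move=> x _; rewrite lee_fin powR_ge0|exact: measurable_powR_abs].
apply: leeD => //.
rewrite (integral_gasket_address_cell hK mu n); [|exact: measurable_powR_abs|
  by move=> x _; rewrite lee_fin powR_ge0].
apply: (@le_trans _ _ (\sum_(w <- words n) ((3 ^+ n) `^ (p - 1) * b `^ (p - 1) *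
   (3 ^- n * `|cell_avg f w|))%:E)%E); last first.
  rewrite sumEFin lee_fin -mulr_sumr -mulrA ler_wpM2l ?powR_ge0//.
  have -> : b `^ p = b `^ (p - 1) * b.
    have [->|bn0] := eqVneq b 0; first by rewrite mulr0 powR0 ?gt_eqF.
    by rewrite -[X in _ = _ * X]powRr1// -powRD ?subrK// bn0 implybT.
  by rewrite ler_wpM2l ?powR_ge0// sum_cell_avg_abs.
apply: lee_sum_words => w sw.
rewrite (eq_integral (cst (`|cell_avg f w| `^ p)%:E)); last first.
  by move=> x; rewrite inE => -[_ /=]; rewrite sw => ->.
rewrite integral_cst; last exact: maddress_cell.
rewrite (mu_address_cell hK hmu) sw -EFinM lee_fin.
have ab : 3 ^- n * `|cell_avg f w| <= b.
  apply: le_trans (sum_cell_avg_abs n fi).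
  rewrite (bigD1_seq w) ?uniq_words ?mem_words ?sw//= lerDl sumr_ge0 => // *.
set u := `|cell_avg f w| in ab *; have u0 : 0 <= u by rewrite /u.
have -> : u `^ p = u `^ (p - 1) * u.
  have [->|un0] := eqVneq u 0; first by rewrite mulr0 powR0 ?gt_eqF.
  by rewrite -[X in _ = _ * X]powRr1// -powRD ?subrK// un0 implybT.
have -> : u `^ (p - 1) * u / 3 ^+ n = u `^ (p - 1) * (3 ^- n * u) by ring.
rewrite ler_wpM2r ?mulr_ge0 ?invr_ge0 ?exprn_ge0//.
rewrite -powRM ?exprn_ge0// ge0_ler_powR ?nnegrE ?subr_ge0 ?mulr_ge0 ?exprn_ge0//.
by rewrite -ler_pdivrMl ?exprn_gt0.
Qed.

Lemma Lp_real p f : 1 <= p -> f \in Lfun mu p%:E ->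
  exists2 I : R, (\int[mu]_x (`|f x| `^ p)%:E)%E = I%:E &
    [/\ 0 <= I, ('N[mu]_(p%:E)[EFin \o f] = (I `^ p^-1)%:E)%E &
        fine (('N[mu]_1[EFin \o f])%E) `^ p <= I].
Proof.
move=> p1 fL; have p0 : 0 < p by exact: lt_le_trans p1.
have fi := Lfun_integrable1 hK hmu p1 fL.
have Ifin := integrable_fin_num measurableT (Lfun_integrable p1 fL).
exists (fine (\int[mu]_x (`|f x| `^ p)%:E)%E); first by rewrite fineK.
have I0 : (0 <= \int[mu]_x (`|f x| `^ p)%:E)%E.
  by apply: integral_ge0 => x _; rewrite lee_fin powR_ge0.
split; first exact: fine_ge0.
  by rewrite unlock -[in LHS](fineK Ifin) poweR_EFin.
have := jensen_powR measurableT (mu_setT hK hmu) ltr01 p1 (integrable_abse fi).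
rewrite [1^-1]invr1 !mul1r -lee_fin fineK//.
have -> : (\int[mu]_x (`|(`|f x|)| `^ p)%:E = \int[mu]_x (`|f x| `^ p)%:E)%E.
  by apply: eq_integral => x _; rewrite normr_id.
apply: le_trans; rewrite lee_fin ge0_ler_powR ?nnegrE ?(ltW p0)//.
  by rewrite fine_ge0 ?Lnorm_ge0.
rewrite Lnorm1; exact: ler_norm.
Qed.

Lemma Lp_eq0_of_L1_eq0 p f : 1 <= p -> f \in Lfun mu p%:E ->
  (('N[mu]_1[EFin \o f])%E = 0)%E -> ('N[mu]_(p%:E)[EFin \o f] = 0)%E.
Proof.
move=> p1 fL N0; have p0 : 0 < p by exact: lt_le_trans p1.
have mf : measurable_fun setT (EFin \o f) by apply/measurable_EFinP; exact: Lfun_measurable fL.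
have f0 := Lnorm_eq0_eq0 mf (lte01 : (0 < 1)%E) N0.
rewrite unlock; suff -> : (\int[mu]_x `|(EFin \o f) x| `^ p = 0)%E.
  by rewrite poweR0r// invr_neq0// gt_eqF.
transitivity (\int[mu]_x cst 0%E x)%E; last by rewrite integral0.
apply: ae_eq_integral => //.
- apply: (measurableT_comp (measurable_poweR _)); exact: measurableT_comp.
- apply: filterS f0 => x + _ => /(_ I) /= [->].
  by rewrite normr0 powR0// gt_eqF.
Qed.

(** A suitable multiple Y of the fluctuation is at most the energy at every small
scale, so that Y^(1 / p) is at most the variation and [interpolation] applies.
Infinite variation and vanishing L^1 norm are treated apart, since there the
right-hand side is not a product of positive real numbers; in the second case
f = 0 almost everywhere. *)
Lemma nash_inequality p : 1 < p -> exists2 C : R, 0 < C &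
  forall f, f \in Lfun mu p%:E ->
    ('N[mu]_(p%:E)[EFin \o f] <=
       C%:E * ('N[mu]_(p%:E)[EFin \o f] + variation_p K mu p f) `^ (nash_exponent K mu p)
            * ('N[mu]_1[EFin \o f])%E `^ (1 - nash_exponent K mu p))%E.
Proof.
move=> p1; have p0 : 0 < p by exact: lt_trans p1.
have pn0 := lt0r_neq0 p0; have pV0 : 0 < p^-1 by rewrite invr_gt0.
have [C C0 hC] := fluctuation_le_energy hq hK hmu p1.
set al := critical_exponent K mu p in hC *; set X := 2 `^ (p * al) in hC *.
have X1 : 1 < X.
  have := resistance_rate_gt1 hq hK hmu p1; rewrite /X resistance_rateE; lra.
have X0 : 0 < X by apply: lt_trans X1.
have al0 : 0 < al.
  rewrite ltNge; apply/negP => al0; move: X1; rewrite ltNge => /negP; apply.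
  rewrite -[leRHS](powRr0 2) /X; apply: ler_powR; first by rewrite ler1n.
  by rewrite mulr_ge0_le0// ltW.
pose D := 2 `^ p * (C + 1).
have D0 : 0 < D by rewrite mulr_gt0 ?powR_gt0// addr_gt0.
exists ((D * (X + 1)) `^ p^-1).
  by rewrite powR_gt0// mulr_gt0// addr_gt0.
move=> f fL; set th := nash_exponent K mu p.
have th0 : 0 < th.
  have d0 := @hausdorff_dim_gt0 R; have pm1 : 0 < p - 1 by rewrite subr_gt0.
  have den0 : 0 < p * (al + hausdorff_dim) - hausdorff_dim.
    have -> : p * (al + hausdorff_dim) - hausdorff_dim = p * al + hausdorff_dim * (p - 1).
      by ring.
    by rewrite addr_gt0// mulr_gt0.
  by rewrite /th /nash_exponent -/al divr_gt0// mulr_gt0.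
have fi := Lfun_integrable1 hK hmu (ltW p1) fL.
have [I IE [I0 NE bI]] := Lp_real (ltW p1) fL.
have [N0|N0] := eqVneq ('N[mu]_1[EFin \o f])%E 0%E.
  by rewrite {1}(Lp_eq0_of_L1_eq0 (ltW p1) fL N0) !mule_ge0 ?poweR_ge0 ?lee_fin ?powR_ge0.
have V0 : (0 <= variation_p K mu p f)%E.
  by apply: (le_limf_einf_right ltr01) => r _ _; exact: poweR_ge0.
have L1fin := L1_real fi.
have N0' : (0 < ('N[mu]_1[EFin \o f])%E)%E by rewrite lt0e N0 Lnorm_ge0.
have cst0 : (0 < ((D * (X + 1)) `^ p^-1)%:E)%E.
  by rewrite lte_fin powR_gt0// mulr_gt0// addr_gt0.
case VE : (variation_p K mu p f) V0 => [v| |] // V0; last first.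
  rewrite NE addey// poweRyr ?gt_eqF// gt0_muley// gt0_mulye ?leey//.
  by rewrite poweR_gt0.
rewrite lee_fin in V0.
set b := fine ('N[mu]_1[EFin \o f])%E in bI.
have bE : (('N[mu]_1[EFin \o f])%E = b%:E)%E by rewrite fineK.
have b0 : 0 <= b by rewrite fine_ge0 ?Lnorm_ge0.
rewrite bE NE -EFinD !poweR_EFin -!EFinM lee_fin -mulrA.
apply: interpolation => //; first by apply: le_powR_root.
move=> n; rewrite powR_root//.
have Xn0 : 0 < C * X^-1 ^+ n by rewrite mulr_gt0// exprn_gt0// invr_gt0.
have Fn0 : (0 <= fluctuation q K mu p f n id)%E.
  by apply: integral_ge0 => x _; rewrite lee_fin powR_ge0.
have key : (fluctuation q K mu p f n id <= (C * X^-1 ^+ n * v `^ p)%:E)%E.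
  set Y := ((C * X^-1 ^+ n)^-1%:E * fluctuation q K mu p f n id)%E.
  have Y0 : (0 <= Y)%E by rewrite mule_ge0// lee_fin invr_ge0 ltW.
  have Yv : (Y `^ p^-1 <= v%:E)%E.
    rewrite -VE; apply: (@le_limf_einf_right _ _ _ (2^-1 ^+ n.+1)).
      by rewrite exprn_gt0.
    move=> r r0 rn; apply: gt0_ler_poweR; rewrite ?in_itv/= ?leey ?andbT ?ks_energy_ge0 ?(ltW pV0)//.
    rewrite /Y lee_pdivrMl//; exact: hC (ltW rn).
  have Yp : (Y <= (v `^ p)%:E)%E.
    have -> : Y = ((Y `^ p^-1) `^ p)%E by rewrite -poweRrM mulVf// poweRe1.
    rewrite -poweR_EFin; apply: gt0_ler_poweR; rewrite ?in_itv/= ?leey ?andbT ?poweR_ge0 ?lee_fin ?(ltW p0)//.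
  by rewrite EFinM -lee_pdivrMl.
have := powR_integral_split n (ltW p1) fL; rewrite -integral_setT_gasket; last 2 first.
- by apply: measurable_powR_abs; exact: Lfun_measurable fL.
- by move=> x; rewrite lee_fin powR_ge0.
rewrite IE => h.
have {h} := le_trans h (lee_wpmul2l _ (leeD key (lexx _))).
rewrite lee_fin powR_ge0 => /(_ isT); rewrite -EFinD -EFinM lee_fin -/b => /le_trans; apply.
have gen (c s t : R) : 0 <= c -> 0 <= s -> 0 <= t ->
    2 `^ p * (c * s + t) <= 2 `^ p * (c + 1) * (s + t).
  move=> c0 s0 t0; rewrite -mulrA ler_wpM2l ?powR_ge0//.
  have : 0 <= c * t by exact: mulr_ge0.
  lra.
rewrite -[C * _ * _]mulrA; apply: gen.
- exact: ltW.
- by rewrite mulr_ge0 ?powR_ge0// exprn_ge0// invr_ge0 ltW.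
- by rewrite mulr_ge0 ?powR_ge0.
Qed.

(** The oscillation of the averages is at most their 1-energy, and the latter is at
most C 3^n r^(d_h) E(f, r), where 3^n r^(d_h) <= 81 as r <= 16 * 2^-n.  The mean
over all cells of the modulus of the averages is at most the L^1 norm. *)
Lemma fine_scale_bounds1 f n r (Q : R) : f \in Lfun mu 1 ->
  (5 <= n)%N -> 8 * 2^-1 ^+ n < r -> r <= 16 * 2^-1 ^+ n -> r <= 1 ->
  (ks_energy K mu 1 (critical_exponent K mu 1) f r <= Q%:E)%E ->
  (fluctuation q K mu 1 f n id <= (ball_ratio * r `^ hausdorff_dim * Q)%:E)%E /\
  forall x, `|cell_avg f (address q K n x)| <=
     fine (('N[mu]_1[EFin \o f])%E) + 3 * ball_ratio * 81 * Q.
Proof.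
move=> fL n5 r1 r2 r3 hQ.
have fL1 : f \in Lfun mu 1%:E by [].
have r0 : 0 < r by apply: le_lt_trans r1; rewrite mulr_ge0 ?exprn_ge0.
have b0 : 0 < ball_ratio :> R := ball_ratio_gt0.
have d0 := @hausdorff_dim_gt0 R.
have fi := Lfun_integrable1 hK hmu (lexx 1) fL1.
have Q0 : 0 <= Q by rewrite -lee_fin (le_trans (ks_energy_ge0 _ _ _ _ _ _) hQ).
have ra : r `^ (1 * critical_exponent K mu 1) <= r `^ hausdorff_dim.
  rewrite mul1r; apply: ger_powR; first by rewrite r0.
  exact: (critical_exponent1_ge hq hK hmu).
have low tau : (forall w, tau w = w \/ exists c, tau w = (neighbour w c).1) ->
    (fluctuation q K mu 1 f n tau <= (ball_ratio * r `^ hausdorff_dim * Q)%:E)%E.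
  move=> ht; apply: (le_trans (energy_lower hq hK hmu (critical_exponent K mu 1) n5 (lexx 1) r1 r2 fL1 ht)).
  rewrite [leRHS]EFinM; apply: lee_pmul => //; rewrite ?lee_fin ?ks_energy_ge0//.
    by rewrite mulr_ge0 ?powR_ge0// ltW.
  by rewrite ler_wpM2l// ltW.
split; first by apply: low => w; left.
have hE := energy_cell_avg_le hK hmu (lexx 1) fL1 (fun c => low _ (fun w => or_intror (ex_intro _ c erefl))).
have rd : r `^ hausdorff_dim <= 81 * 3 ^- n.
  apply: (@le_trans _ _ ((16 * 2^-1 ^+ n) `^ hausdorff_dim)).
    by rewrite ge0_ler_powR ?nnegrE ?(ltW r0) ?(ltW d0) ?mulr_ge0 ?exprn_ge0.
  rewrite powRM ?exprn_ge0// powR_half_expn powR2_hausdorff exprVn.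
  rewrite (_ : 16 = 2 ^+ 4); last by ring.
  rewrite -powR_mulrn// -powRrM mulrC [_ * hausdorff_dim]mulrC powRrM powR2_hausdorff powR_mulrn//.
  by apply: eq_ler; ring.
have E3 : energy 1 n (cell_avg f) <= 3 * ball_ratio * 81 * Q.
  rewrite -(@ler_pM2l _ (3 ^- n)) ?invr_gt0 ?exprn_gt0//.
  apply: (le_trans hE).
  have : ball_ratio * r `^ hausdorff_dim * Q <= ball_ratio * (81 * 3 ^- n) * Q.
    by rewrite ler_wpM2r// ler_wpM2l// ltW.
  lra.
move=> x; set w := address q K n x.
have sw : size w = n by rewrite size_address.
have hw w' : size w' = n -> `|cell_avg f w| <= `|cell_avg f w'| + 3 * ball_ratio * 81 * Q.
  move=> sw'; have := osc_energy1 (cell_avg f) sw sw'.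
  have := ler_normD (cell_avg f w - cell_avg f w') (cell_avg f w'); rewrite subrK; lra.
have one : \sum_(w' <- words n) 3 ^- n = 1 :> R.
  rewrite big_const_seq count_predT size_words iter_addr_0 -[_ *+ (_ ^ _)]mulr_natr natrX.
  by rewrite mulVf// expf_neq0.
have := sum_cell_avg_abs n fi; set b := fine _ => hb.
have : \sum_(w' <- words n) 3 ^- n * `|cell_avg f w| <=
   \sum_(w' <- words n) 3 ^- n * (`|cell_avg f w'| + 3 * ball_ratio * 81 * Q).
  by apply: ler_sum_words => w' sw'; rewrite ler_wpM2l ?invr_ge0 ?exprn_ge0// hw.
rewrite -mulr_suml one mul1r => /le_trans; apply.
under eq_bigr do rewrite mulrDr.
by rewrite big_split /= -mulr_suml one mul1r lerD2r.
Qed.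

(** For M greater than the variation, let J be the integral of the excess of |f| over
T = ||f||_1 + C M.  At each small scale r of energy less than M, the averages are
at most T, so J is at most int |f - f_n| = O(r^(d_h)).  If J were positive, then
all small enough scales would have energy at least M, contradicting the choice of
M. *)
Lemma sup_inequality : exists2 C : R, 0 < C &
  forall f, f \in Lfun mu 1 ->
    ('N[mu]_(+oo)[EFin \o f] <=
       C%:E * (('N[mu]_1[EFin \o f])%E + variation_p K mu 1 f))%E.
Proof.
have b0 : 0 < ball_ratio :> R := ball_ratio_gt0.
have d0 := @hausdorff_dim_gt0 R.
pose C := 1 + 3 * ball_ratio * 81 : R.
have C1 : 1 <= C by rewrite lerDl !mulr_ge0// ltW.
have C0 : 0 < C by apply: lt_le_trans C1.
exists C => // f fL.
have fL1 : f \in Lfun mu 1%:E by [].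
have fi := Lfun_integrable1 hK hmu (lexx 1) fL1.
have mf := Lfun_measurable fL1.
have L1fin := L1_real fi; set b := fine ('N[mu]_1[EFin \o f])%E.
have bE : (('N[mu]_1[EFin \o f])%E = b%:E)%E by rewrite fineK.
have bb0 : 0 <= b by rewrite fine_ge0 ?Lnorm_ge0.
have V0 : (0 <= variation_p K mu 1 f)%E.
  by apply: (le_limf_einf_right ltr01) => r _ _; exact: poweR_ge0.
case VE : (variation_p K mu 1 f) V0 => [v| |] // V0; last first.
  by rewrite bE addey// gt0_muley ?leey// lte_fin.
rewrite lee_fin in V0.
have mu0 : (0 < mu setT)%E by rewrite (mu_setT hK hmu) lte01.
rewrite bE -EFinD -EFinM unlock mu0; apply/ess_supP.
have main M : v < M -> \forall x \ae mu, `|f x| <= b + (3 * ball_ratio * 81) * M.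
  move=> vM; have M0 : 0 <= M by rewrite (le_trans V0)// ltW.
  set T := b + _.
  pose g x := Num.max (`|f x| - T) 0.
  have g0 x : 0 <= g x by rewrite /g le_max lexx orbT.
  have mg : measurable_fun setT (EFin \o g).
    apply/measurable_EFinP; apply: measurable_maxr => //.
    by apply: measurable_funB => //; exact: measurableT_comp.
  set J := (\int[mu]_(x in K) (g x)%:E)%E.
  have J0 : (0 <= J)%E by apply: integral_ge0 => x _; rewrite lee_fin.
  have J00 : J = 0%E.
    apply/eqP; rewrite eq_le J0 andbT leNgt; apply/negP => Jpos.
    have [j j0 jJ] : exists2 j : R, 0 < j & (j%:E <= J)%E.
      case JE : J Jpos => [j| |] // Jpos; last by exists 1 => //; exact: leey.
      by exists j => //; rewrite -lte_fin.
    have Bpos : 0 < ball_ratio * M + 1 by rewrite ltr_wpDl// mulr_ge0// ltW.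
    pose r1 := (j / (ball_ratio * M + 1)) `^ hausdorff_dim^-1.
    have r10 : 0 < r1 by rewrite powR_gt0// divr_gt0.
    have : (M%:E <= variation_p K mu 1 f)%E.
      apply: (@le_limf_einf_right _ _ _ (Num.min r1 2^-1)).
        by rewrite lt_min r10 invr_gt0 ltr0n.
      move=> r r0; rewrite lt_min => /andP[rr1 r2].
      rewrite invr1 poweRe1 ?ks_energy_ge0// leNgt; apply/negP => ksM.
      have [|| k /andP[k1 k2]] := @geometric_scale R 2^-1 (2 * r).
      - by rewrite invr_gt0 ltr0n/=; lra.
      - by rewrite mulr_gt0//=; lra.
      have n5 : (5 <= k + 5)%N by rewrite leq_addl.
      have s1 : 8 * 2^-1 ^+ (k + 5) < r.
        by rewrite exprD; move: k1; rewrite exprS; lra.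
      have s2 : r <= 16 * 2^-1 ^+ (k + 5) by rewrite exprD; lra.
      have r11 : r <= 1 by lra.
      have [F hA] := fine_scale_bounds1 fL n5 s1 s2 r11 (ltW ksM).
      have : (J <= fluctuation q K mu 1 f (k + 5) id)%E.
        apply: ge0_le_integral_nonmeasurable => x _; first by rewrite lee_fin.
        rewrite lee_fin powRr1// /g ge_max normr_ge0 andbT /=.
        have := hA x; rewrite -/b -/T.
        have := ler_normD (f x - cell_avg f (address q K (k + 5) x)) (cell_avg f (address q K (k + 5) x)).
        by rewrite subrK; lra.
      move=> /(le_trans jJ) /le_trans/(_ F); rewrite lee_fin leNgt => /negP; apply.
      have rd : r `^ hausdorff_dim < j / (ball_ratio * M + 1).
        rewrite -[ltRHS](@powR_root _ _ hausdorff_dim) ?gt_eqF//; last first.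
          by rewrite divr_ge0 ?(ltW j0) ?(ltW Bpos).
        rewrite [X in _ < X]powRAC -/r1 [X in _ < X](_ : _ = r1 `^ hausdorff_dim); last first.
          by rewrite /r1 powRAC.
        by rewrite gt0_ltr_powR ?nnegrE ?(ltW r0) ?(ltW r10).
      rewrite ltr_pdivlMr// in rd; apply: le_lt_trans rd.
      have := powR_ge0 r hausdorff_dim; lra.
    by rewrite VE lee_fin leNgt vM.
  have : (\int[mu]_x `|(g x)%:E| = 0)%E.
    rewrite integral_setT_gasket//; last exact: measurableT_comp.
    by rewrite -[RHS]J00; apply: eq_integral => x _; rewrite gee0_abs ?lee_fin.
  move=> /(ae_eq_integral_abs mu measurableT mg); apply: filterS => x /(_ I) [].
  by move=> /eqP; rewrite -subr_le0 eq_le ge_max => /andP[/andP[]].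
have sup n : \forall x \ae mu, `|f x| <= b + (3 * ball_ratio * 81) * (v + n.+1%:R^-1).
  by apply: main; rewrite ltrDl invr_gt0.
have := @ae_foralln _ _ _ mu _ sup.
apply: filterS => x hx; rewrite /= lee_fin.
apply: (@le_trans _ _ (b + 3 * ball_ratio * 81 * v)).
  apply/ler_addgt0Pr => e e0.
  pose n := Num.bound (3 * ball_ratio * 81 / e).
  have c0 : 0 <= 3 * ball_ratio * 81 :> R by rewrite !mulr_ge0// ltW.
  apply: (le_trans (hx n)); rewrite -addrA lerD2l mulrDr lerD2l.
  rewrite ler_pdivrMr// [e * _]mulrC -ler_pdivrMr//.
  apply: ltW; apply: (lt_trans (archi_boundP _)); first exact: (divr_ge0 c0 (ltW e0)).
  by rewrite ltr_nat.
rewrite /C mulrDl mul1r.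
have : 0 <= 3 * ball_ratio * 81 * b by rewrite !mulr_ge0// ltW.
lra.
Qed.

End Inequalities.

Theorem corollary6p10 (R : realType) (q : 'I_3 -> R * R) (K : set (R * R))
    (mu : {measure set (R * R)%type -> \bar R})
    (hq : unit_equilateral q) (hK : is_gasket q K)
    (hmu : is_gasket_measure q K mu) :
  (forall p : R, 1 < p ->
     exists2 C : R, 0 < C &
       forall f : R * R -> R,
         korevaar_schoen K mu (critical_exponent K mu p) p f ->
         let theta := nash_exponent K mu p in
         ('N[mu]_(p%:E)[EFin \o f] <=
            C%:E * ('N[mu]_(p%:E)[EFin \o f] + variation_p K mu p f) `^ theta
                 * 'N[mu]_1[EFin \o f] `^ (1 - theta))%E) /\
  (exists2 C : R, 0 < C &
     forall f : R * R -> R,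
       korevaar_schoen K mu hausdorff_dim 1 f ->
       ('N[mu]_(+oo)[EFin \o f] <=
          C%:E * ('N[mu]_1[EFin \o f] + variation_p K mu 1 f))%E).
Proof.
split=> [p p1|].
  have [C C0 hC] := nash_inequality hq hK hmu p1.
  by exists C => // f [fL _]; exact: hC.
have [C C0 hC] := sup_inequality hq hK hmu.
by exists C => // f [fL _]; exact: hC.
Qed.
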